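(* There exists a positive constant $R_0$ (not depending on $\beta$) such that, for every $\beta>0$, with $B = R_0l_0(\beta)$ in the definition of $\Xi_0$, the following hold: (i) There exist constants $C^*_1, C^*_2 >0$ that do not depend on $\beta$ such that for all $y \ge 4B$, \[ \mathbb{P}_{(0, 2B)}\left(\tau_2(y) \le \Xi_0 \right) \le C^*_1 \mathrm{e}^{-C^*_2 \beta (y-\beta)/2}. \] (ii) For all $y \ge 2B$, \[ \mathbb{P}_{(0,2B)}\left(\tau_2(y) \le \Xi_0\right) \ge (1-\mathrm{e}^{-\beta R_0l_0(\beta)})\mathrm{e}^{-\beta(y-2R_0l_0(\beta))}. \] (iii) There exists a constant $C^*(\beta)>0$ depending on $\beta$ such that for any $x \ge 18B$, \[ \mathbb{P}_{(0,2B)}\left(\tau_1(-x) \le \Xi_0\right) \le C^*(\beta) \mathrm{e}^{-(x-2\beta)^2/8}. \] (iv) There exists a constant $C^{**}(\beta) >0$ depending on $\beta$ such that for any $x \ge \beta$, \[ \mathbb{P}_{(0,2B)}\left(\inf_{t \le \Xi_0} Q_1(t) < -x\right) \ge C^{**}(\beta) \mathrm{e}^{-x^2}. \]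
   Context: Fix $\beta>0$. For an initial state $(x,y)$ with $x\le 0$, $y\ge 0$, let $(Q_1,Q_2)$ be the continuous process on $[0,\infty)$ solving \[ Q_1(t) = x + \sqrt{2}W(t) - \beta t + \int_0^t(-Q_1(s)+Q_2(s))\,ds - L(t),\qquad Q_2(t) = y + L(t) - \int_0^t Q_2(s)\,ds, \] where $W$ is a standard Brownian motion and $L$ is the unique nondecreasing nonnegative càdlàg process with $L(0)=0$ such that $Q_1(t)\le 0$ for all $t$ and $\int_0^\infty \mathbf{1}_{[Q_1(t)<0]}\,dL(t)=0$. $\mathbb{P}_{(x,y)}$ denotes probability when $(Q_1(0),Q_2(0))=(x,y)$; $\tau_i(z)=\inf\{t\ge0: Q_i(t)=z\}$ for $i=1,2$. For $B>0$, define $\alpha_0=0$, $\alpha_1=\inf\{t\ge 0: Q_2(t)=B\}$, $\alpha_2=\inf\{t>\alpha_1: Q_2(t)=2B\}$, and $\Xi_0=\alpha_2$. Let $l_0(\beta)=\max\{\beta,\beta^{-1},\beta^{-1}\log(1/\beta)\}$. *)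

(* Defs.v *)
From HB Require Import structures.
From mathcomp Require Import all_boot all_order all_algebra.
From mathcomp Require Import all_classical all_reals all_analysis.
Set Implicit Arguments. Unset Strict Implicit. Unset Printing Implicit Defensive.
Import Order.TTheory GRing.Theory Num.Theory.
Import numFieldNormedType.Exports.
Local Open Scope classical_set_scope.
Local Open Scope ring_scope.

Section Defs.
Variable R : realType.

(** Hitting time convention: inf of a set of times, inf of the empty set = +oo. *)
Definition hit (S : set R) : \bar R := ereal_inf [set t%:E | t in S].

Definition l0 (beta : R) : R :=
  Num.max beta (Num.max beta^-1 (beta^-1 * ln beta^-1)).

Definition mutually_indep {d} {T : measurableType d} (P : probability T R)
    (n : nat) (X : nat -> T -> R) : Prop :=
  forall A : nat -> set R, (forall k, measurable (A k)) ->
    fine (P (\bigcap_(k in [set k | (k < n)%N]) (X k @^-1` A k))) =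
    \prod_(k < n) fine (P (X k @^-1` A k)).

Definition standard_BM {d} {T : measurableType d} (P : probability T R)
    (W : R -> T -> R) : Prop :=
  [/\ forall w, W 0 w = 0,
      forall w, {within `[0, +oo[, continuous (fun t => W t w)},
      forall t, 0 <= t -> measurable_fun setT (W t),
      forall s t, 0 <= s -> s < t -> forall A : set R, measurable A ->
        P ((fun w => W t w - W s w) @^-1` A) = normal_prob 0 (Num.sqrt (t - s)) A
    &
      forall (n : nat) (tt : nat -> R), 0 <= tt 0%N ->
        (forall k, (k < n)%N -> tt k < tt k.+1) ->
        mutually_indep P n (fun k w => W (tt k.+1) w - W (tt k) w)].

Definition reflected_solution (beta x y : R) (W Q1 Q2 L : R -> R) : Prop :=
  [/\ {within `[0, +oo[, continuous Q1} /\
      {within `[0, +oo[, continuous Q2},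
      (L 0 = 0 /\
       (forall t, 0 <= t -> 0 <= L t) /\
       (forall s t, 0 <= s -> s <= t -> L s <= L t) /\
       (forall t, 0 <= t -> L u @[u --> t^'+] --> L t) /\
       (forall t, 0 < t -> cvg (L u @[u --> t^'-]))),
      (forall t, 0 <= t -> Q1 t <= 0),
      (* \int_0^oo 1_{Q1 t < 0} dL t = 0, as a Lebesgue-Stieltjes integral
         against the cumulative function t |-> L (max t 0) *)
      (forall F : cumulative R R, (forall t, F t = L (Num.max t 0)) ->
         (\int[lebesgue_stieltjes_measure F]_(t in [set t : R | (0 <= t)%R])
             (\1_[set t : R | (Q1 t < 0)%R] t)%:E = 0)%E) &
      forall t, 0 <= t ->
        Q1 t = x + Num.sqrt 2 * W t - beta * t
               + Rintegral lebesgue_measure `[0, t] (fun s => - Q1 s + Q2 s)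
               - L t
        /\ Q2 t = y + L t - Rintegral lebesgue_measure `[0, t] Q2].

Definition alpha1 (B : R) (Q2 : R -> R) : \bar R :=
  hit [set t | 0 <= t /\ Q2 t = B].
Definition Xi0 (B : R) (Q2 : R -> R) : \bar R :=
  hit [set t | (alpha1 B Q2 < t%:E)%E /\ Q2 t = 2 * B].
Definition tau (Q : R -> R) (z : R) : \bar R := hit [set t | 0 <= t /\ Q t = z].

End Defs.

(* Main.v *)
Require Import Defs.
From HB Require Import structures.
From mathcomp Require Import all_boot all_order all_algebra.
From mathcomp Require Import all_classical all_reals all_analysis.
From mathcomp Require Import measurable_realfun ring lra.
Import Order.TTheory GRing.Theory Num.Theory.
Import numFieldNormedType.Exports.
Local Open Scope classical_set_scope.
Local Open Scope ring_scope.

(** Put [X = - Q1] and [S = Q1 + Q2]; then [dS = sqrt 2 dW + (X - beta) dt] and the reflection acts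
    on [X] only. The reflected Euler scheme driven by the increments of [W] converges to [(X, S)]
    uniformly on compact time intervals, path by path, so every event is a limit of events of a
    Markov chain with independent Gaussian increments, for which a one-step inequality
    [E V(z') <= c V(z)] gives [E V(z_n) <= c ^ n V(z_0)]; neither stochastic calculus nor the strong
    Markov property is needed. With [B >= 4 (beta + 1 / beta)]:
    - [exp (beta / 4 * (S + X ^ 2 / (4 (beta + 1 / beta))))] is a supermartingale while [Q2 >= B],
      which bounds the probability that [Q2] reaches [y] before [B];
    - [Q2] dominates [2 B + sqrt 2 W t - beta t], which reaches [y] before [B] with at least the
      probability given by its scale function [exp (beta z)];
    - [exp (X ^ 2 / 8)], corrected by the function above while [Q2 >= B] and by
      [1 - exp (- (S - m) ^ 2 / 2)] while [Q2 <= 2 B], decays exponentially in mean. Hence [Xi0] is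
      almost surely finite, and summing over the integer part of the first hitting time of [B]
      yields the Gaussian upper tail of [X];
    - up to time [1 / 2] the cycle cannot end, since [Q2 t >= 2 B (1 - t)], and [X] stays above an
      Ornstein-Uhlenbeck process minus [2 B], whose variance at time [1 / 2] exceeds [1 / 2]. *)

(** * Gaussian integrals *)

(** Two obstacles shape the estimates. One-step inequalities for the scheme hold up to an error of
    order [h ^ 2] that is uniform only on bounded sets. The chain is therefore killed on leaving a
    box of size [K], the test functions are at least 1 where a strict decay must absorb the error,
    and the mesh tends to 0 before [K] tends to infinity. Moreover, the scheme is only uniformly
    close to the solution, so it cannot be asked to meet a level exactly: every inclusion of a
    continuous event in discrete ones needs slack. In the upper tail of [X] the slack is the
    [2 * beta] of the exponent, in that of [Q2] it is a loss of [B] in the level, in the lower tail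
    of [X] a shift of the level by a constant. The lower bound for [Q2] has a prescribed constant;
    there the slack comes from the strictness of the scale function estimate, by perturbing all
    parameters at once. *)

Section gaussian.
Context {R : realType}.
Local Notation mu := (@lebesgue_measure R).

(** The Radon-Nikodym derivative of [normal_prob] and [normal_pdf] have the same integral over every
    measurable set, so they agree almost everywhere. *)
Lemma ge0_integral_normal_prob (m s : R) (f : R -> \bar R) :
  (forall x, 0 <= f x)%E -> measurable_fun setT f ->
  (\int[normal_prob m s]_x f x = \int[mu]_x (f x * (normal_pdf m s x)%:E))%E.
Proof.
move=> f0 mf.
have dom := normal_prob_dominates m s.
rewrite -(Radon_Nikodym_SigmaFinite.change_of_variables dom)//.
apply: ae_eq_integral => //.
- apply: emeasurable_funM => //.
  exact: measurable_int (Radon_Nikodym_SigmaFinite.f_integrable dom).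
- apply: emeasurable_funM => //; apply/measurable_EFinP.
  exact: measurable_normal_pdf.
- apply: ae_eqe_mul2l => /=.
  apply: integral_ae_eq => //=.
  + exact: Radon_Nikodym_SigmaFinite.f_integrable dom.
  + by apply/measurable_EFinP; exact: measurable_normal_pdf.
  + by move=> E _ mE; rewrite -Radon_Nikodym_SigmaFinite.f_integral.
Qed.

(** Completing the square: the exponential of a quadratic tilts a centred Gaussian density into
    another one, with mean [a * v / d] and variance [v / d]. The prefactor is then the integral, and
    [0 < d] is the condition of integrability. *)
Lemma expR_quad_normal_pdf (v a c x : R) : 0 < v -> 0 < 1 - 2 * c * v ->
  let d := 1 - 2 * c * v in
  expR (a * x + c * x ^+ 2) * normal_pdf 0 (Num.sqrt v) x
  = (Num.sqrt d)^-1 * expR (a ^+ 2 * v / (2 * d))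
    * normal_pdf (a * v / d) (Num.sqrt (v / d)) x.
Proof.
move=> v0 d0 d; have {}d0 : 0 < d by [].
have d0' : d != 0 by rewrite gt_eqF.
have v0' : v != 0 by rewrite gt_eqF.
have w0 : 0 < v / d by rewrite divr_gt0.
rewrite !normal_pdfE ?gt_eqF ?sqrtr_gt0// /normal_fun /normal_peak.
rewrite !sqr_sqrtr ?ltW//.
have -> : v / d * pi *+ 2 = (v * pi *+ 2) * d^-1.
  by rewrite mulrAC mulrnAl.
rewrite sqrtrM; last by rewrite mulrn_wge0// mulr_ge0 ?pi_ge0// ltW.
rewrite sqrtrV ?ltW// [(_ * (Num.sqrt d)^-1)^-1]invfM invrK.
set p := (Num.sqrt (v * pi *+ 2))^-1.
have sd0 : Num.sqrt d != 0 by rewrite gt_eqF// sqrtr_gt0.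
set e := Num.sqrt d in sd0 *.
move: p e sd0 => p e sd0.
rewrite mulrCA -expRD.
have -> : forall y z, e^-1 * expR y * (p * e * expR z) = p * (expR y * expR z).
  move=> y z; move: (expR y) (expR z) => y' z'.
  by rewrite mulrACA [p * e]mulrC mulKf.
rewrite -expRD; congr (p * expR _).
rewrite -(mulr_natr v) -(mulr_natr (v / d)) /d; field.
by rewrite v0' d0'.
Qed.

Lemma integral_normal_expR_quad (v a c : R) : 0 < v -> 0 < 1 - 2 * c * v ->
  (\int[normal_prob 0%R (Num.sqrt v)]_x (expR (a * x + c * x ^+ 2))%:E
   = ((Num.sqrt (1 - 2 * c * v))^-1
      * expR (a ^+ 2 * v / (2 * (1 - 2 * c * v))))%:E)%E.
Proof.
move=> v0 d0.
rewrite ge0_integral_normal_prob; last 2 first.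
- by move=> x; rewrite lee_fin expR_ge0.
- apply/measurable_EFinP; apply: measurableT_comp => //.
  by apply: measurable_funD; apply: measurable_funM => //; exact: measurable_funX.
under eq_integral do rewrite -EFinM expR_quad_normal_pdf// EFinM.
rewrite ge0_integralZl//=; first by rewrite integral_normal_pdf mule1.
- by apply/measurable_EFinP; exact: measurable_normal_pdf.
- by move=> x _; rewrite lee_fin normal_pdf_ge0.
Qed.

Lemma integral_normal_expR (v a k : R) : 0 < v ->
  (\int[normal_prob 0%R (Num.sqrt v)]_x (expR (a * x + k))%:E = (expR (a ^+ 2 * v / 2 + k))%:E)%E.
Proof.
move=> v0.
have E x : expR (a * x + k) = expR k * expR (a * x + 0 * x ^+ 2).
  by rewrite -expRD mul0r addr0 addrC.
under eq_integral do rewrite E EFinM.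
rewrite ge0_integralZl//=; last first.
  apply/measurable_EFinP; apply: measurableT_comp => //.
  by apply: measurable_funD; apply: measurable_funM => //; exact: measurable_funX.
have c0 : 1 - 2 * 0 * v = 1 by rewrite mulr0 mul0r subr0.
rewrite integral_normal_expR_quad// c0// sqrtr1 invr1 mul1r mulr1 -EFinM -expRD.
by rewrite addrC.
Qed.

End gaussian.

(** * Chains driven by independent noise *)

Section markov_chain.
Context {R : realType} {d : measure_display} {T : measurableType d}.
Context {dY : measure_display} {Y : measurableType dY}.
Variables (P : probability T R) (n : nat) (D : nat -> T -> Y).
Variable gam : probability Y R.
Hypothesis mD : forall k, measurable_fun setT (D k).
Hypothesis D_indep : forall A : nat -> set Y, (forall k, measurable (A k)) ->
  fine (P (\bigcap_(k in [set k | (k < n)%N]) (D k @^-1` A k))) =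
  \prod_(k < n) fine (P (D k @^-1` A k)).
Hypothesis D_law : forall k (A : set Y), (k < n)%N -> measurable A ->
  P (D k @^-1` A) = gam A.

Context {dS : measure_display} {S : measurableType dS}.
Variables (F : nat -> S * Y -> S) (z0 : S).
Hypothesis mF : forall k, measurable_fun setT (F k).

Fixpoint chain (k : nat) (w : T) : S :=
  if k is k'.+1 then F k' (chain k' w, D k' w) else z0.

Lemma measurable_chain k : measurable_fun setT (chain k).
Proof.
elim: k => [|k ih] /=; first exact: measurable_cst.
apply: measurableT_comp => //.
by apply: measurable_fun_pair => //; exact: mD.
Qed.

(** Constrains only the noises of index at least [k], but is written as an intersection over all
    indices so that [D_indep] applies to it directly. *)
Let future k (C : nat -> set Y) : set T :=
  \bigcap_(i in [set i | (i < n)%N])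
    (D i @^-1` (if (i < k)%N then setT else C i)).

Let measurable_future k C : (forall i, measurable (C i)) ->
  measurable (future k C).
Proof.
move=> mC; apply: bigcap_measurableType => i _.
by rewrite -[X in measurable X]setTI; apply: mD => //; case: ifP.
Qed.

Let future_split k (C : nat -> set Y) B : (k < n)%N ->
  (forall i, measurable (C i)) -> measurable B ->
  P (D k @^-1` B `&` future k.+1 C)
  = (gam B * P (future k.+1 C))%E.
Proof.
move=> kn mC mB.
pose C' i := if i == k then B else if (i < k.+1)%N then setT else C i.
pose C1 i := if (i < k.+1)%N then setT else C i.
have mC1 i : measurable (C1 i) by rewrite /C1; case: ifP.
have mC' i : measurable (C' i) by rewrite /C'; case: ifP => // _; exact: mC1.
have -> : D k @^-1` B `&` future k.+1 C
    = \bigcap_(i in [set i | (i < n)%N]) (D i @^-1` C' i).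
  apply/seteqP; split => [w [Bw fw] i /= iN|w fw].
    by rewrite /C'; case: eqP => [->//|_]; exact: (fw i).
  split; first by have := fw k kn; rewrite /= /C' eqxx.
  move=> i /= iN; have := fw i iN; rewrite /= /C'.
  by case: eqP => // ->; rewrite ltnSn.
have fin A : measurable A -> P A = (fine (P A))%:E.
  by move=> mA; rewrite fineK// fin_num_measure.
have m1 : measurable (\bigcap_(i in [set i | (i < n)%N]) (D i @^-1` C' i)).
  apply: bigcap_measurable => [|i _]; first by exists k.
  by rewrite -[X in measurable X]setTI; exact: mD.
have m2 := measurable_future k.+1 C mC.
rewrite (fin _ m1) (fin _ m2) (D_indep _ mC').
rewrite (_ : fine (P (future k.+1 C)) = \prod_(i < n) fine (P (D i @^-1` C1 i))); last first.
  exact: (D_indep _ mC1).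
rewrite (bigD1 (Ordinal kn))//= [in RHS](bigD1 (Ordinal kn))//=.
rewrite /C' eqxx /C1 ltnSn preimage_setT probability_setT/= mul1r.
rewrite -(D_law k)// (fin (D k @^-1` B)); last first.
  by rewrite -[X in measurable X]setTI; exact: mD.
rewrite -EFinM/=; congr (_ * _)%:E; apply: eq_bigr => i ik.
by rewrite /C' ifN.
Qed.

Let Dk_pair k w : S * Y := (chain k w, D k w).

Let mpair k : measurable_fun setT (Dk_pair k).
Proof.
apply: measurable_fun_pair.
  exact: measurable_chain.
exact: mD.
Qed.

Let chainRV k : {mfun T >-> S} :=
  HB.pack (chain k) (isMeasurableFun.Build _ _ _ _ _ (measurable_chain k)).

Let law k : probability S R := distribution P (chainRV k).

Let indep_future k := forall A C, measurable A -> (forall i, measurable (C i)) ->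
  P (chain k @^-1` A `&` future k C) = (P (chain k @^-1` A) * P (future k C))%E.

(** Both sides are finite measures in [E]. They agree on rectangles, which are stable under
    intersection and generate the product sigma-algebra, hence everywhere. *)
Let joint_law k : (k < n)%N -> indep_future k -> forall C E,
  (forall i, measurable (C i)) -> measurable E ->
  P (Dk_pair k @^-1` E `&` future k.+1 C)
  = (P (future k.+1 C) * (law k \x gam)%E E)%E.
Proof.
move=> kn ik C E mC mE.
have mG := measurable_future k.+1 C mC.
pose p := fine (P (future k.+1 C)).
have p0 : 0 <= p by apply: fine_ge0; exact: measure_ge0.
have pE : P (future k.+1 C) = p%:E by rewrite /p fineK// fin_num_measure.
have mres := mpair k.
pose m1 : {measure set (S * Y) -> \bar R} :=
  measure_function_pushforward__canonical__measure_function_Measure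
    (mrestr P mG) mres.
pose m2 : {measure set (S * Y) -> \bar R} := mscale (NngNum p0) (law k \x gam)%E.
pose G : set (set (S * Y)) :=
  [set E | exists A, measurable A /\ exists B, measurable B /\ E = A `*` B].
have GI : setI_closed G.
  move=> /= _ _ [X1 [mX1 [X2 [mX2 ->]]]] [Y1 [mY1 [Y2 [mY2 ->]]]].
  rewrite -setXI; exists (X1 `&` Y1); split; first exact: measurableI.
  by exists (X2 `&` Y2); split => //; exact: measurableI.
rewrite pE -[LHS]/(m1 E) -[RHS]/(m2 E).
apply: (measure_unique G (fun=> setT)) => //.
- rewrite measurable_prod_measurableType //; congr (<<s _ >>).
  rewrite predeqE => Z; split => [[A mA [B mB <-]]|[A [mA [B [mB ->]]]]].
    by exists A; split => //; exists B.
  by exists A => //; exists B.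
- by move=> _; exists setT; split => //; exists setT; split => //; rewrite setXTT.
- by rewrite bigcup_const//; exists 0%N.
- move=> _ [A [mA [B [mB ->]]]].
  (* Requiring [D k] to lie in [B] turns [future k.+1 C] into [future k C'], to which the assumed
     independence of [chain k] applies. *)
  pose C' i := if i == k then B else if (i < k.+1)%N then setT else C i.
  have mC' i : measurable (C' i) by rewrite /C'; do 2 case: ifP => // _.
  have fE : future k C' = D k @^-1` B `&` future k.+1 C.
    apply/seteqP; split => [w fw|w [Bw fw] i /= iN].
      split; first by have := fw k kn; rewrite /= ltnn /C' eqxx.
      by move=> i /= iN; have := fw i iN; rewrite /= /C' ltnS; case: (ltngtP i k).
    have := fw i iN; rewrite /= /C' ltnS; case: (ltngtP i k) => //= ik'.
    by rewrite ik'.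
  transitivity (P (chain k @^-1` A `&` future k C')).
    by rewrite fE setIA.
  rewrite (ik A C')// fE future_split// pE.
  have -> : m2 (A `*` B) = (p%:E * (P (chain k @^-1` A) * gam B))%E.
    by rewrite /m2/= /mscale/= product_measure1E.
  by rewrite [(gam B * p%:E)%E]muleC muleCA.
- move=> _; have -> : m1 setT = P (future k.+1 C).
    by rewrite /m1/= /pushforward /mrestr preimage_setT setTI.
  by rewrite pE ltry.
Qed.

Let futureT k : future k (fun=> setT) = setT.
Proof.
by apply/seteqP; split => // w _ i _; rewrite /=; case: ifP.
Qed.

Let chain_indep_future k : (k <= n)%N -> indep_future k.
Proof.
elim: k => [|k ih] kn A C mA mC.
  have [Az|Az] := pselect (A z0).
    rewrite (_ : chain 0 @^-1` A = setT); last by apply/seteqP; split.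
    by rewrite setTI probability_setT mul1e.
  rewrite (_ : chain 0 @^-1` A = set0); last by apply/seteqP; split.
  by rewrite set0I measure0 mul0e.
have ik := ih (ltnW kn).
have mE : measurable (F k @^-1` A) by rewrite -[X in measurable X]setTI; exact: mF.
have E : chain k.+1 @^-1` A = Dk_pair k @^-1` (F k @^-1` A) by [].
have := joint_law k kn ik (fun=> setT) _ (fun=> measurableT) mE.
rewrite futureT setIT probability_setT mul1e -E => ->.
by rewrite E joint_law// muleC.
Qed.

Lemma integral_chainS k (f : S -> \bar R) : (k < n)%N ->
  measurable_fun setT f -> (forall z, 0 <= f z)%E ->
  (\int[P]_w f (chain k.+1 w)
   = \int[P]_w \int[gam]_u f (F k (chain k w, u)))%E.
Proof.
move=> kn mf f0.
have mfF : measurable_fun setT (f \o F k) by exact: measurableT_comp.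
pose pRV : {mfun T >-> (S * Y)%type} :=
  HB.pack (Dk_pair k) (isMeasurableFun.Build _ _ _ _ _ (mpair k)).
transitivity (\int[distribution P pRV]_z (f \o F k) z)%E.
  by rewrite ge0_integral_distribution// => z; exact: f0.
transitivity (\int[(law k \x gam)%E]_z (f \o F k) z)%E.
  apply: eq_measure_integral => E mE _.
  have := joint_law k kn (chain_indep_future k (ltnW kn)) (fun=> setT) _ (fun=> measurableT) mE.
  by rewrite futureT setIT probability_setT mul1e.
rewrite fubini_tonelli1//; last by move=> z; exact: f0.
rewrite ge0_integral_distribution//.
- by apply: measurable_fun_fubini_tonelli_F => // z; exact: f0.
- by move=> z; apply: integral_ge0 => u _; exact: f0.
Qed.

(** [V] and [c] may depend on the step; this is what later allows different test functions on
    successive time intervals. *)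
Lemma integral_chain_le (V : nat -> S -> R) (c : nat -> R) :
  (forall k, measurable_fun setT (V k)) -> (forall k z, 0 <= V k z) ->
  (forall k, 0 <= c k) ->
  (forall k z, (k < n)%N ->
    \int[gam]_u (V k.+1 (F k (z, u)))%:E <= (c k * V k z)%:E)%E ->
  (\int[P]_w (V n (chain n w))%:E <= ((\prod_(k < n) c k) * V 0 z0)%:E)%E.
Proof.
move=> mV V0 c0 cV.
suff H : forall k, (k <= n)%N ->
  (\int[P]_w (V k (chain k w))%:E <= ((\prod_(i < k) c i) * V 0 z0)%:E)%E by exact: H.
elim => [|k ih] kn.
  by rewrite big_ord0 mul1r /= integral_cst//= probability_setT mule1.
have mVE : measurable_fun setT (fun z => (V k.+1 z)%:E).
  by apply/measurable_EFinP; exact: mV.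
rewrite (integral_chainS k (fun z => (V k.+1 z)%:E) kn mVE) => [|z]; last first.
  by rewrite lee_fin.
apply: (@le_trans _ _ (\int[P]_w (c k * V k (chain k w))%:E)%E).
  apply: ge0_le_integral => //.
  - by move=> w _; apply: integral_ge0 => u _; rewrite lee_fin.
  - have mI : measurable_fun setT (fun z => (\int[gam]_u (V k.+1 (F k (z, u)))%:E)%E).
      apply: (measurable_fun_fubini_tonelli_F (fun zu => (V k.+1 (F k zu))%:E)).
        by apply/measurable_EFinP; exact: measurableT_comp.
      by move=> zu; rewrite lee_fin.
    by apply: (measurableT_comp mI); exact: measurable_chain.
  - apply/measurable_EFinP; apply: measurable_funM => //.
    by apply: measurableT_comp => //; exact: measurable_chain.
  - by move=> w _; exact: cV.
under eq_integral do rewrite EFinM.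
rewrite ge0_integralZl//; last 3 first.
- by apply/measurable_EFinP; apply: measurableT_comp => //; exact: measurable_chain.
- by move=> w _; rewrite lee_fin.
- by rewrite lee_fin.
rewrite big_ord_recr/= [X in (X * _)%R]mulrC -mulrA EFinM.
apply: lee_wpmul2l; first by rewrite lee_fin.
by apply: ih; exact: ltnW.
Qed.

Lemma integral_chain_eq (V : nat -> S -> R) (c : nat -> R) :
  (forall k, measurable_fun setT (V k)) -> (forall k z, 0 <= V k z) ->
  (forall k, 0 <= c k) ->
  (forall k z, (k < n)%N ->
    \int[gam]_u (V k.+1 (F k (z, u)))%:E = (c k * V k z)%:E)%E ->
  (\int[P]_w (V n (chain n w))%:E = ((\prod_(k < n) c k) * V 0 z0)%:E)%E.
Proof.
move=> mV V0 c0 cV.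
suff H : forall k, (k <= n)%N ->
  (\int[P]_w (V k (chain k w))%:E = ((\prod_(i < k) c i) * V 0 z0)%:E)%E by exact: H.
elim => [|k ih] kn.
  by rewrite big_ord0 mul1r /= integral_cst//= probability_setT mule1.
have mVE : measurable_fun setT (fun z => (V k.+1 z)%:E).
  by apply/measurable_EFinP; exact: mV.
rewrite (integral_chainS k (fun z => (V k.+1 z)%:E) kn mVE) => [|z]; last first.
  by rewrite lee_fin.
under eq_integral do rewrite cV// EFinM.
rewrite ge0_integralZl//; last 3 first.
- by apply/measurable_EFinP; apply: measurableT_comp => //; exact: measurable_chain.
- by move=> w _; rewrite lee_fin.
- by rewrite lee_fin.
by rewrite (ih (ltnW kn)) big_ord_recr/= -EFinM mulrA [c k * _]mulrC.
Qed.

End markov_chain.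

(** * Fatou inequalities for events *)

Section limits_of_events.
Context {R : realType} {d : measure_display} {T : measurableType d}.
Variable P : probability T R.
Local Open Scope ereal_scope.

(** Fatou for the lower limit of events: the tail intersections [G n] increase, and each has at most
    the probability of [F n]. *)
Lemma measure_eventually_le (E : set T) (F : nat -> set T) (c : \bar R) (n0 : nat) :
  measurable E -> (forall n, measurable (F n)) ->
  (forall w, E w -> exists n, forall k, (n <= k)%N -> F k w) ->
  (forall n, (n0 <= n)%N -> P (F n) <= c) -> P E <= c.
Proof.
move=> mE mF EF Fc.
pose G n := \bigcap_(k in [set k | (n <= k)%N]) F k.
have mG n : measurable (G n) by exact: bigcap_measurableType.
have ndG : nondecreasing_seq G.
  move=> m n mn; apply/subsetPset => w Gw k /= nk; apply: Gw => /=.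
  exact: leq_trans nk.
have EG : E `<=` \bigcup_n G n.
  by move=> w /EF[n Hn]; exists n => // k /= /Hn.
have mUG : measurable (\bigcup_n G n) by exact: bigcupT_measurable.
apply: (@le_trans _ _ (P (\bigcup_n G n))).
  by apply: le_measure; rewrite ?inE.
have cv : (P \o G) n @[n --> \oo] --> P (\bigcup_n G n).
  exact: nondecreasing_cvg_mu.
rewrite -(cvg_lim _ cv)//; apply: lime_le.
  by apply/cvg_ex; exists (P (\bigcup_n G n)).
near=> n.
apply: (@le_trans _ _ (P (F n))); last by apply: Fc; near: n; exists n0.
by apply: le_measure; rewrite ?inE// => w; apply => /=.
Unshelve. all: by end_near. Qed.

(** Reverse Fatou, valid because [P] is finite: the tail unions decrease to the upper limit of the
    events. *)
Lemma measure_infinitely_often_ge (E : set T) (F : nat -> set T) (c : \bar R) (n0 : nat) :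
  measurable E -> (forall n, measurable (F n)) ->
  (forall w, (forall n, exists2 k, (n <= k)%N & F k w) -> E w) ->
  (forall n, (n0 <= n)%N -> c <= P (F n)) -> c <= P E.
Proof.
move=> mE mF EF Fc.
have mL : measurable (lim_sup_set F).
  by apply: bigcapT_measurable => n; apply: bigcup_measurable => k _.
apply: (@le_trans _ _ (P (lim_sup_set F))); last first.
  apply: le_measure; rewrite ?inE// => w Lw; apply: EF => n.
  by have [k nk Fk] := Lw n Logic.I; exists k.
have cv : P (\bigcup_(k >= n) F k) @[n --> \oo] --> P (lim_sup_set F).
  apply: lim_sup_set_cvg => //.
  by rewrite (le_lt_trans (probability_le1 _ _)) ?ltry//; exact: bigcup_measurable.
rewrite -(cvg_lim _ cv)//; apply: lime_ge; first by apply/cvg_ex; exists (P (lim_sup_set F)).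
near=> n.
apply: (@le_trans _ _ (P (F n))); first by apply: Fc; near: n; exists n0.
apply: le_measure; rewrite ?inE//; first exact: bigcup_measurable.
by move=> w Fw; exists n => //=.
Unshelve. all: by end_near. Qed.

End limits_of_events.

(** * Killed and frozen chains *)

Section killed_chain.
Context {R : realType} {d : measure_display} {T : measurableType d}.
Context {dY : measure_display} {Y : measurableType dY}.
Variables (P : probability T R) (n : nat) (D : nat -> T -> Y).
Variable gam : probability Y R.
Hypothesis mD : forall k, measurable_fun setT (D k).
Hypothesis D_indep : forall A : nat -> set Y, (forall k, measurable (A k)) ->
  fine (P (\bigcap_(k in [set k | (k < n)%N]) (D k @^-1` A k))) =
  \prod_(k < n) fine (P (D k @^-1` A k)).
Hypothesis D_law : forall k (A : set Y), (k < n)%N -> measurable A ->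
  P (D k @^-1` A) = gam A.
Context {dS : measure_display} {S : measurableType dS}.
Variables (step : S * Y -> S) (z0 : S) (alive frozen : nat -> S -> bool).
Hypothesis mstep : measurable_fun setT step.
Hypothesis malive : forall k, measurable_fun setT (alive k).
Hypothesis mfrozen : forall k, measurable_fun setT (frozen k).

(* A frozen state no longer moves; otherwise the chain is killed (second
   component [false]) as soon as it tries to move from a state that is not alive. *)
Definition kstep (k : nat) (zu : (S * bool) * Y) : S * bool :=
  if frozen k zu.1.1 then zu.1
  else if alive k zu.1.1 && zu.1.2 then (step (zu.1.1, zu.2), true)
  else (zu.1.1, false).

Lemma measurable_kstep k : measurable_fun setT (kstep k).
Proof.
have m11 : measurable_fun setT (fun zu : (S * bool) * Y => zu.1.1).
  exact: (measurableT_comp measurable_fst measurable_fst).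
have m12 : measurable_fun setT (fun zu : (S * bool) * Y => zu.1.2).
  exact: (measurableT_comp measurable_snd measurable_fst).
apply: measurable_fun_ifT.
- exact: (measurableT_comp (mfrozen k) m11).
- exact: measurable_fst.
- apply: measurable_fun_ifT.
  + apply: measurable_and => //; exact: (measurableT_comp (malive k) m11).
  + apply: measurable_fun_pair => //.
    apply: (measurableT_comp mstep); apply: measurable_fun_pair => //.
  + exact: measurable_fun_pair.
Qed.

Definition kchain : nat -> T -> S * bool := chain D kstep (z0, true).
Definition pchain : nat -> T -> S := chain D (fun=> step) z0.

(** Along a path whose free chain stays alive, the killed chain follows it until it freezes. This
    transfers events of the free scheme to the chain for which the moment bounds hold. *)
Lemma kchain_alive k w :
  (forall j z, (j < k)%N -> frozen j z -> frozen j.+1 z) ->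
  (forall j, (j < k)%N -> alive j (pchain j w)) ->
  (kchain k w).2 /\ ((kchain k w).1 = pchain k w \/ frozen k (kchain k w).1).
Proof.
move=> fr; elim: k fr => [|k ih] fr al; first by split=> //; left.
have [a b] := ih (fun j z jk => fr j z (ltnW jk)) (fun j jk => al j (ltnW jk)).
rewrite /kchain /= -/(kchain k w) /kstep /=.
have [f|nf] := boolP (frozen k (kchain k w).1).
  by split => //; right; exact: fr.
case: b => [e|f]; last by rewrite f in nf.
rewrite e al//= a /=; split => //; left; by [].
Qed.

Lemma kchain_bound (V : nat -> S -> R) (c : nat -> R) (tg : S -> bool) (m : R) :
  (forall k, measurable_fun setT (V k)) -> (forall k z, 0 <= V k z) ->
  (forall k, 0 <= c k) -> measurable_fun setT tg -> 0 < m ->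
  (forall k z, (k < n)%N -> alive k z -> ~~ frozen k z ->
    \int[gam]_u (V k.+1 (step (z, u)))%:E <= (c k * V k z)%:E)%E ->
  (forall k z, (k < n)%N -> frozen k z -> V k.+1 z <= c k * V k z) ->
  (forall z, tg z -> m <= V n z) ->
  measurable [set w | (kchain n w).2 && tg (kchain n w).1] /\
  (P [set w | (kchain n w).2 && tg (kchain n w).1]
   <= ((\prod_(k < n) c k) * V 0 z0 / m)%:E)%E.
Proof.
move=> mV V0 c0 mtg m0 HV Hf Htg.
(* Killed states weigh nothing, so the one-step inequality is only required at states that are
   alive; the claim is then Markov's inequality at step [n]. *)
pose V' k (zb : S * bool) := if zb.2 then V k zb.1 else 0.
have mV' k : measurable_fun setT (V' k).
  apply: measurable_fun_ifT => //.
  exact: (measurableT_comp (mV k) measurable_fst).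
have V'0 k z : 0 <= V' k z by rewrite /V'; case: ifP.
have mk : measurable_fun setT (kchain n).
  by apply: measurable_chain => //; exact: measurable_kstep.
have mb : measurable_fun setT (fun w => (kchain n w).2 && tg (kchain n w).1).
  apply: measurable_and.
    exact: (measurableT_comp measurable_snd mk).
  exact: (measurableT_comp mtg (measurableT_comp measurable_fst mk)).
have mE : measurable [set w | (kchain n w).2 && tg (kchain n w).1].
  have := mb measurableT [set true] I; rewrite setTI.
  by congr measurable; apply/seteqP; split => w /=.
split => //.
have key : (\int[P]_w (V' n (kchain n w))%:E <= ((\prod_(k < n) c k) * V' 0 (z0, true))%:E)%E.
  apply: (integral_chain_le P n D gam mD D_indep D_law kstep (z0, true) measurable_kstep V' c) => //.
  move=> k [z b] kn; rewrite /kstep /=.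
  have [f|nf] := boolP (frozen k z).
    rewrite /V' /=; case: b => /=; last first.
      by rewrite integral0 mulr0.
    by rewrite integral_cst//= probability_setT mule1 lee_fin Hf.
  case: (boolP (alive k z && b)) => [/andP[al ->]|_].
    exact: HV.
  by rewrite /V'/= integral0 lee_fin mulr_ge0//; case: ifP.
have mi : (m%:E * P [set w | (kchain n w).2 && tg (kchain n w).1]
   <= \int[P]_w (V' n (kchain n w))%:E)%E.
  have -> : P [set w | (kchain n w).2 && tg (kchain n w).1]
      = (\int[P]_w (\1_[set w | (kchain n w).2 && tg (kchain n w).1] w)%:E)%E.
    by rewrite integral_indic// setIT.
  rewrite -ge0_integralZl//=; last 2 first.
  - by apply/measurable_EFinP; exact: measurable_indic.
  - by rewrite lee_fin ltW.
  apply: ge0_le_integral => //.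
  - by move=> w _; rewrite -EFinM lee_fin mulr_ge0// ltW.
  - by apply: measurable_funeM; apply/measurable_EFinP; exact: measurable_indic.
  - by apply/measurable_EFinP; exact: measurableT_comp.
  - move=> w _; rewrite -EFinM lee_fin indicE.
    have [|] := boolP (w \in _); last by rewrite mulr0.
    by rewrite inE/= => /andP[kb tgw]; rewrite mulr1 /V' kb; exact: Htg.
rewrite EFinM lee_pdivlMr// muleC (le_trans mi)//.
Qed.

End killed_chain.

(** * Paths of the solution and the Euler scheme *)

Section paths.
Context {R : realType}.
Local Notation mu := (@lebesgue_measure R).

(* Paths live on [0, +oo[; extending them by a constant to the left makes them
   continuous on the whole line. *)
Definition clamp (f : R -> R) : R -> R := fun t => f (Num.max t 0).

Lemma clampE (f : R -> R) t : 0 <= t -> clamp f t = f t.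
Proof. by move=> t0; rewrite /clamp max_l. Qed.

Lemma continuous_clamp (f : R -> R) :
  {within `[0, +oo[, continuous f} -> continuous (clamp f).
Proof.
move=> /continuous_within_itvcyP[fi f0] t.
apply/cvgrPdist_lt => e e0; have [t0|t0|t0] := ltgtP t 0.
- near=> u; rewrite /clamp !max_r ?subrr ?normr0 ?ltW//.
  by near: u; exact: lt_nbhsl.
- have /cvgrPdist_lt/(_ e e0) ft : {for t, continuous f}.
    by apply: fi; rewrite in_itv/= t0.
  near=> u; rewrite /clamp !max_l ?ltW//; first by near: u.
  by near: u; exact: lt_nbhsr.
- rewrite t0; move/cvgrPdist_lt : f0 => /(_ e e0) [d /= d0 H].
  exists d => //= u ud; rewrite {1}/clamp maxxx /clamp.
  have [u0|u0] := ltP 0 u; last by rewrite subrr normr0.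
  exact: H.
Unshelve. all: by end_near. Qed.

Lemma continuous_clamp_within (f : R -> R) a b : 0 <= a ->
  continuous (clamp f) -> {within `[a, b], continuous f}.
Proof.
move=> a0 cf.
apply: (@subspace_eq_continuous _ _ _ (clamp f)).
  move=> t; rewrite inE/= in_itv/= => /andP[at_ _].
  by rewrite clampE// (le_trans a0).
exact: continuous_subspaceT.
Qed.

(** Only [t] is confined to the segment. With [a = b] this is continuity at a point, and it is used
    in that form as well. *)
Lemma segment_unif_continuous (f : R -> R) (a b e : R) :
  continuous f -> 0 < e ->
  exists2 d, 0 < d & forall t, a <= t <= b -> forall u, `|u - t| < d ->
    `|f u - f t| < e.
Proof.
move=> cf e0.
have /compact_near_coveringP/(_ _ (0:R)^'+
  (fun d t => forall u, `|u - t| < d -> `|f u - f t| < e)) := @segment_compact _ a b.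
case.
  move=> t _.
  have e2 : 0 < e / 2 by rewrite divr_gt0.
  have /cvgrPdist_lt/(_ _ e2)[d /= d0 H] := cf t.
  exists (ball t (d / 2), [set x | x < d / 2]); first split => /=.
  - by exists (d / 2) => //=; rewrite divr_gt0.
  - by exists (d / 2) => /=; [rewrite divr_gt0| move=> x /=; rewrite sub0r normrN => /ltr_normlW].
  move=> [s x] [/= ts xd] u us.
  have ts' : `|t - s| < d / 2 by [].
  have h1 : `|f t - f s| < e / 2 by apply: H => /=; rewrite (lt_le_trans ts')//; lra.
  have h2 : `|f t - f u| < e / 2.
    apply: H => /=; rewrite (splitr d) (le_lt_trans (ler_distD s _ _))// ltrD// distrC.
    exact: lt_trans us xd.
  rewrite (splitr e) (le_lt_trans (ler_distD (f t) _ _))// ltrD// distrC//.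
move=> d /= d0 H; exists (d / 2); first by rewrite divr_gt0.
move=> t tab; apply: (H (d / 2)) => //=.
- rewrite sub0r normrN gtr0_norm ?divr_gt0//.
  lra.
- by rewrite divr_gt0.
Qed.

Lemma clamp_integrable (f : R -> R) b : continuous (clamp f) ->
  mu.-integrable `[0, b] (EFin \o f).
Proof.
move=> cf; apply: continuous_compact_integrable; first exact: segment_compact.
exact: continuous_clamp_within.
Qed.

Lemma Rintegral_increment (f : R -> R) (a b c e : R) : continuous (clamp f) ->
  0 <= a -> a <= b -> (forall t, a <= t <= b -> `|f t - c| <= e) ->
  `|(Rintegral mu `[0, b] f - Rintegral mu `[0, a] f) - c * (b - a)|
    <= e * (b - a).
Proof.
move=> cf a0 ab H.
rewrite Rintegral_itvB//; last exact: clamp_integrable.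
have itf : mu.-integrable `]a, b] (EFin \o f).
  apply: integrableS (clamp_integrable f b cf) => //.
  by apply: subset_itvr; rewrite bnd_simp.
have cst_int r : mu.-integrable `]a, b] (EFin \o cst r).
  apply: (@integrableS _ _ _ mu `[a, b]) => //; first exact: subset_itv_oc_cc.
  apply: continuous_compact_integrable; first exact: segment_compact.
  by move=> x; exact: cvg_cst.
have mab : fine (mu `]a, b]) = b - a.
  rewrite lebesgue_measure_itv/= lte_fin; case: ltP => // ba.
  by rewrite (_ : a = b) ?subrr//; apply/eqP; rewrite eq_le ab.
have E r : Rintegral mu `]a, b] (cst r) = r * (b - a).
  by rewrite Rintegral_cst// mab.
have itg : mu.-integrable `]a, b] (EFin \o (fun t => f t - c)).
  exact: (integrableB _ itf (cst_int c)).
rewrite -(E c) -(E e) -RintegralB//; last exact: cst_int.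
apply: (le_trans (le_normr_Rintegral _ itg)) => //.
apply: le_Rintegral => //.
- exact: (integrable_abse itg).
- exact: cst_int.
- by move=> t /=; rewrite in_itv/= => /andP[/ltW ? ?]; apply: H; apply/andP.
Qed.

Lemma segment_bounded (f : R -> R) (a b : R) : continuous f ->
  exists2 M, 0 <= M & forall t, a <= t <= b -> `|f t| <= M.
Proof.
move=> cf.
have cw : {within `[a, b], continuous f} by exact: continuous_subspaceT.
have /compact_bounded[M [_ HM]] := continuous_compact cw (@segment_compact _ a b).
exists (`|M| + 1); first by rewrite addr_ge0.
move=> t tab; apply: (HM (`|M| + 1)).
  by rewrite (le_lt_trans (ler_norm _))// ltrDl.
by exists t.
Qed.

Lemma last_zero (f : R -> R) (a b s : R) : continuous f ->
  a <= s -> s <= b -> f s = 0 ->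
  exists u, [/\ s <= u, u <= b, f u = 0 & forall t, u < t -> t <= b -> f t != 0].
Proof.
move=> cf as_ sb fs.
pose Z := [set t | s <= t <= b /\ f t = 0].
have Zs : Z s by split; rewrite ?lexx ?sb.
have ubZ : ubound Z b by move=> t [/andP[]].
have supZ : has_sup Z by split; [exists s|exists b].
have us : s <= sup Z by apply: ub_le_sup => //; exists b.
have ub : sup Z <= b by apply: ge_sup => //; exists s.
exists (sup Z); split => //.
- apply/eqP; apply: contraT => fu.
  have e0 : 0 < `|f (sup Z)| by rewrite normr_gt0.
  have /cvgrPdist_lt/(_ _ e0)[d /= d0 H] := cf (sup Z).
  have [t Zt] := sup_adherent d0 supZ.
  have tle : t <= sup Z by apply: ub_le_sup => //; exists b.
  move=> dt; have h : `|sup Z - t| < d by rewrite ger0_norm ?subr_ge0//; lra.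
  by have := H t h; case: Zt => _ ->; rewrite subr0 ltxx.
- move=> t ut tb; apply/eqP => ft.
  have : t <= sup Z.
    apply: ub_le_sup; first by exists b.
    by split => //; rewrite tb (le_trans us)// ltW.
  by rewrite leNgt ut.
Qed.

End paths.

Lemma lebesgue_stieltjes_measure_oc {R : realType} (f : cumulative R R) (a b : R) :
  a <= b -> lebesgue_stieltjes_measure f `]a, b]%classic = (f b - f a)%:E.
Proof.
move=> ab; rewrite /lebesgue_stieltjes_measure /measure_extension/=.
by rewrite measurable_mu_extE/= ?wlength_itv_bnd//; exact: is_ocitv.
Qed.

(** * The reflected equation, path by path *)

Section solution.
Context {R : realType}.
Variables (beta y0 : R) (W Q1 Q2 L : R -> R).
Hypothesis W0 : W 0 = 0.
Hypothesis W_within : {within `[0, +oo[, continuous W}.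
Hypothesis sol : reflected_solution beta 0 y0 W Q1 Q2 L.
Local Notation mu := (@lebesgue_measure R).

Let X t := - Q1 t.
Let S t := Q1 t + Q2 t.
(** The free part of [X]: its equation does not contain [L], so its increments, like those of [S],
    are controlled by the values of [X] and [S] and by the increments of [W]. *)
Let Y t := X t - L t.

Lemma solution_continuous :
  [/\ continuous (clamp W), continuous (clamp X) & continuous (clamp S)].
Proof.
case: sol => -[/continuous_clamp cQ1 /continuous_clamp cQ2] _ _ _ _; split.
- exact: continuous_clamp.
- by move=> t; apply: continuousN; exact: cQ1.
- by move=> t; apply: continuousD; [exact: cQ1|exact: cQ2].
Qed.

Lemma solution_X_ge0 t : 0 <= t -> 0 <= X t.
Proof. by case: sol => _ _ H _ _ /H; rewrite oppr_ge0. Qed.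

Lemma solution_0 : X 0 = 0 /\ S 0 = y0.
Proof.
case: sol => _ [L0 _] _ _ /(_ 0 (lexx _)).
rewrite set_itv1 !Rintegral_set1 L0 W0 /X /S !mulr0 !subr0 !addr0 => -[-> ->].
by rewrite oppr0 add0r.
Qed.

Lemma solution_S_increment a b c e : 0 <= a -> a <= b ->
  (forall t, a <= t <= b -> `|X t - c| <= e) ->
  `|S b - S a - Num.sqrt 2 * (W b - W a) - (c - beta) * (b - a)| <= e * (b - a).
Proof.
move=> a0 ab H.
have [cW cX cS] := solution_continuous.
have b0 : 0 <= b by exact: le_trans ab.
case: (sol) => -[/continuous_clamp cQ1 /continuous_clamp cQ2] _ _ _ eqs.
have intE t : Rintegral mu `[0, t] (fun s => - Q1 s + Q2 s) - Rintegral mu `[0, t] Q2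
    = Rintegral mu `[0, t] X.
  rewrite -RintegralB//.
  - by apply: eq_Rintegral => s _; rewrite addrK.
  - apply: clamp_integrable => u.
    exact: (@continuousD _ _ _ (clamp X) (clamp Q2) u (cX u) (cQ2 u)).
  - exact: clamp_integrable.
have SE t : 0 <= t -> S t = y0 + Num.sqrt 2 * W t - beta * t + Rintegral mu `[0, t] X.
  by move=> t0; have [e1 e2] := eqs t t0; rewrite -intE /S e1 e2; ring.
have := Rintegral_increment X a b c e cX a0 ab H.
rewrite !SE//; move: (Rintegral _ _ _) (Rintegral _ _ _) => I1 I2.
by congr (`|_| <= _); ring.
Qed.

Lemma solution_Y_increment a b c e : 0 <= a -> a <= b ->
  (forall t, a <= t <= b -> `|2 * X t + S t - c| <= e) ->
  `|Y b - Y a + Num.sqrt 2 * (W b - W a) - (beta - c) * (b - a)| <= e * (b - a).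
Proof.
move=> a0 ab H.
have b0 : 0 <= b by exact: le_trans ab.
case: (sol) => -[/continuous_clamp cQ1 /continuous_clamp cQ2] _ _ _ eqs.
pose g s := - Q1 s + Q2 s.
have cg : continuous (clamp g).
  move=> u; apply: (@continuousD _ _ _ (fun t => - clamp Q1 t) (clamp Q2) u).
    exact: continuousN (cQ1 u).
  exact: cQ2.
have YE t : 0 <= t -> Y t = - (Num.sqrt 2 * W t) + beta * t - Rintegral mu `[0, t] g.
  by move=> t0; have [e1 e2] := eqs t t0; rewrite /Y /X e1; ring.
have Hg t : a <= t <= b -> `|g t - c| <= e.
  by move=> /H; congr (`|_| <= _); rewrite /g /X /S; ring.
have := Rintegral_increment g a b c e cg a0 ab Hg.
rewrite !YE// -normrN; move: (Rintegral _ _ _) (Rintegral _ _ _) => I1 I2.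
by congr (`|_| <= _); ring.
Qed.

Lemma solution_L_mono s t : 0 <= s -> s <= t -> L s <= L t.
Proof. by case: sol => _ [_ [_ [H _]]] _ _ _; exact: H. Qed.

(** The complementarity condition is an integral against any cumulative function extending [L]. Such
    an [F] is built here as [clamp L], and its Stieltjes measure does not charge the times where [X]
    is positive. *)
Lemma solution_L_flat u t : 0 <= u -> u <= t ->
  (forall s, u < s -> s <= t -> 0 < X s) -> L t = L u.
Proof.
move=> u0 ut H.
case: (sol) => _ [L0 [Lge0 [Lmono [Lrc _]]]] _ Hint _.
pose F := clamp L.
have Fnd : {homo F : x y / x <= y}.
  move=> x y xy; apply: Lmono; first by rewrite le_max lexx orbT.
  by rewrite ge_max !le_max xy lexx orbT.
have Frc : right_continuous F.
  move=> x; apply/cvgrPdist_lt => e e0.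
  have x0 : 0 <= Num.max x 0 by rewrite le_max lexx orbT.
  have /cvgrPdist_lt/(_ e e0)[d /= d0 Hd] := Lrc _ x0.
  exists d => //= v vd xv; rewrite /F /clamp.
  have [v0|v0] := leP v 0.
    have -> : Num.max x 0 = 0 by apply/max_r/(le_trans (ltW xv)).
    by rewrite subrr normr0.
  have [xp|xn] := leP 0 x.
    by have := Hd v; rewrite max_l//; apply.
  have := Hd v; rewrite max_r ?ltW//; apply => //=.
  rewrite sub0r normrN gtr0_norm//.
  have : `|x - v| < d by [].
  rewrite ltr0_norm ?subr_lt0//; lra.
pose Fc : cumulative R R := HB.pack F (isCumulative.Build R _ R F Fnd Frc).
have H0 := Hint Fc (fun t => erefl).
pose nu : {measure set (measurableTypeR R) -> \bar R} := lebesgue_stieltjes_measure Fc.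
have H0' : (\int[nu]_(t in [set t : R | (0 <= t)%R])
    (\1_[set t : R | (Q1 t < 0)%R] t)%:E = 0)%E by exact: H0.
have nuE : nu `]u, t]%classic = (L t - L u)%:E.
  transitivity (F t - F u)%:E.
    exact: (lebesgue_stieltjes_measure_oc Fc _ _ ut).
  by rewrite /F !clampE//; exact: le_trans ut.
have mN : measurable ([set s | (0 <= s)%R] `&` [set s | (Q1 s < 0)%R]).
  have -> : [set s | (0 <= s)%R] `&` [set s | (Q1 s < 0)%R]
      = `[0, +oo[%classic `&` clamp Q1 @^-1` `]-oo, 0[%classic.
    apply/seteqP; split => s /=.
      by move=> [s0 Qs]; rewrite !in_itv/= s0 clampE.
    by rewrite !in_itv/= andbT => -[s0]; rewrite clampE.
  apply: measurableI => //.
  rewrite -[X in measurable X]setTI.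
  have [_ cX _] := solution_continuous.
  have cQ1 : continuous (clamp Q1).
    move=> v; have := continuousN (cX v).
    by congr (continuous_at _ _); apply/funext => r; rewrite /clamp /X opprK.
  apply: continuous_measurable_fun => //.
have mP : measurable [set s : R | (0 <= s)%R].
  have -> : [set s : R | (0 <= s)%R] = `[0, +oo[%classic.
    by apply/seteqP; split => s /=; rewrite in_itv/= andbT.
  exact: measurable_itv.
(* The interval lies inside the set where [Q1] is negative, whose measure is the vanishing
   integral. *)
have le0 : (nu `]u, t]%classic <= 0)%E.
  rewrite -H0'.
  rewrite (eq_integral (fun t : measurableTypeR R => (\1_([set t : R | (0 <= t)%R]
      `&` [set t : R | (Q1 t < 0)%R]) t)%:E)); last first.
    by move=> s s0; rewrite !indicE in_setI s0.
  rewrite integral_indic// le_measure ?inE//; first exact: measurableI.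
  move=> s /=; rewrite in_itv/= => /andP[us st].
  have s0 : 0 <= s by rewrite (le_trans u0)// ltW.
  by do ! split => //; have := H s us st; rewrite oppr_gt0.
apply/le_anti/andP; split; last exact: solution_L_mono.
by move: le0; rewrite nuE lee_fin subr_le0.
Qed.

End solution.

(* One step of the reflected Euler scheme in the coordinates (X, S) = (-Q1, Q1 + Q2),
   in which the reflection acts on the first coordinate only. *)
Definition estep {R : realType} (beta h : R) (z : R * R) (u : R) : R * R :=
  (Num.max 0 (z.1 - Num.sqrt 2 * u + (beta - 2 * z.1 - z.2) * h),
   z.2 + Num.sqrt 2 * u + (z.1 - beta) * h).

Fixpoint euler {R : realType} (beta h y0 : R) (dW : nat -> R) (k : nat) : R * R :=
  if k is k'.+1 then estep beta h (euler beta h y0 dW k') (dW k') else (0, y0).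

Definition grid_increment {R : realType} (W : R -> R) (h : R) (k : nat) : R :=
  W (k.+1%:R * h) - W (k%:R * h).

Lemma sqrt2_le2 {R : realType} : Num.sqrt 2 <= 2 :> R.
Proof.
rewrite -[leRHS]ger0_norm// -sqrtr_sqr ler_wsqrtr// expr2.
by rewrite ler_peMr// ler1n.
Qed.

Lemma euler_ge0 {R : realType} (beta h y0 : R) dW k : 0 <= (euler beta h y0 dW k).1.
Proof. by case: k => [|k]//=; rewrite le_max lexx. Qed.

Section euler_convergence.
Context {R : realType}.
Variables (beta y0 : R) (W Q1 Q2 L : R -> R).
Hypothesis W0 : W 0 = 0.
Hypothesis W_within : {within `[0, +oo[, continuous W}.
Hypothesis sol : reflected_solution beta 0 y0 W Q1 Q2 L.

Let X t := - Q1 t.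
Let S t := Q1 t + Q2 t.
Let Y t := X t - L t.

(** For [X] and [S] this is uniform continuity. [L] is only assumed right-continuous with left
    limits, so the modulus of [Y] is derived from its equation and the modulus of [W]. *)
Let modulus (T e : R) : 0 < e -> exists2 h0, 0 < h0 & forall a b, 0 <= a -> a <= b ->
  b <= T -> b - a <= h0 ->
  [/\ `|X b - X a| <= e, `|S b - S a| <= e & `|Y b - Y a| <= e].
Proof.
move=> e0.
have [cW cX cS] := solution_continuous beta y0 W Q1 Q2 L W_within sol.
have [MX MX0 HMX] := segment_bounded (clamp X) 0 T cX.
have [MS MS0 HMS] := segment_bounded (clamp S) 0 T cS.
pose M := `|beta| + 2 * MX + MS + 1.
have M1 : 1 <= M by rewrite /M; have := normr_ge0 beta; lra.
have M0 : 0 < M by lra.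
(* The increment of [Y] is at most [4 * e']: one share for the oscillation of the drift, one for the
   drift itself, two for the noise since [Num.sqrt 2 <= 2]. *)
pose e' := Num.min e 1 / 6.
have e'0 : 0 < e' by rewrite /e' divr_gt0// lt_min e0 ltr01.
have e'e : 6 * e' <= e.
  by rewrite /e' mulrC divfK// ge_min lexx.
have e'1 : 6 * e' <= 1.
  by rewrite /e' mulrC divfK// ge_min lexx orbT.
have [dX dX0 HX] := segment_unif_continuous (clamp X) 0 T e' cX e'0.
have [dS dS0 HS] := segment_unif_continuous (clamp S) 0 T e' cS e'0.
have [dW dW0 HW] := segment_unif_continuous (clamp W) 0 T e' cW e'0.
pose h0 := Num.min (Num.min dX dS) (Num.min dW (e' / M)) / 2.
have m0 : 0 < Num.min (Num.min dX dS) (Num.min dW (e' / M)).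
  by rewrite !lt_min dX0 dS0 dW0 divr_gt0.
have h00 : 0 < h0 by rewrite divr_gt0.
have lt2 r : Num.min (Num.min dX dS) (Num.min dW (e' / M)) <= r -> h0 < r.
  by rewrite /h0; lra.
have hX : h0 < dX by apply: lt2; rewrite !ge_min lexx.
have hS : h0 < dS by apply: lt2; rewrite !ge_min lexx !orbT.
have hW : h0 < dW by apply: lt2; rewrite !ge_min lexx !orbT.
have hM : h0 * M <= e'.
  by rewrite -ler_pdivlMr//; apply/ltW/lt2; rewrite !ge_min lexx !orbT.
exists h0 => // a b a0 ab bT bah.
have b0 : 0 <= b by exact: le_trans ab.
have aT : 0 <= a <= T by rewrite a0 (le_trans ab).
have nba t : a <= t <= b -> `|t - a| <= h0.
  by move=> /andP[at_ tb]; rewrite ger0_norm ?subr_ge0//; lra.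
have bab : a <= b <= b by rewrite ab lexx.
have bX t : a <= t <= b -> `|X t - X a| <= e'.
  move=> tab; have := HX a aT t (le_lt_trans (nba t tab) hX).
  by rewrite !clampE//; [move/ltW|move/andP: tab => [at_ _]; exact: le_trans at_].
have bS t : a <= t <= b -> `|S t - S a| <= e'.
  move=> tab; have := HS a aT t (le_lt_trans (nba t tab) hS).
  by rewrite !clampE//; [move/ltW|move/andP: tab => [at_ _]; exact: le_trans at_].
have bW : `|W b - W a| <= e'.
  have := HW a aT b (le_lt_trans (nba b bab) hW).
  by rewrite !clampE// => /ltW.
split.
- by apply: (le_trans (bX b bab)); lra.
- by apply: (le_trans (bS b bab)); lra.
have HY t : a <= t <= b -> `|2 * X t + S t - (2 * X a + S a)| <= 3 * e'.
  move=> tab; have := bX t tab; have := bS t tab; rewrite !ler_norml; lra.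
have := solution_Y_increment beta y0 W Q1 Q2 L sol a b _ _ a0 ab HY.
rewrite -/(Y b) -/(Y a).
have ma : `|(beta - (2 * X a + S a)) * (b - a)| <= e'.
  apply: le_trans hM; rewrite normrM mulrC ler_pM//.
    by rewrite ger0_norm ?subr_ge0.
  have := HMX a aT; have := HMS a aT; rewrite !clampE// /M => h1 h2.
  have := ler_normB beta (2 * X a + S a); have := ler_normD (2 * X a) (S a).
  rewrite normrM ger0_norm//; lra.
have ea : 3 * e' * (b - a) <= 3 * e' * h0 by rewrite ler_wpM2l// mulr_ge0// ltW.
have h01 : 3 * e' * h0 <= e'.
  have : h0 <= e'.
    by apply: le_trans hM; rewrite ler_peMr// ltW.
  by move=> h; nra.
have sw : `|Num.sqrt 2 * (W b - W a)| <= 2 * e'.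
  by rewrite normrM ler_pM// ger0_norm// sqrt2_le2.
move: ma sw; rewrite !ler_norml; lra.
Qed.

(* Both regulators are read off the unreflected paths: the discrete one grows to [- y k.+1] when
   needed, and [L] is constant after the last zero [u] of [X], where [L u = - Y u]. *)
Theorem euler_convergence (T e : R) : 0 < e -> exists2 h0, 0 < h0 &
  forall h, 0 < h -> h <= h0 -> forall k, k%:R * h <= T ->
  let z := euler beta h y0 (grid_increment W h) k in
  `|z.1 - X (k%:R * h)| <= e /\ `|z.2 - S (k%:R * h)| <= e.
Proof.
move=> e0.
(* Chosen so that the final error [2 * de k + om] is at most [e] once [(1 + 5 * h) ^+ k] is bounded
   by [expR (5 * T)]. *)
pose om := e / (2 * expR (5 * T)).
have om0 : 0 < om by rewrite divr_gt0// mulr_gt0// expR_gt0.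
have [h0 h00 Hmod] := modulus T om om0.
exists h0 => // h hp hh0.
pose t (k : nat) : R := k%:R * h.
have tS k : t k.+1 = t k + h by rewrite /t -natr1 mulrDl mul1r.
have t_ge0 k : 0 <= t k by rewrite mulr_ge0// ltW.
pose z k := euler beta h y0 (grid_increment W h) k.
pose x k := (z k).1; pose s k := (z k).2.
pose dy k := - (Num.sqrt 2 * grid_increment W h k) + (beta - 2 * x k - s k) * h.
pose y (k : nat) := \sum_(i < k) dy i.
have yS k : y k.+1 = y k + dy k by rewrite /y big_ord_recr.
pose l k := x k - y k.
have x0 k : 0 <= x k by exact: euler_ge0.
have xS k : x k.+1 = Num.max 0 (x k + dy k).
  by rewrite /x /= -/(z k) -/(x k) /dy; congr Num.max; ring.
have sS k : s k.+1 = s k + Num.sqrt 2 * grid_increment W h k + (x k - beta) * h by [].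
have lS k : l k.+1 = Num.max (- y k.+1) (l k).
  by rewrite /l xS yS addr_maxl add0r opprD addrACA subrr addr0.
(* Solution of the discrete Gronwall recursion [deS]. The drift of [y] has error at most
   [2 * (2 * de + om) + de = 5 * de + 2 * om], and the oscillation of the solution within a step
   adds [3 * om]. *)
pose de k := om * ((1 + 5 * h) ^+ k - 1).
have de0 k : 0 <= de k.
  by apply: mulr_ge0; [exact: ltW|rewrite subr_ge0 exprn_ege1//; lra].
have deS k : de k.+1 = de k + 5 * (de k * h) + 5 * (om * h).
  by rewrite /de exprS; ring.
have [X0 S0] := solution_0 beta y0 W Q1 Q2 L W0 sol.
have {}S0 : S 0 = y0 by [].
have {}X0 : X 0 = 0 by [].
have L0 : L 0 = 0 by case: sol => _ [].
have Xge0 r : 0 <= r -> 0 <= X r by exact: (solution_X_ge0 beta y0 W Q1 Q2 L sol).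
(* The extra [om] in the last bound is there because [X] may vanish between grid points, where the
   scheme does not see [L] grow. *)
suff main k : t k <= T -> [/\ `|y k - Y (t k)| <= de k, `|s k - S (t k)| <= de k,
    l k <= L (t k) + de k & L (t k) <= l k + de k + om].
  move=> k kT; have [h1 h2 h3 h4] := main k kT; rewrite /= -/(x k) -/(s k) -/(t k).
  have deT : 2 * de k + om <= e.
    have : (1 + 5 * h) ^+ k <= expR (5 * T).
      apply: (@le_trans _ _ (expR (5 * h) ^+ k)).
        by rewrite lerXn2r ?nnegrE ?expR_ge0//; [lra|exact: expR_ge1Dx].
      by rewrite -expRM_natl ler_expR mulrCA ler_pM2l.
    rewrite /de => hk.
    have : om * (1 + 5 * h) ^+ k <= e / 2.
      rewrite /om invfM mulrA -[leRHS]mulr1 -!mulrA ler_pM2l// ler_pM2l ?invr_gt0//.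
      by rewrite mulrC ler_pdivrMr ?expR_gt0// mul1r.
    lra.
  have xE : x k - X (t k) = (y k - Y (t k)) + (l k - L (t k)).
    by rewrite /l /Y; ring.
  have := de0 k; move: h1 h2; rewrite xE !ler_norml; lra.
elim: k => [|k ih] kT.
  rewrite /y big_ord0 /l /y big_ord0 /de expr0 subrr mulr0 /s /x /t mul0r /=.
  rewrite S0 /Y X0 L0 !subr0 !subrr normr0; split => //.
  by rewrite !add0r ltW.
have kT' : t k <= T by move: kT; rewrite tS; lra.
have [h1 h2 h3 h4] := ih kT'.
have tk1 : t k <= t k.+1 by rewrite tS; lra.
have Hc r : t k <= r <= t k.+1 -> [/\ `|X r - X (t k)| <= om, `|S r - S (t k)| <= om & `|Y r - Y (t k)| <= om].
  move=> /andP[r1 r2]; apply: Hmod => //; first exact: le_trans kT.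
  by move: r2; rewrite tS; lra.
have HX r : t k <= r <= t k.+1 -> `|X r - X (t k)| <= om by case/Hc.
have HXS r : t k <= r <= t k.+1 -> `|2 * X r + S r - (2 * X (t k) + S (t k))| <= 3 * om.
  by case/Hc; rewrite !ler_norml; lra.
have iS := solution_S_increment beta y0 W Q1 Q2 L W_within sol _ _ _ _ (t_ge0 k) tk1 HX.
have iY := solution_Y_increment beta y0 W Q1 Q2 L sol _ _ _ _ (t_ge0 k) tk1 HXS.
rewrite -/(grid_increment W h k) -/(S (t k.+1)) -/(S (t k)) in iS.
rewrite -/(grid_increment W h k) -/(Y (t k.+1)) -/(Y (t k)) in iY.
have dt : t k.+1 - t k = h by rewrite tS; ring.
rewrite dt in iS iY.
have xE : x k - X (t k) = (y k - Y (t k)) + (l k - L (t k)).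
  by rewrite /l /Y; ring.
have hx : `|x k - X (t k)| <= 2 * de k + om.
  have := de0 k; move: h1; rewrite xE !ler_norml; lra.
have hxh : `|(x k - X (t k)) * h| <= (2 * de k + om) * h.
  by rewrite normrM (gtr0_norm hp) ler_wpM2r// ltW.
have hxsh : `|(2 * (x k - X (t k)) + (s k - S (t k))) * h| <= (5 * de k + 2 * om) * h.
  rewrite normrM (gtr0_norm hp) ler_wpM2r ?(ltW hp)//.
  by move: hx h2; rewrite !ler_norml; lra.
have deh : 0 <= de k * h by rewrite mulr_ge0// ltW.
have omh : 0 <= om * h by rewrite mulr_ge0// ltW.
have g1 : `|y k.+1 - Y (t k.+1)| <= de k.+1.
  rewrite yS deS /dy; move: iY hxsh h1; rewrite !ler_norml; lra.
have g2 : `|s k.+1 - S (t k.+1)| <= de k.+1.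
  rewrite sS deS; move: iS hxh h2; rewrite !ler_norml; lra.
have deM : de k <= de k.+1 by rewrite deS; lra.
have Lm : L (t k) <= L (t k.+1).
  exact: (solution_L_mono beta y0 W Q1 Q2 L sol _ _ (t_ge0 k) tk1).
split => //.
- rewrite lS ge_max; apply/andP; split; last by lra.
  have := Xge0 _ (t_ge0 k.+1); move: g1; rewrite /Y ler_norml; lra.
- have l1 : - y k.+1 <= l k.+1 by rewrite lS le_max lexx.
  have l2 : l k <= l k.+1 by rewrite lS le_max lexx orbT.
  have [[r [r1 r2 Xr]]|nz] := pselect (exists r, [/\ t k < r, r <= t k.+1 & X r = 0]).
    have [_ cX _] := solution_continuous beta y0 W Q1 Q2 L W_within sol.
    have r0 : 0 <= r by rewrite (le_trans (t_ge0 k))// ltW.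
    have [u [ru ut Xu Hu]] := last_zero (clamp X) (t k) (t k.+1) r cX (ltW r1) r2 (etrans (clampE _ _ r0) Xr).
    have u0 : 0 <= u by exact: le_trans ru.
    rewrite clampE// in Xu.
    have Lu : L (t k.+1) = L u.
      apply: (solution_L_flat beta y0 W Q1 Q2 L W_within sol _ _ u0 ut) => v uv vt.
      have v0 : 0 <= v by rewrite (le_trans u0)// ltW.
      by have := Hu v uv vt; rewrite clampE// lt_def Xge0// andbT.
    have [_ _] : [/\ `|X (t k.+1) - X u| <= om, `|S (t k.+1) - S u| <= om & `|Y (t k.+1) - Y u| <= om].
      by apply: Hmod => //; move: ut ru; rewrite tS in r2 *; lra.
    have Yu : Y u = - L u by rewrite /Y Xu sub0r.
    by move: g1; rewrite Lu Yu !ler_norml; lra.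
  have -> : L (t k.+1) = L (t k).
    apply: (solution_L_flat beta y0 W Q1 Q2 L W_within sol) => // v kv vk.
    have v0 : 0 <= v by rewrite (le_trans (t_ge0 k))// ltW.
    rewrite -/(X v) lt_def Xge0// andbT; apply/eqP => Xv.
    by apply: nz; exists v.
  lra.
Qed.

End euler_convergence.

(** * Brownian increments on a grid and measurability of the solution *)

Section brownian_increments.
Context {R : realType} {d : measure_display} {T : measurableType d}.
Variables (P : probability T R) (W : R -> T -> R).
Hypothesis BM : standard_BM P W.

Definition bm_increment (h : R) (k : nat) (w : T) : measurableTypeR R :=
  grid_increment (W^~ w) h k.

Lemma measurable_bm_increment h k : 0 < h -> measurable_fun setT (bm_increment h k).
Proof.
move=> h0; case: BM => _ _ mW _ _.
have H : measurable_fun setT (fun w => W (k.+1%:R * h) w - W (k%:R * h) w).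
  by apply: measurable_funB; apply: mW; rewrite mulr_ge0// ltW.
exact: H.
Qed.

Lemma bm_increment_indep h n (A : nat -> set (measurableTypeR R)) : 0 < h ->
  (forall k, measurable (A k)) ->
  fine (P (\bigcap_(k in [set k | (k < n)%N]) (bm_increment h k @^-1` A k))) =
  \prod_(k < n) fine (P (bm_increment h k @^-1` A k)).
Proof.
move=> h0 mA; case: BM => _ _ _ _ /(_ n (fun k => k%:R * h)) H.
apply: H; first by rewrite mul0r.
- by move=> k _; rewrite ltr_pM2r// ltr_nat.
- exact: mA.
Qed.

Lemma bm_increment_law h k (A : set (measurableTypeR R)) : 0 < h -> measurable A ->
  P (bm_increment h k @^-1` A) = normal_prob 0 (Num.sqrt h) A.
Proof.
move=> h0 mA; case: BM => _ _ _ H _.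
have := H (k%:R * h) (k.+1%:R * h).
have -> : k.+1%:R * h - k%:R * h = h by rewrite -natr1 mulrDl mul1r addrAC subrr add0r.
apply => //; first by rewrite mulr_ge0// ltW.
by rewrite ltr_pM2r// ltr_nat.
Qed.

End brownian_increments.

Lemma measurable_estep {R : realType} (beta h : R) :
  measurable_fun setT (fun zu : (R * R) * measurableTypeR R => estep beta h zu.1 zu.2).
Proof.
have m1 : measurable_fun setT (fun zu : (R * R) * measurableTypeR R => zu.1.1).
  exact: (measurableT_comp measurable_fst measurable_fst).
have m2 : measurable_fun setT (fun zu : (R * R) * measurableTypeR R => zu.1.2).
  exact: (measurableT_comp measurable_snd measurable_fst).
have m3 : measurable_fun setT (fun zu : (R * R) * measurableTypeR R => zu.2 : R).
  exact: measurable_snd.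
apply: measurable_fun_pair.
  apply: measurable_maxr => //; apply: measurable_funD.
    by apply: measurable_funB => //; exact: measurable_funM.
  by apply: measurable_funM => //; do 2 (apply: measurable_funB => //); exact: measurable_funM.
apply: measurable_funD.
  by apply: measurable_funD => //; exact: measurable_funM.
by apply: measurable_funM => //; exact: measurable_funB.
Qed.

Lemma truncn_grid {R : realType} (t h : R) : 0 <= t -> 0 < h ->
  let k := Num.truncn (t / h) in k%:R * h <= t < k%:R * h + h.
Proof.
move=> t0 h0 /=.
have /truncn_itv/andP[k1 k2] : 0 <= t / h by rewrite divr_ge0// ltW.
by rewrite -ler_pdivlMr// k1; move: k2; rewrite ltr_pdivrMr// -natr1 mulrDl mul1r.
Qed.

Section measurability.
Context {R : realType} {d : measure_display} {T : measurableType d}.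
Variables (P : probability T R) (W Q1 Q2 L : R -> T -> R) (beta y0 : R).
Hypothesis BM : standard_BM P W.
Hypothesis sol : forall w, reflected_solution beta 0 y0 (W^~ w) (Q1^~ w) (Q2^~ w) (L^~ w).

Lemma pchain_euler h k w :
  pchain (bm_increment W h) (fun zu : (R * R) * measurableTypeR R => estep beta h zu.1 zu.2)
    (0, y0) k w = euler beta h y0 (grid_increment (W^~ w) h) k.
Proof. by elim: k => [|k ih] //=; rewrite -ih. Qed.

Lemma measurable_euler h k : 0 < h ->
  measurable_fun setT (fun w => euler beta h y0 (grid_increment (W^~ w) h) k).
Proof.
move=> h0; under eq_fun do rewrite -pchain_euler.
apply: measurable_chain => [j|_]; last exact: measurable_estep.
exact: (measurable_bm_increment P W BM h j h0).
Qed.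

(** A reciprocal integer, so that every integer time [j] is a grid point, reached at step
    [j * n.+1]. *)
Definition mesh (n : nat) : R := n.+1%:R^-1.

Lemma mesh_gt0 n : 0 < mesh n. Proof. by rewrite invr_gt0. Qed.

Lemma mesh_small e : 0 < e -> exists n0, forall n, (n0 <= n)%N -> mesh n <= e.
Proof.
move=> e0; exists (Num.truncn e^-1) => n hn.
rewrite /mesh -[leRHS]invrK lef_pV2 ?posrE ?invr_gt0//.
apply: (@le_trans _ _ (Num.truncn e^-1).+1%:R); last by rewrite ler_nat.
by apply/ltW; rewrite truncnS_gt.
Qed.

Lemma solution_euler_near (t e : R) w : 0 <= t -> 0 < e ->
  exists n0, forall n, (n0 <= n)%N ->
  let z := euler beta (mesh n) y0 (grid_increment (W^~ w) (mesh n)) (Num.truncn (t / mesh n)) in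
  `|z.1 + Q1 t w| <= e /\ `|z.2 - (Q1 t w + Q2 t w)| <= e.
Proof.
move=> t0 e0.
case: BM => W0 Wc _ _ _.
have e2 : 0 < e / 2 by rewrite divr_gt0.
have [h0 h00 H] := euler_convergence beta y0 (W^~ w) (Q1^~ w) (Q2^~ w) (L^~ w) (W0 w) (Wc w) (sol w) t _ e2.
have [_ cX cS] := solution_continuous beta y0 (W^~ w) (Q1^~ w) (Q2^~ w) (L^~ w) (Wc w) (sol w).
have [dX dX0 HX] := segment_unif_continuous _ t t _ cX e2.
have [dS dS0 HS] := segment_unif_continuous _ t t _ cS e2.
have m0 : 0 < Num.min h0 (Num.min dX dS) / 2 by rewrite divr_gt0// !lt_min h00 dX0.
have [n0 Hn0] := mesh_small _ m0.
exists n0 => n /Hn0 hn.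
have hp := mesh_gt0 n; set h := mesh n in hn hp *.
have lt2 r : Num.min h0 (Num.min dX dS) <= r -> h < r.
  have : 0 < Num.min h0 (Num.min dX dS) by rewrite !lt_min h00 dX0.
  by move: hn; lra.
have hh0 : h <= h0 by apply/ltW/lt2; rewrite !ge_min lexx.
have hX : h < dX by apply/lt2; rewrite !ge_min lexx !orbT.
have hS : h < dS by apply/lt2; rewrite !ge_min lexx !orbT.
set k := Num.truncn (t / h).
have /andP[k1' k2'] := truncn_grid t h t0 hp; rewrite -/k in k1' k2'.
have [z1 z2] := H h hp hh0 k k1'.
have tt : t <= t <= t by rewrite lexx.
have kh0 : 0 <= k%:R * h by rewrite mulr_ge0// ltW.
have dk : `|k%:R * h - t| <= h by rewrite distrC ger0_norm ?subr_ge0//; lra.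
have := HX t tt _ (le_lt_trans dk hX); have := HS t tt _ (le_lt_trans dk hS).
rewrite !clampE//.
move: z1 z2 => /=; rewrite !ler_norml !ltr_norml; lra.
Qed.

(** Measurability in [w] is not part of [reflected_solution]; it follows because the values at a
    fixed time are pointwise limits of the scheme, a measurable function of finitely many
    increments. *)
Lemma measurable_solution t : 0 <= t ->
  measurable_fun setT (Q1 t) /\ measurable_fun setT (Q2 t).
Proof.
move=> t0.
pose z n w := euler beta (mesh n) y0 (grid_increment (W^~ w) (mesh n)) (Num.truncn (t / mesh n)).
have mz n : measurable_fun setT (z n) by exact: (measurable_euler _ _ (mesh_gt0 n)).
have mX : measurable_fun setT (fun w => - Q1 t w).
  apply: (@measurable_fun_cvg _ _ _ setT (fun n w => (z n w).1)) => [n|w _].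
    exact: (measurableT_comp measurable_fst (mz n)).
  apply/cvgrPdist_le => e e0.
  have [n0 Hn0] := solution_euler_near t e w t0 e0.
  exists n0 => // n /= /Hn0[h1 _]; rewrite -normrN opprB opprK.
  by apply: le_trans h1; rewrite addrC.
have mS : measurable_fun setT (fun w => Q1 t w + Q2 t w).
  apply: (@measurable_fun_cvg _ _ _ setT (fun n w => (z n w).2)) => [n|w _].
    exact: (measurableT_comp measurable_snd (mz n)).
  apply/cvgrPdist_le => e e0.
  have [n0 Hn0] := solution_euler_near t e w t0 e0.
  by exists n0 => // n /= /Hn0[_ h1]; rewrite distrC.
have mQ1 : measurable_fun setT (Q1 t).
  rewrite (_ : Q1 t = (fun w => - (- Q1 t w))); last by apply/funext => w; rewrite opprK.
  exact: measurableT_comp.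
split => //.
rewrite (_ : Q2 t = (fun w => (Q1 t w + Q2 t w) - Q1 t w)).
  exact: measurable_funB.
by apply/funext => w; rewrite addrAC subrr add0r.
Qed.

End measurability.

(** * Hitting times *)

Section hitting_times.
Context {R : realType}.
Implicit Types (S : set R) (q Q : R -> R) (B z p : R).

Lemma clamp_near q t e : continuous (clamp q) -> 0 <= t -> 0 < e ->
  exists2 d : R, 0 < d & forall u : R, 0 <= u -> `|u - t| < d -> `|q u - q t| < e.
Proof.
move=> cq t0 e0.
have [d d0 H] := segment_unif_continuous _ t t _ cq e0.
exists d => // u u0 ud; have := H t _ u ud; rewrite !clampE//; apply.
by rewrite lexx.
Qed.

Lemma hit_le S t : S t -> (hit S <= t%:E)%E.
Proof. by move=> St; apply: ge_ereal_inf; exists t%:E => //; exists t. Qed.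

Lemma le_hit S (x : \bar R) : (forall t, S t -> (x <= t%:E)%E) -> (x <= hit S)%E.
Proof. by move=> H; apply/ereal_infP => _ [t St <-]; exact: H. Qed.

Lemma hit_lt S (x : \bar R) : (hit S < x)%E -> exists2 t, S t & (t%:E < x)%E.
Proof. by move=> /ereal_inf_lt[_ [t St <-] tx]; exists t. Qed.

(** A form of [Xi0 B q <= p] without infima: a visit to [B] followed by a visit to [2 * B], both by
    time [p]. *)
Definition cycle_done B q p := exists s t,
  [/\ 0 <= s, s < t, t <= p, q s = B & q t = 2 * B].

Lemma Xi0_le B q s t : 0 <= s -> s < t -> q s = B -> q t = 2 * B ->
  (Xi0 B q <= t%:E)%E.
Proof.
move=> s0 st qs qt; apply: hit_le; split => //.
by apply: (@le_lt_trans _ _ s%:E); [exact: hit_le|rewrite lte_fin].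
Qed.

Lemma Xi0_lt B q (x : \bar R) : (Xi0 B q < x)%E ->
  exists s t, [/\ 0 <= s, s < t, q s = B, q t = 2 * B & (t%:E < x)%E].
Proof.
move=> /hit_lt[t [a1t qt] tx]; have [s [s0 qs]] := hit_lt _ _ a1t.
by rewrite lte_fin => st; exists s, t.
Qed.

Lemma le_Xi0 B q p : ~ cycle_done B q p -> (p%:E <= Xi0 B q)%E.
Proof.
move=> nc; rewrite leNgt; apply/negP => /Xi0_lt[s [t [s0 st qs qt]]].
by rewrite lte_fin => /ltW tp; apply: nc; exists s, t.
Qed.

(** A countable description, for measurability: some rational time separates the two visits, and
    weak inequalities suffice on either side since the intermediate value theorem recovers the exact
    levels. *)
Lemma cycle_done_rat B q p : 0 < B -> continuous (clamp q) -> q 0 = 2 * B ->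
  cycle_done B q p <-> exists r : rat, [/\ 0 <= (ratr r : R) <= p,
    exists2 s, 0 <= s <= ratr r & q s <= B, q (ratr r) < 2 * B &
    exists2 t, ratr r <= t <= p & 2 * B <= q t].
Proof.
move=> B0 cq q0; split.
  move=> [s [t [s0 st tp qs qt]]].
  have [d d0 H] := clamp_near q s _ cq s0 B0.
  have sm : s < Num.min t (s + d) by rewrite lt_min st ltrDl.
  have [r] := rat_in_itvoo sm.
  rewrite in_itv/= lt_min => /and3P[sr rt rd].
  have r0 : 0 <= ratr r :> R by rewrite (le_trans s0)// ltW.
  exists r; split.
  - by rewrite r0 (le_trans (ltW rt)).
  - by exists s; [rewrite s0 ltW|rewrite qs].
  - have : `|q (ratr r) - q s| < B.
      by apply: H => //; rewrite ger0_norm ?subr_ge0 ?(ltW sr)//; lra.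
    by rewrite qs ltr_norml; lra.
  - by exists t; [rewrite ltW|rewrite qt].
move=> [r [/andP[r0 rp] [s /andP[s0 sr] qs] qr [t /andP[rt tp] qt]]].
have [|s'] := @IVT _ q 0 s B s0 (continuous_clamp_within _ _ _ (lexx 0) cq).
  rewrite q0; apply/andP; split; first by rewrite ge_min qs orbT.
  by rewrite le_max; apply/orP; left; lra.
rewrite in_itv/= => /andP[s'0 s's] qs'.
have [|t'] := @IVT _ q _ t (2 * B) rt (continuous_clamp_within _ _ _ r0 cq).
  apply/andP; split; first by rewrite ge_min (ltW qr).
  by rewrite le_max qt orbT.
rewrite in_itv/= => /andP[rt' t't] qt'.
exists s', t'; split => //; last exact: le_trans tp.
rewrite lt_neqAle; apply/andP; split.
  apply/eqP => st'; move: qs'; rewrite st' qt'; lra.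
by rewrite (le_trans s's)// (le_trans sr).
Qed.

Lemma avoid_extend Q z t : continuous (clamp Q) -> 0 <= t ->
  (forall u, 0 <= u <= t -> Q u != z) ->
  exists2 e, 0 < e & forall u, 0 <= u <= t + e -> Q u != z.
Proof.
move=> cQ t0 H.
have e0 : 0 < `|Q t - z| by rewrite normr_gt0 subr_eq0 H// t0 lexx.
have [d d0 Hd] := clamp_near _ t _ cQ t0 e0.
exists (d / 2); first by rewrite divr_gt0.
move=> u /andP[u0 ut]; have [u_t|t_u] := leP u t; first by rewrite H// u0.
apply/eqP => Qu.
have : `|Q u - Q t| < `|Q t - z|.
  by apply: Hd => //; rewrite ger0_norm ?subr_ge0 ?(ltW t_u)//; lra.
by rewrite Qu distrC ltxx.
Qed.

(** If [Q] avoids [z] on a closed interval, it does so slightly longer ([avoid_extend]), which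
    leaves room for a rational time after the end of the cycle. *)
Lemma Xi0_lt_tau_rat B q Q z : continuous (clamp Q) ->
  (Xi0 B q < tau Q z)%E <-> exists r : rat, [/\ 0 <= ratr r :> R,
    cycle_done B q (ratr r) & forall t, 0 <= t <= ratr r -> Q t != z].
Proof.
move=> cQ.
split.
  move=> /Xi0_lt[s [t [s0 st qs qt tt]]].
  have t0 : 0 <= t by rewrite (le_trans s0)// ltW.
  have [|e e0 He] := avoid_extend Q z t cQ t0.
    move=> u /andP[u0 ut]; apply/eqP => Qu.
    have : (tau Q z <= u%:E)%E by exact: hit_le.
    by move=> /(lt_le_trans tt); rewrite lte_fin ltNge ut.
  have te : t < t + e by rewrite ltrDl.
  have [r] := rat_in_itvoo te; rewrite in_itv/= => /andP[tr re].
  exists r; split; first by rewrite (le_trans t0)// ltW.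
  - by exists s, t; split => //; exact: ltW.
  - by move=> u /andP[u0 ur]; apply: He; rewrite u0 (le_trans ur)// ltW.
move=> [r [r0 [s [t [s0 st tr qs qt]]] H]].
have [e e0 He] := avoid_extend Q z _ cQ r0 H.
apply: (@le_lt_trans _ _ (ratr r)%:E).
  by apply: (@le_trans _ _ t%:E); [exact: (Xi0_le _ _ s)|rewrite lee_fin].
apply: (@lt_le_trans _ _ (ratr r + e)%:E); first by rewrite lte_fin ltrDl.
apply: le_hit => u [u0 Qu]; rewrite lee_fin leNgt; apply/negP => ur.
by have := He u; rewrite u0 ltW//= Qu eqxx => /(_ isT).
Qed.

(** The infimum in [tau] is attained: by continuity, avoiding [z] up to [t] would push [tau Q z]
    strictly beyond [t]. *)
Lemma tau_le_hit Q z t (x : \bar R) : continuous (clamp Q) -> 0 <= t ->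
  (tau Q z <= x)%E -> (x <= t%:E)%E -> exists2 u, 0 <= u <= t & Q u = z.
Proof.
move=> cQ t0 tx xt; apply: contrapT => nH.
have H u : 0 <= u <= t -> Q u != z.
  by move=> ut; apply/eqP => Qu; apply: nH; exists u.
have [e e0 He] := avoid_extend Q z t cQ t0 H.
have : ((t + e)%:E <= tau Q z)%E.
  apply: le_hit => u [u0 Qu]; rewrite lee_fin leNgt; apply/negP => ur.
  by have := He u; rewrite u0 ltW//= Qu eqxx => /(_ isT).
move=> /le_trans /(_ (le_trans tx xt)); rewrite lee_fin; lra.
Qed.

Lemma first_hit q z a b : continuous (clamp q) -> 0 <= a -> a <= b -> q b = z ->
  exists u, [/\ a <= u, u <= b, q u = z & forall t, a <= t -> t < u -> q t != z].
Proof.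
move=> cq a0 ab qb.
pose Z := [set t | a <= t <= b /\ q t = z].
have Zb : Z b by split; rewrite ?lexx ?ab.
have lbZ : lbound Z a by move=> t [/andP[]].
have infZ : has_inf Z by split; [exists b|exists a].
have ua : a <= inf Z by apply: lb_le_inf => //; exists b.
have ub : inf Z <= b by apply: ge_inf => //; exists a.
have u0 : 0 <= inf Z by exact: le_trans ua.
exists (inf Z); split => //.
- apply/eqP; apply: contraT => fu.
  have e0 : 0 < `|q (inf Z) - z| by rewrite normr_gt0 subr_eq0.
  have [d d0 H] := clamp_near q (inf Z) _ cq u0 e0.
  have [t Zt td] := inf_adherent d0 infZ.
  have tge : inf Z <= t by apply: ge_inf => //; exists a.
  have : `|q t - q (inf Z)| < `|q (inf Z) - z|.
    apply: H; first exact: le_trans tge.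
    by rewrite ger0_norm ?subr_ge0//; lra.
  by case: Zt => _ ->; rewrite distrC ltxx.
- move=> t at_ tu; apply/eqP => ft.
  have : inf Z <= t.
    apply: ge_inf; first by exists a.
    by split => //; rewrite at_ (le_trans (ltW tu)).
  by rewrite leNgt tu.
Qed.

(** [al] is the first visit to [B] and [xi] the first later visit to [2 * B]; the intermediate value
    theorem turns avoidance of a level into a strict inequality. The two strict regimes are those
    for which supermartingales are available. *)
Lemma cycle_structure B q p : 0 < B -> continuous (clamp q) -> q 0 = 2 * B ->
  cycle_done B q p -> exists al xi, [/\ 0 < al, al < xi, q al = B, (Xi0 B q <= xi%:E)%E &
    (forall t, 0 <= t -> t < al -> B < q t) /\ (forall t, al <= t -> t < xi -> q t < 2 * B)].
Proof.
move=> B0 cq q0 [s [t [s0 st tp qs qt]]].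
have [al [al0 als qal Hal]] := first_hit q B 0 s cq (lexx 0) s0 qs.
have alt : al <= t by rewrite (le_trans als)// ltW.
have [xi [alxi xit qxi Hxi]] := first_hit q (2 * B) al t cq al0 alt qt.
have alp : 0 < al.
  rewrite lt_neqAle al0 andbT; apply/eqP => E; move: qal; rewrite -E q0; lra.
have alx : al < xi.
  rewrite lt_neqAle alxi andbT; apply/eqP => E; move: qal; rewrite E qxi; lra.
exists al, xi; split => //; first exact: (Xi0_le _ _ al).
split => u h1 h2; rewrite ltNge; apply/negP => qu.
  have [|v] := @IVT _ q 0 u B h1 (continuous_clamp_within _ _ _ (lexx 0) cq).
    rewrite q0; apply/andP; split; first by rewrite ge_min qu orbT.
    by rewrite le_max; apply/orP; left; lra.
  rewrite in_itv/= => /andP[v0 vu] qv.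
  by have := Hal v v0 (le_lt_trans vu h2); rewrite qv eqxx.
have [|v] := @IVT _ q al u (2 * B) h1 (continuous_clamp_within _ _ _ al0 cq).
  rewrite qal; apply/andP; split; first by rewrite ge_min; apply/orP; left; lra.
  by rewrite le_max qu orbT.
rewrite in_itv/= => /andP[v0 vu] qv.
by have := Hxi v v0 (le_lt_trans vu h2); rewrite qv eqxx.
Qed.

End hitting_times.

(** * Measurability of hitting events *)

Section measurable_events.
Context {R : realType} {d : measure_display} {T : measurableType d}.

Lemma bigcup_measurable_rat (F : rat -> set T) (A : set rat) :
  (forall r, A r -> measurable (F r)) -> measurable (\bigcup_(r in A) F r).
Proof.
move=> AF; rewrite bigcup_mkcond; apply: bigcupT_measurable_rat => r.
by case: ifP => //; rewrite inE; exact: AF.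
Qed.

Lemma bigcapT_measurable_rat (F : rat -> set T) :
  (forall r, measurable (F r)) -> measurable (\bigcap_r F r).
Proof.
move=> mF; rewrite -[X in measurable X]setCK setC_bigcap; apply: measurableC.
by apply: bigcupT_measurable_rat => r; exact: measurableC.
Qed.

Definition cts_process (f : R -> T -> R) :=
  (forall t, 0 <= t -> measurable_fun setT (f t)) /\
  (forall w, continuous (clamp (f^~ w))).

(** On a compact interval the strict bound has a uniform margin, and the margin can be tested at
    rational times. Rationals are clipped into the interval so that [a = b] is covered too. *)
Lemma measurable_forall_lt (f : R -> T -> R) (a b c : R) : cts_process f -> 0 <= a -> a <= b ->
  measurable [set w | forall t : R, a <= t <= b -> f t w < c].
Proof.
move=> [mf cf] a0 ab.
pose clip (r : rat) : R := Num.max a (Num.min b (ratr r)).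
have clipP r : a <= clip r <= b.
  by rewrite /clip le_max lexx /= ge_max ab ge_min lexx.
have clip0 r : 0 <= clip r by have /andP[h _] := clipP r; exact: le_trans h.
rewrite (_ : [set w | _] = \bigcup_(n in setT) \bigcap_(r in [set: rat])
    [set w | f (clip r) w <= c - n.+1%:R^-1]).
  apply: bigcupT_measurable => n; apply: bigcapT_measurable_rat => r.
  rewrite -[X in measurable X]setTI.
  have -> : [set w | f (clip r) w <= c - n.+1%:R^-1] = f (clip r) @^-1` `]-oo, c - n.+1%:R^-1]%classic.
    by apply/seteqP; split => w /=; rewrite in_itv.
  by apply: mf.
apply/seteqP; split => [w H|w [n _ H] t /andP[at_ tb]].
  have [t tab Ht] := EVT_max ab (continuous_clamp_within _ _ b a0 (cf w)).
  rewrite in_itv/= in tab.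
  have e0 : 0 < c - f t w by rewrite subr_gt0 H.
  exists (Num.truncn (c - f t w)^-1) => // r _ /=.
  apply: (@le_trans _ _ (f t w)); first by apply: Ht; rewrite in_itv/= clipP.
  rewrite lerBrDr -lerBrDl -[leRHS]invrK lef_pV2 ?posrE ?invr_gt0//.
  by apply/ltW; rewrite truncnS_gt.
have t0 : 0 <= t by exact: le_trans at_.
rewrite ltNge; apply/negP => ft.
have e0 : 0 < n.+1%:R^-1 :> R by rewrite invr_gt0.
have [e ep He] := clamp_near _ t _ (cf w) t0 e0.
have te : t - e < t + e by lra.
have [r] := rat_in_itvoo te; rewrite in_itv/= => /andP[r1 r2].
have b1 : t - e < b by lra.
have b2 : a < t + e by lra.
have cl : `|clip r - t| < e.
  rewrite /clip ltr_norml; apply/andP; split.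
    rewrite ltrBrDl lt_max lt_min; apply/orP; right; apply/andP; split; [exact: b1|exact: r1].
  by rewrite ltrBlDr gt_max gt_min [e + t]addrC r2 orbT andbT.
have := H r I; have := He _ (clip0 r) cl; rewrite /= ltr_norml => /andP[h1 _] h2.
move: h1 h2 ft; move: (f (clip r) w) (f t w) (n.+1%:R^-1) => u1 u2 u3; lra.
Qed.

Lemma cts_processN f : cts_process f -> cts_process (fun t w => - f t w).
Proof.
move=> [mf cf]; split => [t t0|w t]; first by apply: measurableT_comp => //; exact: mf.
exact: continuousN (cf w t).
Qed.

Lemma measurable_cycle_done (q : R -> T -> R) (B p : R) : cts_process q -> 0 < B ->
  (forall w, q 0 w = 2 * B) -> measurable [set w | cycle_done B (q^~ w) p].
Proof.
move=> cq B0 q0.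
rewrite (_ : [set w | _] = \bigcup_(r in [set r : rat | 0 <= (ratr r : R) <= p])
  (~` [set w | forall s : R, 0 <= s <= ratr r -> - q s w < - B] `&`
   ([set w | q (ratr r) w < 2 * B] `&`
   ~` [set w | forall t : R, ratr r <= t <= p -> q t w < 2 * B]))).
  apply: bigcup_measurable_rat => r /= /andP[r0 rp].
  apply: measurableI.
    apply: measurableC; apply: measurable_forall_lt => //.
    exact: cts_processN.
  apply: measurableI; last by apply: measurableC; exact: measurable_forall_lt.
  have -> : [set w | q (ratr r) w < 2 * B] = q (ratr r) @^-1` `]-oo, 2 * B[%classic.
    by apply/seteqP; split => w /=; rewrite in_itv.
  by rewrite -[X in measurable X]setTI; apply: cq.1.
have notall (A : R -> Prop) (f : R -> R) (c : R) :
    ~ (forall t, A t -> f t < c) <-> exists2 t, A t & c <= f t.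
  split => [H|[t At ct] H]; last by have := H t At; rewrite ltNge ct.
  apply: contrapT => nH; apply: H => t At; rewrite ltNge; apply/negP => ct.
  by apply: nH; exists t.
apply/seteqP; split => w.
  move=> /(cycle_done_rat B (q^~ w) p B0 (cq.2 w) (q0 w))[r [rp [s sr qs] qr tt]].
  exists r => //; split; first by apply/notall; exists s => //; rewrite lerN2.
  by split => //; apply/notall.
move=> [r /= rp [/notall[s sr qs] [qr /notall tt]]].
apply/(cycle_done_rat B (q^~ w) p B0 (cq.2 w) (q0 w)); exists r; split => //.
by exists s => //; rewrite -lerN2.
Qed.

Lemma measurable_tau_le_Xi0 (q Q : R -> T -> R) (B z : R) : cts_process q -> cts_process Q ->
  0 < B -> (forall w, q 0 w = 2 * B) ->
  measurable [set w | (tau (Q^~ w) z <= Xi0 B (q^~ w))%E].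
Proof.
move=> cq cQ B0 q0.
rewrite (_ : [set w | _] = ~` [set w | (Xi0 B (q^~ w) < tau (Q^~ w) z)%E]); last first.
  by apply/seteqP; split => w /=; rewrite leNgt => /negP.
apply: measurableC.
(* Avoiding [z] on an interval means that this process stays negative there, which has the form of
   [measurable_forall_lt]. *)
have cA : cts_process (fun t w => - `|Q t w - z|).
  split => [t t0|w t].
    apply: measurableT_comp => //; apply: measurableT_comp => //.
    by apply: measurable_funB => //; exact: cQ.1.
  have cz : continuous_at t (fun s => clamp (Q^~ w) s - z).
    by apply: continuousB; [exact: cQ.2|exact: cst_continuous].
  have cn : continuous_at t (fun s => `|clamp (Q^~ w) s - z|).
    exact: (continuous_comp cz (@norm_continuous _ _ _)).
  exact: (continuousN cn).
rewrite (_ : [set w | _] = \bigcup_(r in [set r : rat | 0 <= ratr r :> R])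
  ([set w | cycle_done B (q^~ w) (ratr r)] `&`
   [set w | forall t : R, 0 <= t <= ratr r -> - `|Q t w - z| < 0])).
  apply: bigcup_measurable_rat => r /= r0; apply: measurableI.
    exact: measurable_cycle_done.
  exact: measurable_forall_lt.
apply/seteqP; split => w.
  move=> /(Xi0_lt_tau_rat _ _ _ _ (cQ.2 w))[r [r0 cd H]]; exists r => //; split => //= t tr.
  by rewrite oppr_lt0 normr_gt0 subr_eq0 H.
move=> [r /= r0 [cd H]]; apply/(Xi0_lt_tau_rat _ _ _ _ (cQ.2 w)); exists r; split => // t tr.
by have := H t tr; rewrite oppr_lt0 normr_gt0 subr_eq0.
Qed.

Lemma measurable_inf_lt (q Q : R -> T -> R) (B x : R) : cts_process q -> cts_process Q ->
  0 < B -> (forall w, q 0 w = 2 * B) -> (forall w, x <= Q 0 w) ->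
  measurable [set w | (ereal_inf [set (Q t w)%:E | t in
                        [set t | (0 <= t)%R /\ (t%:E <= Xi0 B (q^~ w))%E]]
                      < x%:E)%E].
Proof.
move=> cq cQ B0 q0 Q0.
rewrite (_ : [set w | _] = \bigcup_(r in [set r : rat | 0 <= ratr r :> R])
  ([set w | Q (ratr r) w < x] `&` ~` [set w | cycle_done B (q^~ w) (ratr r)])).
  apply: bigcup_measurable_rat => r /= r0; apply: measurableI; last first.
    by apply: measurableC; exact: measurable_cycle_done.
  have -> : [set w | Q (ratr r) w < x] = Q (ratr r) @^-1` `]-oo, x[%classic.
    by apply/seteqP; split => w /=; rewrite in_itv.
  by rewrite -[X in measurable X]setTI; apply: cQ.1.
apply/seteqP; split => w.
  move=> /= /ereal_inf_lt[_ [t [t0 tX] <-]]; rewrite lte_fin => Qt.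
  have e0 : 0 < x - Q t w by rewrite subr_gt0.
  have [e ep He] := clamp_near _ t _ (cQ.2 w) t0 e0.
  (* Since [Q] starts at or above [x], the time is positive and there is a rational [r < t] at which
     [Q] is still below [x]; as [r < t <= Xi0], the cycle is not done by [r]. *)
  have tp : 0 < t.
    rewrite lt_def t0 andbT; apply/eqP => t00.
    by move: Qt; rewrite t00 ltNge Q0.
  have mt : Num.max 0 (t - e) < t by rewrite gt_max tp; lra.
  have [r] := rat_in_itvoo mt; rewrite in_itv/= gt_max => /andP[/andP[r0 re] rt].
  exists r; first exact: ltW.
  split => /=.
    have : `|Q (ratr r) w - Q t w| < x - Q t w.
      apply: He; first exact: ltW.
      by rewrite distrC ger0_norm ?subr_ge0 ?(ltW rt)//; lra.
    by rewrite ltr_norml; lra.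
  move=> [s [u [s0 su ur qs qu]]].
  have : (t%:E <= u%:E)%E by apply: (le_trans tX); exact: (Xi0_le _ _ s).
  by rewrite lee_fin leNgt (le_lt_trans ur rt).
move=> [r /= r0 [Qr nc]]; apply/ereal_inf_ltP; exists (Q (ratr r) w)%:E.
  by exists (ratr r) => //; split => //; exact: le_Xi0.
by rewrite lte_fin.
Qed.

End measurable_events.

(** * Lyapunov functions *)

Section one_step.
Context {R : realType}.

Lemma eqr_leW (a b : R) : a = b -> a <= b.
Proof. by move=> ->. Qed.

Lemma expR_le_quadratic (v : R) : v <= 1 / 2 -> expR v <= 1 + v + 2 * v ^+ 2.
Proof.
move=> v2; have : 1 - v <= expR (- v) by exact: expR_ge1Dx.
rewrite expRN => H.
have e0 := expR_gt0 v.
have H2 : expR v * (1 - v) <= 1.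
  by move: H; rewrite -(ler_pM2l e0) divff ?gt_eqF.
(* The product equals [1 + v ^ 2 * (1 - 2 * v)]; this is where [v <= 1 / 2] enters. *)
have : (1 + v + 2 * v ^+ 2) * (1 - v) >= 1 by nra.
move=> H3; rewrite -(@ler_pM2r _ (1 - v)); first exact: le_trans H3.
lra.
Qed.

(** The exact Gaussian integral with [1 / (1 - 2 * c * h)] expanded in [h]: the first-order terms
    give the generator, and the second-order error stays explicit so that it can be made uniform on
    a box. *)
Lemma gauss_quad_ub (h k a c : R) : 0 < h -> `|2 * c * h| <= 1 / 2 ->
  (\int[normal_prob 0%R (Num.sqrt h)]_u (expR (k + (a * u + c * u ^+ 2)))%:E
   <= (expR (k + c * h + a ^+ 2 * h / 2 + (4 * c ^+ 2 + 2 * `|c| * a ^+ 2) * h ^+ 2))%:E)%E.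
Proof.
move=> h0 hc.
set y := 2 * c * h in hc.
have d0 : 0 < 1 - y by move: hc; rewrite ler_norml; lra.
under eq_integral do rewrite expRD EFinM.
rewrite ge0_integralZl//=; last first.
  apply/measurable_EFinP; apply: measurableT_comp => //.
  by apply: measurable_funD; apply: measurable_funM => //; exact: measurable_funX.
rewrite integral_normal_expR_quad// -EFinM lee_fin -/y.
have di : (1 - y)^-1 <= 1 + y + 2 * y ^+ 2.
  have : (1 + y + 2 * y ^+ 2) * (1 - y) >= 1.
    by move: hc; rewrite ler_norml => /andP[? ?]; nra.
  by move=> H; rewrite -[leLHS]mul1r ler_pdivrMr.
have ds : (Num.sqrt (1 - y))^-1 <= expR (c * h + 4 * c ^+ 2 * h ^+ 2).
  rewrite -sqrtrV; last exact: ltW.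
  apply: (@le_trans _ _ (Num.sqrt (expR (y + 2 * y ^+ 2)))).
    apply: ler_wsqrtr; apply: (le_trans di).
    by rewrite -addrA; exact: expR_ge1Dx.
  have -> : y + 2 * y ^+ 2 = (c * h + 4 * c ^+ 2 * h ^+ 2) * 2 by rewrite /y; ring.
  by rewrite expRM_natr sqrtr_sqr ger0_norm// expR_ge0.
have de : a ^+ 2 * h / (2 * (1 - y)) <= a ^+ 2 * h / 2 + 2 * `|c| * a ^+ 2 * h ^+ 2.
  have a2 : 0 <= a ^+ 2 * h / 2 by rewrite divr_ge0// mulr_ge0 ?sqr_ge0// ltW.
  rewrite invfM mulrA.
  apply: (@le_trans _ _ (a ^+ 2 * h / 2 * (1 + 2 * `|y|))).
    rewrite ler_wpM2l//; apply: (le_trans di).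
    have y1 : y <= `|y| by exact: ler_norm.
    have y2 : y ^+ 2 = `|y| ^+ 2 by rewrite real_normK// num_real.
    have y3 := normr_ge0 y.
    by rewrite y2; nra.
  rewrite /y !normrM (gtr0_norm h0) ger0_norm//.
  by apply/eqr_leW; field.
apply: (@le_trans _ _ (expR k * (expR (c * h + 4 * c ^+ 2 * h ^+ 2)
   * expR (a ^+ 2 * h / 2 + 2 * `|c| * a ^+ 2 * h ^+ 2)))).
  rewrite ler_pM2l ?expR_gt0//; apply: ler_pM => //.
  by rewrite ler_expR.
by rewrite -!expRD ler_expR; apply/eqr_leW; ring.
Qed.

Lemma gauss_quad_lb (h k a c : R) : 0 < h -> c <= 0 ->
  ((expR (k + c * h + a ^+ 2 * h / 2 - `|c| * a ^+ 2 * h ^+ 2))%:E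
   <= \int[normal_prob 0%R (Num.sqrt h)]_u (expR (k + (a * u + c * u ^+ 2)))%:E)%E.
Proof.
move=> h0 c0.
set y := 2 * c * h.
have y0 : y <= 0 by rewrite /y -mulrA mulr_ge0_le0// mulr_le0_ge0// ltW.
have d0 : 0 < 1 - y by lra.
under eq_integral do rewrite expRD EFinM.
rewrite ge0_integralZl//=; last first.
  apply/measurable_EFinP; apply: measurableT_comp => //.
  by apply: measurable_funD; apply: measurable_funM => //; exact: measurable_funX.
rewrite integral_normal_expR_quad// -EFinM lee_fin -/y.
have ds : expR (c * h) <= (Num.sqrt (1 - y))^-1.
  rewrite -sqrtrV; last exact: ltW.
  have -> : expR (c * h) = Num.sqrt (expR y).
    have -> : y = (c * h) * 2 by rewrite /y; ring.
    by rewrite expRM_natr sqrtr_sqr ger0_norm// expR_ge0.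
  apply: ler_wsqrtr; rewrite -[leLHS]invrK lef_pV2 ?posrE ?invr_gt0 ?expR_gt0//.
  by rewrite -expRN; exact: expR_ge1Dx.
have de : a ^+ 2 * h / 2 - `|c| * a ^+ 2 * h ^+ 2 <= a ^+ 2 * h / (2 * (1 - y)).
  have a2 : 0 <= a ^+ 2 * h / 2 by rewrite divr_ge0// mulr_ge0 ?sqr_ge0// ltW.
  rewrite invfM [leRHS]mulrA.
  apply: (@le_trans _ _ (a ^+ 2 * h / 2 * (1 + y))); last first.
    rewrite ler_wpM2l// -[leRHS]mul1r ler_pdivlMr//; nra.
  rewrite ler0_norm// /y.
  by apply/eqr_leW; field.
apply: (@le_trans _ _ (expR k * (expR (c * h)
   * expR (a ^+ 2 * h / 2 - `|c| * a ^+ 2 * h ^+ 2)))).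
  by rewrite -!expRD ler_expR; apply/eqr_leW; ring.
rewrite ler_pM2l ?expR_gt0//; apply: ler_pM => //; rewrite ?expR_ge0//.
by rewrite ler_expR.
Qed.

End one_step.

Section lyapunov.
Context {R : realType}.
Variable beta : R.
Hypothesis beta0 : 0 < beta.

Definition lyapX (z : R * R) : R := expR (z.1 ^+ 2 / 8).
Definition lyapF (lam i : R) (z : R * R) : R := expR (lam * (z.2 + i * z.1 ^+ 2 / 2)).
Definition lyapU (m : R) (z : R * R) : R := expR (- (z.2 - m) ^+ 2 / 2).

(** A bound on [X] and on [Q2], the latter being the sum of the two coordinates. Inside it the
    coefficients of the scheme are bounded by [beta + 2 * K + 1]. *)
Definition in_box (K : R) (z : R * R) : bool :=
  (0 <= z.1) && (z.1 <= K) && (0 <= z.1 + z.2) && (z.1 + z.2 <= K).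

Local Notation gauss h := (normal_prob 0%R (Num.sqrt h)).

Lemma measurable_lyapX : measurable_fun setT lyapX.
Proof.
apply: measurableT_comp => //; apply: measurable_funM => //.
by apply: measurable_funX; exact: measurable_fst.
Qed.

Lemma measurable_lyapF lam i : measurable_fun setT (lyapF lam i).
Proof.
apply: measurableT_comp => //; apply: measurable_funM => //; apply: measurable_funD.
  exact: measurable_snd.
apply: measurable_funM => //; apply: measurable_funM => //.
by apply: measurable_funX; exact: measurable_fst.
Qed.

Lemma measurable_lyapU m : measurable_fun setT (lyapU m).
Proof.
apply: measurableT_comp => //; apply: measurable_funM => //.
apply: measurableT_comp => //; apply: measurable_funX.
by apply: measurable_funB => //; exact: measurable_snd.
Qed.

Lemma measurable_estepr h z (f : R * R -> R) : measurable_fun setT f ->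
  measurable_fun setT (fun u : measurableTypeR R => (f (estep beta h z u))%:E).
Proof.
move=> mf; apply/measurable_EFinP.
have m := measurableT_comp mf (measurable_estep beta h).
have mp : measurable_fun setT (fun u : measurableTypeR R => (z, u)).
  exact: measurable_fun_pair.
exact: (measurableT_comp m mp).
Qed.

Lemma step_exp_ub h z (f : R * R -> R) k a c : measurable_fun setT f ->
  (forall y, 0 <= f y) -> 0 < h -> `|2 * c * h| <= 1 / 2 ->
  (forall u, f (estep beta h z u) <= expR (k + (a * u + c * u ^+ 2))) ->
  (\int[gauss h]_u (f (estep beta h z u))%:E
   <= (expR (k + c * h + a ^+ 2 * h / 2 + (4 * c ^+ 2 + 2 * `|c| * a ^+ 2) * h ^+ 2))%:E)%E.
Proof.
move=> mf f0 h0 hc H.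
apply: le_trans (gauss_quad_ub h k a c h0 hc).
apply: ge0_le_integral => //.
- by move=> u _; rewrite lee_fin.
- exact: measurable_estepr.
- apply/measurable_EFinP; apply: measurableT_comp => //; apply: measurable_funD => //.
  by apply: measurable_funD; apply: measurable_funM => //; exact: measurable_funX.
- by move=> u _; rewrite lee_fin.
Qed.

Lemma sqrt2_sqr : Num.sqrt 2 ^+ 2 = 2 :> R.
Proof. by rewrite sqr_sqrtr. Qed.

(* The reflection at 0 can only decrease [x ^+ 2], so it is harmless for test
   functions that are nondecreasing in [x ^+ 2]. *)
Lemma estep_sqr_le h z u : (estep beta h z u).1 ^+ 2 <=
  ((z.1 + (beta - 2 * z.1 - z.2) * h) - Num.sqrt 2 * u) ^+ 2.
Proof.
rewrite /= (_ : z.1 - _ + _ = (z.1 + (beta - 2 * z.1 - z.2) * h) - Num.sqrt 2 * u); last by ring.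
set v := (X in Num.max 0 X).
by have [v0|v0] := leP 0 v => //; rewrite expr0n sqr_ge0.
Qed.

(** The condition [4 * M * h <= 1] keeps the increment of the exponent below [1 / 2], where
    [expR_le_quadratic] applies. *)
Lemma exp_linearize (E0 A M h : R) : `|A| <= M -> 0 < h -> h <= 1 -> 4 * M * h <= 1 ->
  expR (E0 + h * A + h ^+ 2 * M) <= expR E0 * (1 + h * A + (M + 8 * M ^+ 2) * h ^+ 2).
Proof.
move=> AM h0 h1 Mh; rewrite -addrA expRD ler_pM2l ?expR_gt0//.
have M0 : 0 <= M by exact: le_trans AM.
have v1 : `|h * A + h ^+ 2 * M| <= 2 * M * h.
  apply: (le_trans (ler_normD _ _)); rewrite !normrM (gtr0_norm h0) (ger0_norm M0).
  have i1 : h * `|A| <= h * M by rewrite ler_pM2l.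
  have i2 : h ^+ 2 * M <= h * M by rewrite ler_wpM2r// expr2 ler_piMr// ltW.
  lra.
have v2 : h * A + h ^+ 2 * M <= 1 / 2 by move: v1; rewrite ler_norml; lra.
apply: (le_trans (expR_le_quadratic _ v2)).
have v3 : (h * A + h ^+ 2 * M) ^+ 2 <= (2 * M * h) ^+ 2.
  rewrite -[leLHS]real_normK ?num_real// ler_sqr ?nnegrE// !mulr_ge0//.
  exact: ltW.
move: v3; move: (_ ^+ 2) => v3; rewrite expr2 => v3'; nra.
Qed.

Lemma box_bounds K z : in_box K z -> [/\ 0 <= K, `|z.1| <= beta + 2 * K + 1,
  `|z.2| <= beta + 2 * K + 1 & `|beta - 2 * z.1 - z.2| <= beta + 2 * K + 1].
Proof.
move: beta0 => b0 /andP[/andP[/andP[h1 h2] h3] h4].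
by split; rewrite ?ler_norml; lra.
Qed.

(** The factor of [h] is the generator [f'' + (beta - 2 * x - s) * f'] applied to
    [f = expR (x ^ 2 / 8)] and divided by [f]. *)
Lemma step_lyapX K : 0 <= K -> exists M h1, [/\ 0 < M, 0 < h1 &
  forall h z, 0 < h -> h <= h1 -> in_box K z ->
  (\int[gauss h]_u (lyapX (estep beta h z u))%:E
   <= (lyapX z * (1 + h * (1 / 4 + z.1 ^+ 2 / 16 + z.1 * (beta - 2 * z.1 - z.2) / 4)
        + M * h ^+ 2))%:E)%E].
Proof.
move=> K0; pose N := beta + 2 * K + 1; pose M1 := 1 + N ^+ 2.
have N1 : 1 <= N by rewrite /N; have := beta0; lra.
have M10 : 1 < M1 by rewrite /M1; nra.
exists (M1 + 8 * M1 ^+ 2), (1 / (4 * M1)); split.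
- nra.
- by rewrite divr_gt0//; lra.
move=> h z h0 hh zK.
have hM : 4 * M1 * h <= 1 by move: hh; rewrite ler_pdivlMr; [lra|lra].
have h1 : h <= 1 by nra.
have [_ xN sN bN] := box_bounds _ _ zK.
case: z zK xN sN bN => x s /= zK xN sN bN; set b := beta - 2 * x - s in bN *.
rewrite -/N in xN sN bN.
pose m1 := x + b * h.
have s2 := sqrt2_sqr.
apply: (le_trans (step_exp_ub h (x, s) lyapX (m1 ^+ 2 / 8) (- (Num.sqrt 2 * m1 / 4)) (1 / 4)
  measurable_lyapX _ h0 _ _)).
- by move=> y; exact: expR_ge0.
- by rewrite ger0_norm; nra.
- move=> u; rewrite /lyapX ler_expR.
  have H : (estep beta h (x, s) u).1 ^+ 2 <= (m1 - Num.sqrt 2 * u) ^+ 2.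
    exact: (estep_sqr_le h (x, s) u).
  have -> : m1 ^+ 2 / 8 + (- (Num.sqrt 2 * m1 / 4) * u + 1 / 4 * u ^+ 2)
     = (m1 - Num.sqrt 2 * u) ^+ 2 / 8.
    have -> : (m1 - Num.sqrt 2 * u) ^+ 2 = m1 ^+ 2 - 2 * m1 * Num.sqrt 2 * u + Num.sqrt 2 ^+ 2 * u ^+ 2 by ring.
    by rewrite s2; field.
  by rewrite ler_pM2r.
rewrite lee_fin.
pose A := 1 / 4 + x ^+ 2 / 16 + x * b / 4.
have AM : `|A| <= M1.
  rewrite /A /M1; move: xN bN; rewrite !ler_norml => /andP[? ?] /andP[? ?].
  apply/andP; split; nra.
apply: le_trans (exp_linearize (x ^+ 2 / 8) A M1 h AM h0 h1 hM).
rewrite ler_expR sqrrN !exprMn s2 ger0_norm//.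
have xb : x * b <= N ^+ 2 /\ x ^+ 2 <= N ^+ 2 /\ b ^+ 2 <= N ^+ 2.
  by move: xN bN; rewrite !ler_norml => /andP[? ?] /andP[? ?]; do ! split; nra.
case: xb => xb [xx bb].
have m1E : m1 ^+ 2 = x ^+ 2 + 2 * h * (x * b) + h ^+ 2 * b ^+ 2 by rewrite /m1; ring.
have hh1 : h ^+ 2 <= 1 by rewrite expr2; nra.
have h2 : 0 < h ^+ 2 by rewrite exprn_gt0.
have t1 : h ^+ 2 * (x * b) <= h ^+ 2 * N ^+ 2 by rewrite ler_pM2l.
have t2 : h ^+ 2 * x ^+ 2 <= h ^+ 2 * N ^+ 2 by rewrite ler_pM2l.
have t3 : h ^+ 2 * b ^+ 2 <= h ^+ 2 * N ^+ 2 by rewrite ler_pM2l.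
have N2 : 0 <= h ^+ 2 * N ^+ 2 by rewrite mulr_ge0// sqr_ge0.
have shrink (v : R) : h ^+ 2 * v <= h ^+ 2 * N ^+ 2 -> h * (h ^+ 2 * v) <= h ^+ 2 * N ^+ 2.
  move=> hv; apply: (@le_trans _ _ (h * (h ^+ 2 * N ^+ 2))); first by rewrite ler_pM2l.
  by rewrite ler_piMl.
have t4 := shrink _ t1.
have t5 := shrink _ t3.
have t6 : h ^+ 2 * (h ^+ 2 * b ^+ 2) <= h ^+ 2 * N ^+ 2.
  by apply: (@le_trans _ _ (h ^+ 2 * b ^+ 2)) => //; rewrite ler_piMl// mulr_ge0 ?sqr_ge0// ltW.
rewrite m1E /A /M1.
move: t1 t2 t3 t4 t5 t6 h2 N2; rewrite !(mulrDl, mulrDr); lra.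
Qed.

(** Again the generator, now in two variables. [X] and [S] carry the same noise with opposite signs,
    so the logarithmic derivative along it is [lam * (1 - i * x)] up to a constant, whence the
    square. *)
Lemma step_lyapF lam i K : 0 < lam -> 0 < i -> 0 <= K ->
  exists M h1, [/\ 0 < M, 0 < h1 &
  forall h z, 0 < h -> h <= h1 -> in_box K z ->
  (\int[gauss h]_u (lyapF lam i (estep beta h z u))%:E
   <= (lyapF lam i z * (1 + h * (lam * ((z.1 - beta)
         + i * (z.1 * (beta - 2 * z.1 - z.2)) + i + lam * (1 - i * z.1) ^+ 2))
        + M * h ^+ 2))%:E)%E].
Proof.
move=> lam0 i0 K0; pose N := beta + 2 * K + 1; pose Pn := 1 + i * N.
pose M0 := lam * i * N ^+ 2 + 3 * lam ^+ 2 * Pn ^+ 2 + 4 * (lam * i) ^+ 2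
  + 16 * (lam * i) * lam ^+ 2 * Pn ^+ 2.
pose MA := lam * (N + beta + i * N ^+ 2 + i + lam * Pn ^+ 2).
pose M1 := M0 + MA + 1.
have b0 := beta0.
have N1 : 1 <= N by rewrite /N; lra.
have N0 : 0 < N by lra.
have P0 : 0 < Pn by rewrite /Pn addr_gt0// mulr_gt0.
have li0 : 0 < lam * i by rewrite mulr_gt0.
have M00 : 0 <= M0.
  by rewrite /M0 !addr_ge0// !mulr_ge0// ?sqr_ge0// ltW.
have MA0 : lam * i <= MA.
  rewrite /MA ler_pM2l//.
  have : 0 <= i * N ^+ 2 by rewrite mulr_ge0 ?sqr_ge0// ltW.
  have : 0 <= lam * Pn ^+ 2 by rewrite mulr_ge0 ?sqr_ge0// ltW.
  lra.
have M10 : 1 <= M1 by rewrite /M1; lra.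
exists (M1 + 8 * M1 ^+ 2), (1 / (4 * M1)); split.
- by rewrite addr_gt0// ?mulr_gt0 ?exprn_gt0//; lra.
- by rewrite divr_gt0//; lra.
move=> h z h0 hh zK.
have hM : 4 * M1 * h <= 1 by move: hh; rewrite ler_pdivlMr; [lra|lra].
have h1 : h <= 1 by nra.
have [_ xN sN bN] := box_bounds _ _ zK.
case: z zK xN sN bN => x s /= zK xN sN bN; set b := beta - 2 * x - s in bN *.
rewrite -/N in xN sN bN.
pose m1 := x + b * h.
have s2 := sqrt2_sqr.
pose p := 1 - i * x; pose r := i * b.
have pP : `|p| <= Pn.
  rewrite /p /Pn (le_trans (ler_normB _ _))// normr1 lerD2l normrM (gtr0_norm i0).
  by rewrite ler_pM2l.
have rP : `|r| <= Pn.
  rewrite /r /Pn normrM (gtr0_norm i0) (@le_trans _ _ (i * N))// ?ler_pM2l//; lra.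
apply: (le_trans (step_exp_ub h (x, s) (lyapF lam i)
  (lam * (s + (x - beta) * h + i * m1 ^+ 2 / 2)) (Num.sqrt 2 * lam * (1 - i * m1)) (lam * i)
  (measurable_lyapF lam i) _ h0 _ _)).
- by move=> y; exact: expR_ge0.
- rewrite ger0_norm; last by rewrite !mulr_ge0// ltW.
  have : lam * i * h <= M1 * h by rewrite ler_pM2r// /M1; lra.
  lra.
- move=> u; rewrite /lyapF ler_expR.
  have H : (estep beta h (x, s) u).1 ^+ 2 <= (m1 - Num.sqrt 2 * u) ^+ 2.
    exact: (estep_sqr_le h (x, s) u).
  have -> : lam * (s + (x - beta) * h + i * m1 ^+ 2 / 2)
      + (Num.sqrt 2 * lam * (1 - i * m1) * u + lam * i * u ^+ 2)
     = lam * (s + Num.sqrt 2 * u + (x - beta) * h + i * (m1 - Num.sqrt 2 * u) ^+ 2 / 2).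
    have -> : (m1 - Num.sqrt 2 * u) ^+ 2 = m1 ^+ 2 - 2 * m1 * Num.sqrt 2 * u + Num.sqrt 2 ^+ 2 * u ^+ 2 by ring.
    by rewrite s2; field.
  by rewrite ler_pM2l// lerD2l ler_pM2r// ler_pM2l.
rewrite lee_fin.
pose A := lam * ((x - beta) + i * (x * b) + i + lam * p ^+ 2).
have xb : `|x * b| <= N ^+ 2 by rewrite normrM expr2 ler_pM.
have p2 : p ^+ 2 <= Pn ^+ 2 by rewrite -[leLHS]real_normK ?num_real// ler_sqr ?nnegrE// ltW.
have b2 : b ^+ 2 <= N ^+ 2 by rewrite -[leLHS]real_normK ?num_real// ler_sqr ?nnegrE// ltW.
have AM : `|A| <= M1.
  apply: (@le_trans _ _ MA); last by rewrite /M1; lra.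
  rewrite /A /MA normrM (gtr0_norm lam0) ler_pM2l//.
  have ixb : `|i * (x * b)| <= i * N ^+ 2 by rewrite normrM (gtr0_norm i0) ler_pM2l.
  have lp : lam * p ^+ 2 <= lam * Pn ^+ 2 by rewrite ler_pM2l.
  have lp0 : 0 <= lam * p ^+ 2 by rewrite mulr_ge0 ?sqr_ge0// ltW.
  move: ixb xN; rewrite !ler_norml => /andP[? ?] /andP[? ?]; apply/andP; split; lra.
apply: le_trans (exp_linearize (lam * (s + i * x ^+ 2 / 2)) A M1 h AM h0 h1 hM).
rewrite ler_expR.
have li0' : `|lam * i| = lam * i by rewrite gtr0_norm.
have a2 : (Num.sqrt 2 * lam * (1 - i * m1)) ^+ 2 = 2 * lam ^+ 2 * (p - r * h) ^+ 2.
  rewrite !exprMn s2; congr (_ * _ ^+ 2); rewrite /p /r /m1; ring.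
rewrite li0' a2.
have -> : lam * (s + (x - beta) * h + i * m1 ^+ 2 / 2) + lam * i * h + 2 * lam ^+ 2 * (p - r * h) ^+ 2 * h / 2
   + (4 * (lam * i) ^+ 2 + 2 * (lam * i) * (2 * lam ^+ 2 * (p - r * h) ^+ 2)) * h ^+ 2
  = lam * (s + i * x ^+ 2 / 2) + h * A
    + h ^+ 2 * (lam * i * b ^+ 2 / 2 + lam ^+ 2 * (- 2 * (p * r) + r ^+ 2 * h) + 4 * (lam * i) ^+ 2
       + 4 * (lam * i) * (lam ^+ 2 * (p - r * h) ^+ 2)).
  by rewrite /A /m1; field.
rewrite lerD2l ler_pM2l ?exprn_gt0//.
apply: (@le_trans _ _ M0); last by rewrite /M1; have := ltW li0; lra.
have r2 : r ^+ 2 <= Pn ^+ 2 by rewrite -[leLHS]real_normK ?num_real// ler_sqr ?nnegrE// ltW.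
have pr : `|p * r| <= Pn ^+ 2 by rewrite normrM expr2 ler_pM.
have rh : `|p - r * h| <= 2 * Pn.
  have : `|r * h| <= Pn.
    by rewrite normrM (gtr0_norm h0) -[leRHS]mulr1 ler_pM// ltW.
  by move: pP; rewrite !ler_norml => /andP[? ?] /andP[? ?]; apply/andP; split; lra.
have rh2 : (p - r * h) ^+ 2 <= 4 * Pn ^+ 2.
  have -> : 4 * Pn ^+ 2 = (2 * Pn) ^+ 2 by ring.
  by rewrite -[leLHS]real_normK ?num_real// ler_sqr ?nnegrE// mulr_ge0// ltW.
have rrh : r ^+ 2 * h <= Pn ^+ 2.
  by rewrite -[leRHS]mulr1 ler_pM ?sqr_ge0// ltW.
have l2 : 0 < lam ^+ 2 by rewrite exprn_gt0.
have e1 : lam * i * b ^+ 2 / 2 <= lam * i * N ^+ 2.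
  have : lam * i * b ^+ 2 <= lam * i * N ^+ 2 by rewrite ler_pM2l.
  have : 0 <= lam * i * b ^+ 2 by rewrite mulr_ge0 ?sqr_ge0// ltW.
  lra.
have e2 : lam ^+ 2 * (- 2 * (p * r) + r ^+ 2 * h) <= lam ^+ 2 * (3 * Pn ^+ 2).
  by rewrite ler_pM2l//; move: pr; rewrite ler_norml => /andP[? ?]; lra.
have e3 : 4 * (lam * i) * (lam ^+ 2 * (p - r * h) ^+ 2) <= 4 * (lam * i) * (lam ^+ 2 * (4 * Pn ^+ 2)).
  by rewrite ler_pM2l ?mulr_gt0// ler_pM2l.
rewrite /M0; move: e1 e2 e3; lra.
Qed.

(** A lower bound, since [lyapU] enters the Lyapunov function of the last phase with a minus sign.
    It depends on [S] only, so the reflection does not appear and its integrand is an exact Gaussian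
    exponential. *)
Lemma step_lyapU m K : 0 <= K -> exists M, 0 < M /\
  forall h z, 0 < h -> h <= 1 -> in_box K z ->
  ((lyapU m z * (1 + h * ((z.2 - m) ^+ 2 - 1 - (z.2 - m) * (z.1 - beta))
        - M * h ^+ 2))%:E <= \int[gauss h]_u (lyapU m (estep beta h z u))%:E)%E.
Proof.
move=> K0; pose N := 2 * beta + 2 * K + 1 + `|m|; pose M := 12 * N ^+ 2.
have b0 := beta0.
have N1 : 1 <= N by rewrite /N; have := normr_ge0 m; lra.
exists M; split; first by rewrite /M mulr_gt0// exprn_gt0//; lra.
move=> h z h0 h1 zK.
have [_ xN sN _] := box_bounds _ _ zK.
case: z zK xN sN => x s /= zK xN sN.
have s2 := sqrt2_sqr.
pose nu := s - m; pose g := x - beta.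
have nuN : `|nu| <= N.
  by rewrite /nu /N (le_trans (ler_normB _ _))//; have := normr_ge0 m; lra.
have gN : `|g| <= N.
  by rewrite /g /N (le_trans (ler_normB _ _))// (gtr0_norm b0); have := normr_ge0 m; lra.
pose mu := nu + g * h.
have lb := gauss_quad_lb h (- mu ^+ 2 / 2) (- (Num.sqrt 2 * mu)) (-1) h0 (lerN10 R).
have E u : expR (- mu ^+ 2 / 2 + (- (Num.sqrt 2 * mu) * u + -1 * u ^+ 2)) = lyapU m (estep beta h (x, s) u).
  congr expR; rewrite /=.
  have -> : s + Num.sqrt 2 * u + (x - beta) * h - m = mu + Num.sqrt 2 * u.
    by rewrite /mu /nu /g; ring.
  have -> : (mu + Num.sqrt 2 * u) ^+ 2 = mu ^+ 2 + 2 * mu * (Num.sqrt 2 * u) + Num.sqrt 2 ^+ 2 * u ^+ 2 by ring.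
  by rewrite s2; field.
under eq_integral do rewrite -E.
apply: le_trans lb; rewrite lee_fin normrN1 mul1r sqrrN exprMn s2.
pose A := nu ^+ 2 - 1 - nu * g.
apply: (@le_trans _ _ (expR (- nu ^+ 2 / 2) * expR (h * A - M * h ^+ 2))).
  by rewrite /lyapU ler_pM2l ?expR_gt0// -addrA; exact: expR_ge1Dx.
rewrite -expRD ler_expR.
have -> : - mu ^+ 2 / 2 + -1 * h + 2 * mu ^+ 2 * h / 2 - 2 * mu ^+ 2 * h ^+ 2
  = - nu ^+ 2 / 2 + h * A + h ^+ 2 * (- g ^+ 2 / 2 + 2 * (nu * g) + g ^+ 2 * h - 2 * mu ^+ 2).
  by rewrite /mu /A; field.
rewrite addrA lerD2l mulrC -mulrN ler_pM2l ?exprn_gt0//.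
have N0 : 0 <= N by lra.
have g2 : g ^+ 2 <= N ^+ 2 by rewrite -[leLHS]real_normK ?num_real// ler_sqr ?nnegrE.
have ng : `|nu * g| <= N ^+ 2 by rewrite normrM expr2 ler_pM.
have gh : 0 <= g ^+ 2 * h by rewrite mulr_ge0 ?sqr_ge0// ltW.
have muN : `|mu| <= 2 * N.
  have : `|g * h| <= N by rewrite normrM (gtr0_norm h0) -[leRHS]mulr1 ler_pM// ltW.
  by rewrite /mu; move: nuN; rewrite !ler_norml => /andP[? ?] /andP[? ?]; apply/andP; split; lra.
have mu2 : mu ^+ 2 <= 4 * N ^+ 2.
  have -> : 4 * N ^+ 2 = (2 * N) ^+ 2 by ring.
  by rewrite -[leLHS]real_normK ?num_real// ler_sqr ?nnegrE// mulr_ge0.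
have g20 := sqr_ge0 g.
rewrite /M; move: ng; rewrite ler_norml => /andP[? ?]; lra.
Qed.

End lyapunov.

(** * Drift inequalities *)

Section drift.
Context {R : realType}.
Variables (beta B : R).
Hypothesis beta0 : 0 < beta.
Hypothesis B_large : 4 * (beta + beta^-1) <= B.

Local Notation gauss h := (normal_prob 0%R (Num.sqrt h)).
Let eps := 2 * (beta + beta^-1).
Let i := eps^-1.
Let lam := beta / 4.

Let ib0 : 0 < beta^-1. Proof. by rewrite invr_gt0. Qed.
Let eps0 : 0 < eps. Proof. by rewrite /eps; have := ib0; have := beta0; lra. Qed.
Let i0 : 0 < i. Proof. by rewrite invr_gt0. Qed.
Let lam0 : 0 < lam. Proof. by rewrite divr_gt0. Qed.
Let ieps : i * eps = 1. Proof. by rewrite mulVf// gt_eqF. Qed.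

(* The generator applied to [V0] is at most [- (beta / 4) ^+ 2 * V0] where [B <= Q2]: the drift
   [X - beta] of [S] is compensated by that of the quadratic term, which is of order [- Q2 * X]. *)
Definition V0 : R * R -> R := lyapF (beta / 4) (2 * (beta + beta^-1))^-1.

Lemma measurable_V0 : measurable_fun setT V0.
Proof. exact: measurable_lyapF. Qed.

Lemma V0_gt0 z : 0 < V0 z. Proof. exact: expR_gt0. Qed.

(** For given [Q2 = x + s], the exponent is smallest at [x = eps], where the quadratic term has
    recovered all but [eps / 2] of [Q2]. *)
Lemma V0_ge (z : R * R) (q : R) : 0 <= z.1 -> q <= z.1 + z.2 ->
  expR (lam * (q - eps / 2)) <= V0 z.
Proof.
case: z => x s /= x0 qz; rewrite /V0 /lyapF ler_expR ler_pM2l//= -/eps -/i.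
have : 0 <= i * (x - eps) ^+ 2 by rewrite mulr_ge0 ?sqr_ge0// ltW.
have -> : i * (x - eps) ^+ 2 = i * x ^+ 2 - 2 * x * (i * eps) + eps * (i * eps) by ring.
by rewrite ieps; lra.
Qed.

Lemma V0_ge1 (z : R * R) : 0 <= z.1 -> B <= z.1 + z.2 -> 1 <= V0 z.
Proof.
move=> x0 qz; apply: le_trans (V0_ge _ _ x0 qz).
apply: le_trans (expR_ge1Dx _); rewrite lerDl mulr_ge0 ?ltW//.
by have := B_large; have := ib0; have := beta0; rewrite /eps; lra.
Qed.

(** In terms of [u = x / eps], the bracket is bounded by a quadratic. Its constant term
    [i + lam - beta] is at most [- beta / 4] because [i <= beta / 2], its linear coefficient is
    nonpositive because [eps + beta / 2 <= B], its quadratic one because [lam <= eps]. These three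
    conditions dictate [eps], [lam] and the size of [B]. *)
Let drift_F (x s : R) : 0 <= x -> B <= x + s ->
  lam * ((x - beta) + i * (x * (beta - 2 * x - s)) + i + lam * (1 - i * x) ^+ 2)
  <= - (lam * (beta / 4)).
Proof.
move=> x0 qB; rewrite -[leRHS]mulrN ler_pM2l//.
set u := i * x.
have u0 : 0 <= u by rewrite mulr_ge0// ltW.
have xE : x = eps * u by rewrite /u mulrA [eps * i]mulrC ieps mul1r.
have i2 : i <= beta / 2.
  rewrite /i -[leLHS]mul1r ler_pdivrMr// /eps.
  have : beta * beta^-1 = 1 by rewrite mulfV// gt_eqF.
  have := beta0; nra.
have -> : i * (x * (beta - 2 * x - s)) = u * (beta - 2 * x - s) by rewrite /u mulrA.
have h1 : u * (beta - 2 * x - s) <= u * (beta - x - B) by rewrite ler_wpM2l//; lra.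
have h2 : u * (eps + beta / 2 - B) <= 0.
  by rewrite mulr_ge0_le0// /eps; have := B_large; have := ib0; have := beta0; lra.
have h3 : u ^+ 2 * (lam - eps) <= 0.
  by rewrite mulr_ge0_le0 ?sqr_ge0// /eps /lam; have := ib0; have := beta0; lra.
have : (x - beta) + u * (beta - x - B) + i + lam * (1 - u) ^+ 2
  = (i + lam - beta) + u * (eps + beta - 2 * lam - B) + u ^+ 2 * (lam - eps).
  by rewrite [in LHS]xE; ring.
have -> : u * (eps + beta - 2 * lam - B) = u * (eps + beta / 2 - B) by rewrite /lam; congr (_ * _); field.
rewrite /lam in h3 *; lra.
Qed.

Lemma in_box_x0 (K : R) (z : R * R) : in_box K z -> 0 <= z.1.
Proof. by move=> /andP[/andP[/andP[]]]. Qed.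

Lemma in_box_q0 (K : R) (z : R * R) : in_box K z -> 0 <= z.1 + z.2.
Proof. by move=> /andP[/andP[]]. Qed.

Let lyapX_bounded (K : R) (z : R * R) : in_box K z -> lyapX z <= expR (K ^+ 2 / 8).
Proof.
move=> /andP[/andP[/andP[x0 xK] _] _]; rewrite ler_expR ler_pM2r//.
by rewrite ler_sqr ?nnegrE// (le_trans x0).
Qed.

Lemma lyapX_ge1 (z : R * R) : 1 <= lyapX z.
Proof.
by apply: le_trans (expR_ge1Dx _); rewrite lerDl mulr_ge0 ?sqr_ge0// invr_ge0.
Qed.

Let V0_bounded (K : R) (z : R * R) : in_box K z -> V0 z <= expR (lam * (K + i * K ^+ 2 / 2)).
Proof.
case: z => x s /andP[/andP[/andP[/= x0 xK] q0] qK]; rewrite ler_expR ler_pM2l//=.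
rewrite -/eps -/i.
have : i * x ^+ 2 <= i * K ^+ 2 by rewrite ler_pM2l// ler_sqr ?nnegrE// (le_trans x0).
lra.
Qed.

Lemma phaseF_drift K : 0 <= K -> exists M h1, [/\ 0 < M, 0 < h1 &
  forall h z, 0 < h -> h <= h1 -> in_box K z -> B <= z.1 + z.2 ->
  (\int[gauss h]_u (V0 (estep beta h z u))%:E
   <= (V0 z - h * (lam * (beta / 4) * V0 z) + M * h ^+ 2)%:E)%E].
Proof.
move=> K0; have [M [h1 [M0 h10 H]]] := step_lyapF beta beta0 lam i K lam0 i0 K0.
pose M' := expR (lam * (K + i * K ^+ 2 / 2)) * M.
exists M', h1; split => //; first by rewrite mulr_gt0// expR_gt0.
move=> h z h0 hh zK qB; apply: (le_trans (H h z h0 hh zK)); rewrite lee_fin.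
rewrite -[lyapF lam i z]/(V0 z).
have dF := drift_F _ _ (in_box_x0 _ _ zK) qB.
have hd : h * (lam * ((z.1 - beta) + i * (z.1 * (beta - 2 * z.1 - z.2)) + i + lam * (1 - i * z.1) ^+ 2)) <= h * (- (lam * (beta / 4))).
  by rewrite ler_pM2l.
have h2 : 0 <= M * h ^+ 2 by rewrite mulr_ge0 ?sqr_ge0// ltW.
apply: (@le_trans _ _ (V0 z * (1 + h * (- (lam * (beta / 4))) + M * h ^+ 2))).
  by rewrite ler_pM2l ?V0_gt0//; lra.
have := ler_wpM2r h2 (V0_bounded _ _ zK).
rewrite /M'; lra.
Qed.

(** Bounds the drift of [lyapX] plus [lyapX] itself. Since [Q2 >= 0], that sum is at most [lyapX]
    times [5 / 4 + beta * x / 4 - 3 * x ^ 2 / 16], which is nonpositive beyond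
    [x = 2 * beta + 4]. *)
Definition C0 : R := expR ((2 * beta + 4) ^+ 2 / 8) * (5 / 4 + beta * (2 * beta + 4) / 4).

Lemma C0_gt0 : 0 < C0.
Proof. by rewrite mulr_gt0 ?expR_gt0//; have := beta0; nra. Qed.

Let drift_X (x s : R) : 0 <= x -> 0 <= x + s ->
  expR (x ^+ 2 / 8) * (1 / 4 + x ^+ 2 / 16 + x * (beta - 2 * x - s) / 4)
  <= C0 - expR (x ^+ 2 / 8).
Proof.
move=> x0 q0; have b0 := beta0; set e := expR _.
have e0 : 0 < e by exact: expR_gt0.
suff : e * (5 / 4 + x ^+ 2 / 16 + x * (beta - 2 * x - s) / 4) <= C0 by lra.
have h1 : 5 / 4 + x ^+ 2 / 16 + x * (beta - 2 * x - s) / 4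
    <= 5 / 4 + beta * x / 4 - 3 * x ^+ 2 / 16 by nra.
apply: (@le_trans _ _ (e * (5 / 4 + beta * x / 4 - 3 * x ^+ 2 / 16))).
  by rewrite ler_pM2l.
have [xl|xl] := leP (2 * beta + 4) x.
  apply: (@le_trans _ _ 0); last exact: ltW C0_gt0.
  by rewrite mulr_ge0_le0 ?(ltW e0)//; nra.
rewrite /C0; apply: (@le_trans _ _ (e * (5 / 4 + beta * (2 * beta + 4) / 4))).
  by rewrite ler_pM2l//; have := sqr_ge0 x; nra.
rewrite ler_wpM2r//; first by nra.
by rewrite ler_expR ler_pM2r// ler_sqr ?nnegrE//; [exact: ltW|lra].
Qed.

Lemma phaseX_drift K : 0 <= K -> exists M h1, [/\ 0 < M, 0 < h1 &
  forall h z, 0 < h -> h <= h1 -> in_box K z ->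
  (\int[gauss h]_u (lyapX (estep beta h z u))%:E
   <= (lyapX z + h * (C0 - lyapX z) + M * h ^+ 2)%:E)%E].
Proof.
move=> K0; have [M [h1 [M0 h10 H]]] := step_lyapX beta beta0 K K0.
pose M' := expR (K ^+ 2 / 8) * M.
exists M', h1; split => //; first by rewrite mulr_gt0// expR_gt0.
move=> h z h0 hh zK; apply: (le_trans (H h z h0 hh zK)); rewrite lee_fin.
have dX := drift_X _ _ (in_box_x0 _ _ zK) (in_box_q0 _ _ zK).
rewrite -/(lyapX z) in dX.
have hd := ler_wpM2l (ltW h0) dX.
have h2 : 0 <= M * h ^+ 2 by rewrite mulr_ge0 ?sqr_ge0// ltW.
have := ler_wpM2r h2 (lyapX_bounded _ _ zK).
rewrite /M'; lra.
Qed.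

End drift.

Section phases.
Context {R : realType}.
Variables (beta B : R).
Hypothesis beta0 : 0 < beta.
Hypothesis B_large : 4 * (beta + beta^-1) <= B.
Local Notation gauss h := (normal_prob 0%R (Num.sqrt h)).
Local Notation V0 := (V0 beta).
Local Notation C0 := (C0 beta).

Let B0 : 0 < B.
Proof. by apply: lt_le_trans B_large; rewrite mulr_gt0// addr_gt0// invr_gt0. Qed.

Let rate := beta / 4 * (beta / 4).
Let rate0 : 0 < rate. Proof. by rewrite mulr_gt0// divr_gt0. Qed.

(** The decay [h * rate * V0] is at least [h * rate], because [V0 >= 1] where [B <= Q2], and absorbs
    the error [M * h ^ 2] for small [h]. *)
Lemma phaseF K : 0 <= K -> exists2 h1, 0 < h1 &
  forall h z, 0 < h -> h <= h1 -> in_box K z -> B <= z.1 + z.2 ->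
  (\int[gauss h]_u (V0 (estep beta h z u))%:E <= (V0 z)%:E)%E.
Proof.
move=> K0; have [M [h1 [M0 h10 H]]] := phaseF_drift beta B beta0 B_large K K0.
exists (Num.min h1 (rate / M)); first by rewrite lt_min h10 divr_gt0.
move=> h z h0; rewrite le_min => /andP[hh1 hh2] zK qB.
apply: (le_trans (H h z h0 hh1 zK qB)); rewrite lee_fin -/rate.
have V1 := V0_ge1 beta B beta0 B_large z (in_box_x0 _ _ zK) qB.
have hM : h * M <= rate by rewrite -ler_pdivlMr.
have : h * (h * M) <= h * rate by rewrite ler_pM2l.
have : h * rate <= h * (rate * V0 z) by rewrite ler_pM2l// ler_peMr// ltW.
rewrite expr2; lra.
Qed.

(** Without a restriction on [Q2] there is only a bounded growth rate; it is paid over a single unit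
    of time. *)
Lemma phaseN K : 0 <= K -> exists2 h1, 0 < h1 &
  forall h z, 0 < h -> h <= h1 -> in_box K z ->
  (\int[gauss h]_u (lyapX (estep beta h z u))%:E <= ((1 + C0 * h) * lyapX z)%:E)%E.
Proof.
move=> K0; have [M [h1 [M0 h10 H]]] := phaseX_drift beta beta0 K K0.
exists (Num.min h1 M^-1); first by rewrite lt_min h10 invr_gt0.
move=> h z h0; rewrite le_min => /andP[hh1 hh2] zK.
apply: (le_trans (H h z h0 hh1 zK)); rewrite lee_fin.
have X1 := lyapX_ge1 z.
have hM : h * M <= 1 by rewrite -ler_pdivlMr// mul1r.
have : h * (h * M) <= h * 1 by rewrite ler_pM2l.
have : h * 1 <= h * lyapX z by rewrite ler_pM2l.
have C00 := C0_gt0 beta beta0.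
have : h * C0 <= h * (C0 * lyapX z) by rewrite ler_pM2l// ler_peMr// ltW.
rewrite expr2; lra.
Qed.

Definition V1 (k : R) (z : R * R) : R := lyapX z + k * V0 z.

Lemma measurable_V1 k : measurable_fun setT (V1 k).
Proof.
apply: measurable_funD; first exact: measurable_lyapX.
by apply: measurable_funM => //; exact: measurable_V0.
Qed.

Lemma V1_geX k z : 0 <= k -> lyapX z <= V1 k z.
Proof. by move=> k0; rewrite lerDl mulr_ge0// ltW// V0_gt0. Qed.

Lemma phase1 : exists k eta : R, [/\ 0 < k, 0 < eta & eta <= 1] /\
  forall K, 0 <= K -> exists2 h1, 0 < h1 &
  forall h z, 0 < h -> h <= h1 -> in_box K z -> B <= z.1 + z.2 ->
  (\int[gauss h]_u (V1 k (estep beta h z u))%:E <= ((1 - eta * h) * V1 k z)%:E)%E.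
Proof.
have C00 := C0_gt0 beta beta0.
(* Half of the decay of [k * V0] compensates the constant [C0] in the drift of [lyapX]; the other
   half, with that of [lyapX], leaves a rate [2 * eta], of which one [eta] absorbs the [h ^ 2]
   errors. *)
pose k := 2 * C0 / rate.
have k0 : 0 < k by rewrite divr_gt0// mulr_gt0.
have kr : k * rate = 2 * C0 by rewrite /k divfK// gt_eqF.
pose eta := Num.min 1 (rate / 2) / 2.
have e0 : 0 < eta by rewrite divr_gt0// lt_min ltr01 divr_gt0.
have e1 : 2 * eta <= 1 by rewrite /eta mulrC divfK// ge_min lexx.
have e2 : 2 * eta <= rate / 2 by rewrite /eta mulrC divfK// ge_min lexx orbT.
exists k, eta; split; first by split => //; lra.
move=> K K0.
have [M [h1 [M0 h10 HX]]] := phaseX_drift beta beta0 K K0.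
have [M' [h2 [M0' h20 HF]]] := phaseF_drift beta B beta0 B_large K K0.
pose MM := M + k * M'.
have MM0 : 0 < MM by rewrite addr_gt0// mulr_gt0.
exists (Num.min h1 (Num.min h2 (eta / MM))); first by rewrite !lt_min h10 h20 divr_gt0.
move=> h z h0; rewrite !le_min => /and3P[hh1 hh2 hh3] zK qB.
have IX := HX h z h0 hh1 zK.
have IF := HF h z h0 hh2 zK qB.
rewrite /V1; under eq_integral do rewrite EFinD EFinM.
rewrite ge0_integralD//; last 4 first.
- by move=> u _; rewrite lee_fin ltW// expR_gt0.
- by apply: measurable_estepr; exact: measurable_lyapX.
- by move=> u _; rewrite mule_ge0// lee_fin ltW// V0_gt0.
- by apply: measurable_funeM; apply: measurable_estepr; exact: measurable_V0.
rewrite ge0_integralZl//; last 3 first.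
- by apply: measurable_estepr; exact: measurable_V0.
- by move=> u _; rewrite lee_fin ltW// V0_gt0.
- by rewrite lee_fin ltW.
apply: (@le_trans _ _ ((lyapX z + h * (C0 - lyapX z) + M * h ^+ 2)%:E
   + k%:E * (V0 z - h * (rate * V0 z) + M' * h ^+ 2)%:E)%E).
  by apply: leeD => //; rewrite lee_wpmul2l// lee_fin ltW.
rewrite -EFinM -EFinD lee_fin.
have W1 := V0_ge1 beta B beta0 B_large z (in_box_x0 _ _ zK) qB.
have X1 := lyapX_ge1 z.
have Z1 : 1 <= lyapX z + k * V0 z.
  by have : 0 <= k * V0 z by [rewrite mulr_ge0 ?ltW// V0_gt0]; lra.
have hM : h * MM <= eta by rewrite -ler_pdivlMr.
have t1 : h * (h * MM) <= h * (eta * (lyapX z + k * V0 z)).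
  by rewrite ler_pM2l// (le_trans hM)// ler_peMr// ltW.
have t2 : h * C0 <= h * (k * rate / 2 * V0 z).
  by rewrite ler_pM2l// kr mulrC [2 * C0]mulrC mulfK// ler_peMl// ltW.
have t3 : h * (2 * eta * lyapX z) <= h * lyapX z.
  by rewrite ler_pM2l// ler_piMl//; lra.
have t4 : h * (2 * eta * (k * V0 z)) <= h * (rate / 2 * (k * V0 z)).
  by rewrite ler_pM2l// ler_wpM2r// mulr_ge0 ?ltW// V0_gt0.
move: t1 t2 t3 t4; rewrite /MM expr2; lra.
Qed.

(* On [Q2 <= 2 * B] the centre [2 * B + beta + 2] lies above [S], so [1 - lyapU] has a negative
   drift on the compact region where [lyapX] has not. *)
Definition V2 (k : R) (z : R * R) : R :=
  lyapX z + k * (1 - lyapU (2 * B + beta + 2) z).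

Let lyapU_le1 m (z : R * R) : lyapU m z <= 1.
Proof.
rewrite -expR0 ler_expR mulNr oppr_le0 mulr_ge0 ?sqr_ge0// invr_ge0//.
Qed.

Lemma measurable_V2 k : measurable_fun setT (V2 k).
Proof.
apply: measurable_funD; first exact: measurable_lyapX.
apply: measurable_funM => //; apply: measurable_funB => //; exact: measurable_lyapU.
Qed.

Lemma V2_geX k z : 0 <= k -> lyapX z <= V2 k z.
Proof. by move=> k0; rewrite lerDl mulr_ge0// subr_ge0. Qed.

Lemma V2_leX k z : 0 <= k -> V2 k z <= (1 + k) * lyapX z.
Proof.
move=> k0; have -> : (1 + k) * lyapX z = lyapX z + k * lyapX z by ring.
rewrite lerD2l ler_wpM2l//.
by apply: le_trans (lyapX_ge1 z); rewrite gerBl expR_ge0.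
Qed.

Lemma phase2 : exists k eta : R, [/\ 0 < k, 0 < eta & eta <= 1] /\
  forall K, 0 <= K -> exists2 h1, 0 < h1 &
  forall h z, 0 < h -> h <= h1 -> in_box K z -> z.1 + z.2 <= 2 * B ->
  (\int[gauss h]_u (V2 k (estep beta h z u))%:E <= ((1 - eta * h) * V2 k z)%:E)%E.
Proof.
have C00 := C0_gt0 beta beta0.
pose m := 2 * B + beta + 2.
(* When [lyapX < 2 * C0], one has [x <= x1] and hence [s >= - x1], so [lyapU] is at least [u0]. The
   choice [k * u0 = C0] then cancels the positive drift; when [2 * C0 <= lyapX] the drift of [lyapX]
   suffices alone. *)
pose x1 := 4 * (C0 + 1).
pose u0 := expR (- (m + x1) ^+ 2 / 2).
have u00 : 0 < u0 by exact: expR_gt0.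
pose k := C0 / u0.
have k0 : 0 < k by rewrite divr_gt0.
have ku : k * u0 = C0 by rewrite /k divfK// gt_eqF.
pose eta := (4 * (1 + k))^-1.
have k10 : 0 < 4 * (1 + k) by rewrite mulr_gt0// addr_gt0.
have e0 : 0 < eta by rewrite invr_gt0.
have ek : 4 * eta * (1 + k) = 1 by rewrite mulrAC /eta mulfV// gt_eqF.
have e1 : eta <= 1 by nra.
exists k, eta; split => //.
move=> K K0.
have [M [h1 [M0 h10 HX]]] := phaseX_drift beta beta0 K K0.
have [M' [M0' HU]] := step_lyapU beta beta0 m K K0.
pose MM := M + k * M'.
have MM0 : 0 < MM by rewrite addr_gt0// mulr_gt0.
exists (Num.min h1 (Num.min 1 (eta / MM))); first by rewrite !lt_min h10 ltr01 divr_gt0.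
move=> h z h0; rewrite !le_min => /and3P[hh1 hh2 hh3] zK qB.
have IX := HX h z h0 hh1 zK.
have IU := HU h z h0 hh2 zK.
have V20 y : 0 <= V2 k y.
  by apply: (le_trans _ (V2_geX k y (ltW k0))); rewrite ltW// expR_gt0.
(* Nonnegative integrals are added on both sides instead of being subtracted in the extended
   reals. *)
have sumE : (\int[gauss h]_u (V2 k (estep beta h z u))%:E
    + k%:E * \int[gauss h]_u (lyapU m (estep beta h z u))%:E
    = \int[gauss h]_u (lyapX (estep beta h z u))%:E + k%:E)%E.
  rewrite -ge0_integralZl//; last 3 first.
  - by apply: measurable_estepr; exact: measurable_lyapU.
  - by move=> u _; rewrite lee_fin expR_ge0.
  - by rewrite lee_fin ltW.
  rewrite -ge0_integralD//; last 4 first.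
  - by move=> u _; rewrite lee_fin.
  - by apply: measurable_estepr; exact: measurable_V2.
  - by move=> u _; rewrite -EFinM lee_fin; apply: mulr_ge0; [exact: ltW|exact: expR_ge0].
  - by apply: measurable_funeM; apply: measurable_estepr; exact: measurable_lyapU.
  have kE : (k%:E = \int[gauss h]_u (cst k%:E u))%E.
    by rewrite integral_cst//= probability_setT mule1.
  rewrite [in RHS]kE -ge0_integralD//; last 3 first.
  - by move=> u _; rewrite lee_fin expR_ge0.
  - by apply: measurable_estepr; exact: measurable_lyapX.
  - by move=> u _; rewrite lee_fin ltW.
  apply: eq_integral => u _; rewrite -EFinM -!EFinD; congr EFin.
  by rewrite /V2 -/m; ring.
set A := ((z.2 - m) ^+ 2 - 1 - (z.2 - m) * (z.1 - beta)) in IU.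
set c := (lyapX z + h * (C0 - lyapX z) + M * h ^+ 2) in IX.
set d := (lyapU m z * (1 + h * A - M' * h ^+ 2)) in IU.
have step1 : (\int[gauss h]_u (V2 k (estep beta h z u))%:E <= (c + k - k * d)%:E)%E.
  have : (\int[gauss h]_u (V2 k (estep beta h z u))%:E + (k * d)%:E <= (c + k)%:E)%E.
    apply: (@le_trans _ _ (\int[gauss h]_u (V2 k (estep beta h z u))%:E
      + k%:E * \int[gauss h]_u (lyapU m (estep beta h z u))%:E)%E).
      by rewrite leeD2l// EFinM lee_wpmul2l// lee_fin ltW.
    by rewrite sumE EFinD leeD2r.
  by rewrite [(c + k - k * d)%:E]EFinB leeBrDr.
apply: (le_trans step1); rewrite lee_fin.
have x0 := in_box_x0 _ _ zK; have q0 := in_box_q0 _ _ zK.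
pose x := z.1; pose s := z.2.
pose X := lyapX z; pose U := lyapU m z.
have X1 : 1 <= X by exact: lyapX_ge1.
have U1 : U <= 1 by exact: lyapU_le1.
have U0 : 0 < U by exact: expR_gt0.
rewrite -/x -/s in qB x0 q0.
have A1 : 1 <= A.
  have ms : beta + 2 <= m - s by rewrite /m; lra.
  have := beta0 => b0.
  have -> : A = (m - s) * (m - s - beta + x) - 1 by rewrite /A -/x -/s; ring.
  nra.
have key : C0 - X - k * (A * U) <= - (X / 2).
  have kAU : k * U <= k * (A * U) by rewrite ler_pM2l// ler_peMl// ltW.
  have [Xl|Xl] := leP (2 * C0) X.
    have : 0 <= k * U by rewrite mulr_ge0// ltW.
    lra.
  have xx1 : x <= x1.
    rewrite leNgt; apply/negP => xl.
    have : x1 ^+ 2 / 8 < X.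
      apply: (@lt_le_trans _ _ (1 + x ^+ 2 / 8)); last exact: expR_ge1Dx.
      rewrite /x1 in xl *; nra.
    by rewrite /x1 => h'; nra.
  have uU : u0 <= U.
    rewrite /u0 /U /lyapU ler_expR -/s !mulNr lerN2 ler_pM2r//.
    have -> : (s - m) ^+ 2 = (m - s) ^+ 2 by ring.
    rewrite ler_sqr ?nnegrE; [lra| |].
      by have := beta0; rewrite /m; lra.
    by have := beta0; have := B0; rewrite /m /x1; lra.
  have : k * u0 <= k * U by rewrite ler_pM2l.
  lra.
have V2l : V2 k z <= (1 + k) * X by exact: V2_leX (ltW k0).
have V2g : 1 <= V2 k z by apply: (le_trans X1); exact: V2_geX (ltW k0).
have V2E : V2 k z = X + k * (1 - U) by [].
set V := V2 k z in V2l V2g V2E *.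
have eV : 2 * eta * V <= X / 2.
  have : 2 * eta * V <= 2 * eta * ((1 + k) * X) by rewrite ler_pM2l// mulr_gt0.
  have -> : 2 * eta * ((1 + k) * X) = (4 * eta * (1 + k)) * X / 2 by field.
  by rewrite ek mul1r.
have hM : h * MM <= eta by rewrite -ler_pdivlMr.
have t1 : h * (h * MM) <= h * (eta * V).
  by rewrite ler_pM2l// (le_trans hM)// ler_peMr// ltW.
have t2 : h * (C0 - X - k * (A * U)) <= h * (- (2 * eta * V)).
  by rewrite ler_pM2l//; lra.
have t3 : k * U * M' * h ^+ 2 <= k * M' * h ^+ 2.
  by rewrite ler_pM2r ?exprn_gt0// ler_pM2r// ler_piMr// ltW.
move: t1 t2 t3; rewrite /c /d -/X -/U V2E /MM expr2; lra.
Qed.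

End phases.

(** * From the chain to the solution *)

Section double_limit.
Context {R : realType} {d : measure_display} {T : measurableType d}.
Variable P : probability T R.

(** Iterated Fatou: the box size is the outer limit and the mesh the inner one, because the
    admissible mesh depends on the box while [c] does not. *)
Lemma measure_eventually2_le (E : set T) (F : nat -> nat -> set T) (c : \bar R) (K1 : nat) :
  measurable E -> (forall K n, measurable (F K n)) ->
  (forall w, E w -> exists K0, forall K, (K0 <= K)%N ->
     exists n, forall k, (n <= k)%N -> F K k w) ->
  (forall K, (K1 <= K)%N -> exists n, forall k, (n <= k)%N -> (P (F K k) <= c)%E) ->
  (P E <= c)%E.
Proof.
move=> mE mF EF Fc.
pose G K := \bigcup_n \bigcap_(k in [set k | (n <= k)%N]) F K k.
have mG K : measurable (G K).
  by apply: bigcupT_measurable => n; exact: bigcap_measurableType.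
apply: (measure_eventually_le P E G c K1) => //.
  move=> w /EF[K0 HK]; exists K0 => K /HK[n Hn].
  by exists n => // k /= /Hn.
move=> K /Fc[n Hn].
apply: (measure_eventually_le P (G K) (F K) c n) => //.
by move=> w [m _ Hm]; exists m => k mk; exact: Hm.
Qed.

End double_limit.

Section frozen_chain.
Context {d : measure_display} {T : measurableType d}.
Context {dY : measure_display} {Y : measurableType dY}.
Context {dS : measure_display} {S : measurableType dS}.
Variables (D : nat -> T -> Y) (step : S * Y -> S) (z0 : S) (alive frozen : nat -> S -> bool).
Hypothesis frozen_mono : forall k z, frozen k z -> frozen k.+1 z.

Lemma kchain_stays_frozen k k' w : (k <= k')%N ->
  frozen k (kchain D step z0 alive frozen k w).1 ->
  kchain D step z0 alive frozen k' w = kchain D step z0 alive frozen k w /\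
  frozen k' (kchain D step z0 alive frozen k' w).1.
Proof.
move=> kk' f; rewrite -(subnK kk'); elim: (k' - k)%N => [|i [e fi]]; first by rewrite add0n.
rewrite addSn.
have E : kchain D step z0 alive frozen (i + k).+1 w = kchain D step z0 alive frozen (i + k) w.
  by rewrite {1}/kchain /= -/(kchain D step z0 alive frozen (i + k) w) /kstep /= fi.
by rewrite E; split => //; exact: frozen_mono.
Qed.

Lemma kchain_frozen k k' w : (k <= k')%N ->
  (forall j, (j < k)%N -> alive j (pchain D step z0 j w)) ->
  frozen k (pchain D step z0 k w) ->
  (kchain D step z0 alive frozen k' w).2 /\
  frozen k' (kchain D step z0 alive frozen k' w).1.
Proof.
move=> kk' al f.
have [a b] := kchain_alive D step z0 alive frozen k w (fun j z _ => frozen_mono j z) al.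
have fk : frozen k (kchain D step z0 alive frozen k w).1 by case: b => [->|].
have [e fk'] := kchain_stays_frozen k k' w kk' fk.
by split => //; rewrite e.
Qed.

End frozen_chain.

Section bm_chain.
Context {R : realType} {d : measure_display} {T : measurableType d}.
Variables (P : probability T R) (W : R -> T -> R).
Hypothesis BM : standard_BM P W.
Context {dS : measure_display} {S : measurableType dS}.
Variables (h : R) (n : nat) (step : S * measurableTypeR R -> S) (z0 : S).
Variables (alive frozen : nat -> S -> bool).
Hypothesis h0 : 0 < h.
Hypothesis mstep : measurable_fun setT step.
Hypothesis malive : forall k, measurable_fun setT (alive k).
Hypothesis mfrozen : forall k, measurable_fun setT (frozen k).

Lemma bm_kchain_bound (V : nat -> S -> R) (c : nat -> R) (tg : S -> bool) (m : R) :
  (forall k, measurable_fun setT (V k)) -> (forall k z, 0 <= V k z) ->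
  (forall k, 0 <= c k) -> measurable_fun setT tg -> 0 < m ->
  (forall k z, (k < n)%N -> alive k z -> ~~ frozen k z ->
    \int[normal_prob 0%R (Num.sqrt h)]_u (V k.+1 (step (z, u)))%:E <= (c k * V k z)%:E)%E ->
  (forall k z, (k < n)%N -> frozen k z -> V k.+1 z <= c k * V k z) ->
  (forall z, tg z -> m <= V n z) ->
  (P [set w | (kchain (bm_increment W h) step z0 alive frozen n w).2
       && tg (kchain (bm_increment W h) step z0 alive frozen n w).1]
   <= ((\prod_(k < n) c k) * V 0 z0 / m)%:E)%E.
Proof.
move=> mV V0 c0 mtg m0 HV Hf Htg.
have [] // := kchain_bound P n (bm_increment W h) (normal_prob 0%R (Num.sqrt h))
  (fun k => measurable_bm_increment P W BM h k h0)
  (fun A => bm_increment_indep P W BM h n A h0)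
  (fun k A _ => bm_increment_law P W BM h k A h0) step z0 alive frozen mstep malive mfrozen
  V c tg m.
Qed.

Lemma measurable_bm_kchain (tg : S -> bool) : measurable_fun setT tg ->
  measurable [set w | (kchain (bm_increment W h) step z0 alive frozen n w).2
       && tg (kchain (bm_increment W h) step z0 alive frozen n w).1].
Proof.
move=> mtg.
have mk : measurable_fun setT (kchain (bm_increment W h) step z0 alive frozen n).
  apply: measurable_chain => k; last exact: measurable_kstep.
  exact: (measurable_bm_increment P W BM).
have mb : measurable_fun setT (fun w => (kchain (bm_increment W h) step z0 alive frozen n w).2
    && tg (kchain (bm_increment W h) step z0 alive frozen n w).1).
  apply: measurable_and.
    exact: (measurableT_comp measurable_snd mk).
  exact: (measurableT_comp mtg (measurableT_comp measurable_fst mk)).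
have := mb measurableT [set true] I; rewrite setTI.
by congr measurable; apply/seteqP; split => w /=.
Qed.

End bm_chain.

(** The noise and [beta] cancel in the sum of the coordinates, and the reflection can only increase
    it: this is the discrete form of [Q2] decaying at most at unit rate. *)
Lemma estep_q {R : realType} (beta h : R) z u :
  (1 - h) * (z.1 + z.2) <= (estep beta h z u).1 + (estep beta h z u).2.
Proof.
rewrite /=; set v := (X in Num.max 0 X).
have : v <= Num.max 0 v by rewrite le_max lexx orbT.
rewrite {1}/v; lra.
Qed.

Lemma euler_q_ge {R : realType} (beta h y0 : R) dW k : 0 <= h -> h <= 1 -> 0 <= y0 ->
  y0 * (1 - k%:R * h) <= (euler beta h y0 dW k).1 + (euler beta h y0 dW k).2 /\
  0 <= (euler beta h y0 dW k).1 + (euler beta h y0 dW k).2.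
Proof.
move=> h0 h1 y00; elim: k => [|k [ih1 ih2]].
  by rewrite /= mul0r subr0 mulr1 add0r.
have E := estep_q beta h (euler beta h y0 dW k) (dW k).
rewrite [euler _ _ _ _ k.+1]/(estep beta h (euler beta h y0 dW k) (dW k)).
set q := (euler beta h y0 dW k).1 + (euler beta h y0 dW k).2 in ih1 ih2 E.
have q0 : 0 <= (1 - h) * q by rewrite mulr_ge0// subr_ge0.
split; last exact: le_trans E.
apply: le_trans E.
apply: (@le_trans _ _ ((1 - h) * (y0 * (1 - k%:R * h)))); last by rewrite ler_wpM2l// subr_ge0.
have : 0 <= y0 * (k%:R * h * h) by rewrite !mulr_ge0.
rewrite -natr1; move: (k%:R : R) => kr; lra.
Qed.

Section path_approximation.
Context {R : realType} {d : measure_display} {T : measurableType d}.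
Variables (P : probability T R) (W Q1 Q2 L : R -> T -> R) (beta y0 : R).
Hypothesis BM : standard_BM P W.
Hypothesis sol : forall w, reflected_solution beta 0 y0 (W^~ w) (Q1^~ w) (Q2^~ w) (L^~ w).

Definition sde_step (h : R) (zu : (R * R) * measurableTypeR R) : R * R :=
  estep beta h zu.1 zu.2.

Definition pz n k w := pchain (bm_increment W (mesh n)) (sde_step (mesh n)) (0, y0) k w.

Lemma pz_near w (t e : R) : 0 < e -> exists n0, forall n, (n0 <= n)%N ->
  forall k, k%:R * mesh n <= t ->
  `|(pz n k w).1 + Q1 (k%:R * mesh n) w| <= e /\
  `|((pz n k w).1 + (pz n k w).2) - Q2 (k%:R * mesh n) w| <= e.
Proof.
move=> e0; have e2 : 0 < e / 2 by rewrite divr_gt0.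
case: BM => W0 Wc _ _ _.
have [h0 h00 H] := euler_convergence beta y0 (W^~ w) (Q1^~ w) (Q2^~ w) (L^~ w) (W0 w) (Wc w) (sol w) t _ e2.
have [n0 Hn0] := mesh_small _ h00.
exists n0 => n /Hn0 hn k kt.
have := H (mesh n) (mesh_gt0 n) hn k kt; rewrite /pz pchain_euler /=.
by rewrite !ler_norml => -[/andP[? ?] /andP[? ?]]; split; apply/andP; split; lra.
Qed.

Lemma pz_ge0 n k w : 0 <= y0 -> 0 <= (pz n k w).1 /\ 0 <= (pz n k w).1 + (pz n k w).2.
Proof.
move=> y00; rewrite /pz pchain_euler; split; first exact: euler_ge0.
apply: (euler_q_ge _ _ _ _ _ _ _ _).2 => //; first exact: ltW (mesh_gt0 n).
by rewrite /mesh invf_le1// ler1n.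
Qed.

Lemma solution_cts : cts_process Q1 /\ cts_process Q2.
Proof.
case: (BM) => W0 Wc _ _ _.
split; split => [t t0|w].
- by have [] := measurable_solution P W Q1 Q2 L beta y0 BM sol t t0.
- by case: (sol w) => -[/continuous_clamp].
- by have [] := measurable_solution P W Q1 Q2 L beta y0 BM sol t t0.
- by case: (sol w) => -[_ /continuous_clamp].
Qed.

Lemma solution_init w : Q1 0 w = 0 /\ Q2 0 w = y0.
Proof.
case: BM => W0 _ _ _ _.
have [h1 h2] := solution_0 beta y0 _ _ _ _ (W0 w) (sol w).
have q1 : Q1 0 w = 0 by apply/eqP; rewrite -oppr_eq0 h1.
by split => //; move: h2; rewrite q1 add0r.
Qed.

End path_approximation.

(** * Exponential bounds for a schedule of three phases *)

Section three_phases.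
Context {R : realType}.
Variables (beta B : R).
Hypothesis beta0 : 0 < beta.
Hypothesis B_large : 4 * (beta + beta^-1) <= B.

(* Strong Markov at the crossing times is avoided by restricting [Q2] on deterministic time
   intervals: [B <= Q2] before step [a1], no restriction up to [a2], [Q2 <= 2 * B] afterwards. *)
Definition sched_alive (K : R) (a1 a2 k : nat) (z : R * R) : bool :=
  in_box K z && (if (k < a1)%N then B <= z.1 + z.2
                 else if (k < a2)%N then true else z.1 + z.2 <= 2 * B).

(** Two uses share one schedule: with [fz] the chain stops where [X] reaches [lev], for the Gaussian
    tail; without it, mere survival is measured, for the finiteness of [Xi0]. *)
Definition sched_frozen (fz : bool) (lev : R) (a1 k : nat) (z : R * R) : bool :=
  [&& fz, (a1 <= k)%N & lev <= z.1].

Let mz1 : measurable_fun setT (fun z : R * R => z.1). Proof. exact: measurable_fst. Qed.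
Let mzq : measurable_fun setT (fun z : R * R => z.1 + z.2).
Proof. by apply: measurable_funD; [exact: measurable_fst|exact: measurable_snd]. Qed.

Lemma measurable_in_box (K : R) : measurable_fun setT (in_box K).
Proof.
by do 3 (apply: measurable_and; last exact: measurable_fun_ler);
  exact: measurable_fun_ler.
Qed.

Lemma measurable_sched_alive K a1 a2 k : measurable_fun setT (sched_alive K a1 a2 k).
Proof.
apply: measurable_and; first exact: measurable_in_box.
by case: (k < a1)%N; [|case: (k < a2)%N => //]; exact: measurable_fun_ler.
Qed.

Lemma measurable_sched_frozen fz lev a1 k : measurable_fun setT (sched_frozen fz lev a1 k).
Proof.
apply: measurable_and => //; apply: measurable_and => //; exact: measurable_fun_ler.
Qed.

Definition sched_event {d : measure_display} {T : measurableType d} (W : R -> T -> R)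
    (K : R) (fz : bool) (lev : R) (j1 j2 j3 n : nat) : set T :=
  [set w | let z := kchain (bm_increment W (mesh n)) (sde_step beta (mesh n)) (0, 2 * B)
       (sched_alive K (j1 * n.+1) (j2 * n.+1)) (sched_frozen fz lev (j1 * n.+1)) (j3 * n.+1) w in
     z.2 && (fz ==> (lev <= z.1.1))].

Let measurable_tg fz lev : measurable_fun setT (fun z : R * R => fz ==> (lev <= z.1)).
Proof. by case: fz => //=; exact: measurable_fun_ler. Qed.

Lemma measurable_sched_event {d : measure_display} {T : measurableType d} (P : probability T R)
    (W : R -> T -> R) K fz lev j1 j2 j3 n : standard_BM P W ->
  measurable (sched_event W K fz lev j1 j2 j3 n).
Proof.
move=> BM.
apply: (measurable_bm_kchain P W BM (mesh n) (j3 * n.+1) (sde_step beta (mesh n)) (0, 2 * B)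
  (sched_alive K (j1 * n.+1) (j2 * n.+1)) (sched_frozen fz lev (j1 * n.+1)) (mesh_gt0 n)
  _ _ _ (fun z => fz ==> (lev <= z.1))) => //.
- exact: measurable_estep.
- by move=> k; exact: measurable_sched_alive.
- by move=> k; exact: measurable_sched_frozen.
Qed.

Let pow_mesh (c e : R) (j n : nat) : 0 <= c -> c <= 1 + e * mesh n ->
  c ^+ (j * n.+1) <= expR (e * j%:R).
Proof.
move=> c0 ce; have -> : e * j%:R = (e * mesh n) * (j * n.+1)%:R.
  by rewrite natrM mulrACA mulVf ?mulr1.
rewrite expRM_natr lerXn2r ?nnegrE ?expR_ge0// (le_trans ce)//.
exact: expR_ge1Dx.
Qed.

(** [Cst] and [eta] are chosen before the box [K], and only the mesh threshold depends on it, so the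
    bound survives the limit in [K]. *)
Lemma three_phase_bound : exists Cst eta : R, [/\ 0 < Cst, 0 < eta &
  forall K : R, 0 <= K -> exists2 h1 : R, 0 < h1 & forall n, mesh n <= h1 ->
  forall (fz : bool) (lev : R) (j1 j2 j3 : nat), 0 <= lev -> (j1 <= j2)%N -> (j2 <= j3)%N ->
  forall (d : measure_display) (T : measurableType d) (P : probability T R) (W : R -> T -> R),
  standard_BM P W ->
  (P (sched_event W K fz lev j1 j2 j3 n)
   <= (Cst * expR (- eta * j1%:R + C0 beta * (j2 - j1)%:R
                   + (if fz then 0 else - eta) * (j3 - j2)%:R)
       / (if fz then expR (lev ^+ 2 / 8) else 1))%:E)%E].
Proof.
have [k1 [e1 [[k10 e10 e11] H1]]] := phase1 beta B beta0 B_large.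
have [k2 [e2 [[k20 e20 e21] H2]]] := phase2 beta B beta0 B_large.
have C00 := C0_gt0 beta beta0.
pose eta := Num.min e1 e2.
have eta0 : 0 < eta by rewrite lt_min e10.
have etae1 : eta <= e1 by rewrite ge_min lexx.
have etae2 : eta <= e2 by rewrite ge_min lexx orbT.
(* This weight makes [a * V2 <= lyapX]. Together with [lyapX <= V1], the test function decreases at
   each change of phase. *)
pose a := (1 + k2)^-1.
have k21 : 0 < 1 + k2 by rewrite addr_gt0.
have a0 : 0 < a by rewrite invr_gt0.
pose z0 : R * R := (0, 2 * B).
have V1z : 0 < V1 beta k1 z0.
  by apply: (lt_le_trans _ (V1_geX beta k1 z0 (ltW k10))); exact: expR_gt0.
exists (V1 beta k1 z0 / a), eta; split => //; first by rewrite divr_gt0.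
move=> K K0.
have [hN hN0 HN] := phaseN beta beta0 K K0.
have [h1 h10 {}H1] := H1 K K0.
have [h2 h20 {}H2] := H2 K K0.
exists (Num.min hN (Num.min h1 h2)); first by rewrite !lt_min hN0 h10.
move=> n; rewrite !le_min => /and3P[hnN hn1 hn2] fz lev j1 j2 j3 lev0 j12 j23 d T P W BM.
have hp := mesh_gt0 (R := R) n.
set h := mesh n in hnN hn1 hn2 hp.
have hle1 : h <= 1 by rewrite /h /mesh invf_le1// ler1n.
pose a1 := (j1 * n.+1)%N; pose a2 := (j2 * n.+1)%N; pose a3 := (j3 * n.+1)%N.
have a12 : (a1 <= a2)%N by rewrite leq_mul2r j12 orbT.
have a23 : (a2 <= a3)%N by rewrite leq_mul2r j23 orbT.
pose V (k : nat) z := if (k < a1)%N then V1 beta k1 z else if (k < a2)%N then lyapX z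
  else a * V2 beta B k2 z.
pose c (k : nat) := if (k < a1)%N then 1 - eta * h else if (k < a2)%N then 1 + C0 beta * h
  else if fz then 1 else 1 - eta * h.
have X0 z : 0 <= lyapX z :> R by exact: expR_ge0.
have V2X z : a * V2 beta B k2 z <= lyapX z.
  by rewrite mulrC ler_pdivrMr// mulrC; exact: V2_leX (ltW k20).
have V2p z : a * lyapX z <= a * V2 beta B k2 z by rewrite ler_pM2l//; exact: V2_geX (ltW k20).
have V1X z : lyapX z <= V1 beta k1 z by exact: V1_geX (ltW k10).
have V20 z : 0 <= a * V2 beta B k2 z by apply: le_trans (V2p z); rewrite mulr_ge0// ltW.
have V10 z : 0 <= V1 beta k1 z by exact: le_trans (V1X z).
have mV k : measurable_fun setT (V k).
  rewrite /V; case: (k < a1)%N; first exact: measurable_V1.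
  case: (k < a2)%N; first exact: measurable_lyapX.
  by apply: measurable_funM => //; exact: measurable_V2.
have Vge0 k z : 0 <= V k z by rewrite /V; case: ifP => // _; case: ifP.
have eh1 : 0 <= 1 - eta * h.
  rewrite subr_ge0 -[leRHS]mulr1 ler_pM// ?(ltW eta0) ?(ltW hp)//.
  exact: le_trans etae1 e11.
have Ch : 0 <= C0 beta * h by rewrite mulr_ge0// ltW.
have c0 k : 0 <= c k.
  by rewrite /c; case: ifP => // _; case: ifP => _; [lra|case: ifP].
have Vdec k z : V k.+1 z <= V k z.
  rewrite /V; have [k1a|k1a] := ltnP k.+1 a1.
    by rewrite (ltnW k1a).
  have [ka|ka] := ltnP k a1.
    case: ifP => _ //; exact: le_trans (V2X z) (V1X z).
  have [k2a|k2a] := ltnP k.+1 a2; first by rewrite (ltnW k2a).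
  by case: ifP => // _.
have key k z : (k < a3)%N -> sched_alive K a1 a2 k z -> ~~ sched_frozen fz lev a1 k z ->
    (\int[normal_prob 0%R (Num.sqrt h)]_u (V k.+1 (sde_step beta h (z, u)))%:E
      <= (c k * V k z)%:E)%E.
  move=> _ /andP[zK al] nf.
  apply: (@le_trans _ _ (\int[normal_prob 0%R (Num.sqrt h)]_u (V k (estep beta h z u))%:E)%E).
    apply: ge0_le_integral => //.
    - by move=> u _; rewrite lee_fin.
    - exact: measurable_estepr.
    - exact: measurable_estepr.
    - by move=> u _; rewrite lee_fin.
  move: al; rewrite /V /c; case: (k < a1)%N => al.
    apply: (le_trans (H1 h z hp hn1 zK al)); rewrite lee_fin ler_wpM2r//.
    by have := ler_wpM2r (ltW hp) etae1; lra.
  move: al; case: (k < a2)%N => al; first exact: HN.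
  under eq_integral do rewrite EFinM.
  rewrite ge0_integralZl//; last 3 first.
  - by apply: measurable_estepr; exact: measurable_V2.
  - move=> u _; rewrite lee_fin; apply: le_trans (X0 _) _.
    exact: V2_geX (ltW k20).
  - by rewrite lee_fin ltW.
  apply: (@le_trans _ _ (a%:E * ((1 - e2 * h) * V2 beta B k2 z)%:E)%E).
    by rewrite lee_wpmul2l ?lee_fin ?(ltW a0)//; exact: H2.
  rewrite -EFinM lee_fin mulrCA ler_wpM2r//.
  have := ler_wpM2r (ltW hp) etae2.
  have := mulr_ge0 (ltW e20) (ltW hp).
  by case: (fz); lra.
(* A frozen state does not move, so its factor has to be at least 1. Freezing begins at step [a1],
   from which on the factors are [1 + C0 * h] and then 1. *)
have fr k z : (k < a3)%N -> sched_frozen fz lev a1 k z -> V k.+1 z <= c k * V k z.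
  move=> _ /and3P[fzt ak _]; apply: (le_trans (Vdec k z)).
  rewrite ler_peMl// /c ltnNge ak /= fzt.
  by case: ifP => // _; lra.
pose m := a * (if fz then expR (lev ^+ 2 / 8) else 1).
have m0 : 0 < m by rewrite mulr_gt0//; case: (fz) => //; exact: expR_gt0.
have tgm z : fz ==> (lev <= z.1) -> m <= V a3 z.
  move=> tz; rewrite /V ltnNge (leq_trans a12 a23)/= ltnNge a23/=.
  apply: le_trans (V2p z); rewrite /m ler_pM2l//.
  case: (fz) tz => /= lz; last exact: lyapX_ge1.
  by rewrite ler_expR ler_pM2r// ler_sqr ?nnegrE// (le_trans lev0).
have := bm_kchain_bound P W BM h a3 (sde_step beta h) z0 (sched_alive K a1 a2)
  (sched_frozen fz lev a1) hp (measurable_estep beta h)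
  (fun k => measurable_sched_alive K a1 a2 k) (fun k => measurable_sched_frozen fz lev a1 k)
  V c (fun z => fz ==> (lev <= z.1)) m mV Vge0 c0 (measurable_tg fz lev) m0 key fr tgm.
move=> /le_trans; apply; rewrite lee_fin.
have V00 : V 0%N z0 <= V1 beta k1 z0.
  by rewrite /V; case: ifP => // _; case: ifP => _; [exact: V1X|exact: le_trans (V2X z0) (V1X z0)].
set E := expR _.
have prodE : \prod_(k < a3) c k <= E.
  rewrite -(big_mkord xpredT c) (big_cat_nat (leq0n a1) (leq_trans a12 a23))/=.
  rewrite (big_cat_nat a12 a23)/=.
  have -> : \prod_(0 <= k < a1) c k = (1 - eta * h) ^+ a1.
    rewrite (eq_big_nat _ _ (F2 := fun=> 1 - eta * h)) ?prodr_const_nat ?subn0//.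
    by move=> k /andP[_ ka]; rewrite /c ka.
  have -> : \prod_(a1 <= k < a2) c k = (1 + C0 beta * h) ^+ (a2 - a1).
    rewrite (eq_big_nat _ _ (F2 := fun=> 1 + C0 beta * h)) ?prodr_const_nat//.
    by move=> k /andP[ka1 ka2]; rewrite /c ltnNge ka1/= ka2.
  have -> : \prod_(a2 <= k < a3) c k = (if fz then 1 else 1 - eta * h) ^+ (a3 - a2).
    rewrite (eq_big_nat _ _ (F2 := fun=> if fz then 1 else 1 - eta * h)) ?prodr_const_nat//.
    by move=> k /andP[ka1 ka2]; rewrite /c ltnNge (leq_trans a12 ka1)/= ltnNge ka1.
  rewrite /a1 /a2 /a3 -!mulnBl /E -addrA expRD expRD.
  have p1 : (1 - eta * h) ^+ (j1 * n.+1) <= expR (- eta * j1%:R).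
    by apply: pow_mesh => //; rewrite mulNr.
  have p2 : (1 + C0 beta * h) ^+ ((j2 - j1) * n.+1) <= expR (C0 beta * (j2 - j1)%:R).
    by apply: pow_mesh => //; lra.
  have p3 : (if fz then 1 else 1 - eta * h) ^+ ((j3 - j2) * n.+1)
      <= expR ((if fz then 0 else - eta) * (j3 - j2)%:R).
    by apply: pow_mesh; case: (fz); rewrite ?mul0r ?addr0 ?mulNr.
  apply: ler_pM => //; first exact: exprn_ge0.
    by apply: mulr_ge0; apply: exprn_ge0; [lra|case: (fz)].
  by apply: ler_pM => //; apply: exprn_ge0; [lra|case: (fz)].
rewrite /m invfM.
have -> : V1 beta k1 z0 / a * E / (if fz then expR (lev ^+ 2 / 8) else 1)
  = E * V1 beta k1 z0 * (a^-1 * (if fz then expR (lev ^+ 2 / 8) else 1)^-1) by ring.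
rewrite ler_wpM2r//.
  apply: mulr_ge0; rewrite invr_ge0; first exact: ltW.
  by case: (fz) => //; exact: expR_ge0.
apply: ler_pM => //.
by apply: prodr_ge0.
Qed.

End three_phases.

Lemma mesh_natr {R : realType} (j n : nat) : (j * n.+1)%:R * mesh n = j%:R :> R.
Proof. by rewrite natrM -mulrA mulfV ?mulr1. Qed.

(** The margin is what survives a uniform approximation: strict constraints on the solution become
    weak ones for the scheme. *)
Lemma clamp_margin {R : realType} (f : R -> R) (a b c : R) : continuous (clamp f) -> 0 <= a ->
  (forall t, a <= t <= b -> f t < c) ->
  exists2 e, 0 < e & forall t, a <= t <= b -> f t <= c - e.
Proof.
move=> cf a0 H; have [ab|ba] := leP a b; last first.
  by exists 1 => // t /andP[h1 h2]; move: (le_lt_trans (le_trans h1 h2) ba); rewrite ltxx.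
have [t tab Ht] := EVT_max ab (continuous_clamp_within _ _ b a0 cf).
rewrite in_itv/= in tab.
exists (c - f t); first by rewrite subr_gt0 H.
move=> u uab; have := Ht u; rewrite in_itv/= => /(_ uab); lra.
Qed.

Section inclusion.
Context {R : realType} {d : measure_display} {T : measurableType d}.
Variables (P : probability T R) (W Q1 Q2 L : R -> T -> R) (beta B : R).
Hypothesis B0 : 0 < B.
Hypothesis BM : standard_BM P W.
Hypothesis sol : forall w, reflected_solution beta 0 (2 * B) (W^~ w) (Q1^~ w) (Q2^~ w) (L^~ w).

Let cQ := solution_cts P W Q1 Q2 L beta (2 * B) BM sol.
Let y00 : 0 <= 2 * B. Proof. by rewrite mulr_ge0// ltW. Qed.

(** The box depends on the path but not on the mesh, as required by the order of the two limits. *)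
Lemma pz_control w (t1 e : R) : 0 < e -> exists K0 : nat, exists n0 : nat,
  forall n, (n0 <= n)%N -> forall k, k%:R * mesh n <= t1 ->
  [/\ `|(pz W beta (2 * B) n k w).1 + Q1 (k%:R * mesh n) w| <= e,
      `|((pz W beta (2 * B) n k w).1 + (pz W beta (2 * B) n k w).2) - Q2 (k%:R * mesh n) w| <= e &
      forall K, (K0 <= K)%N -> in_box K%:R (pz W beta (2 * B) n k w)].
Proof.
move=> e0; have [[_ c1] [_ c2]] := cQ.
have [M1 M10 H1] := segment_bounded _ 0 t1 (c1 w).
have [M2 M20 H2] := segment_bounded _ 0 t1 (c2 w).
pose M := M1 + M2 + e.
have M0 : 0 <= M by rewrite !addr_ge0// ltW.
have [n0 Hn0] := pz_near P W Q1 Q2 L beta (2 * B) BM sol w t1 e e0.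
exists (Num.truncn M).+1, n0 => n nn0 k kt; have [h1 h2] := Hn0 n nn0 k kt.
split => // K MK.
have KM : M <= K%:R.
  by apply: (@le_trans _ _ (Num.truncn M).+1%:R); [apply/ltW; rewrite truncnS_gt|rewrite ler_nat].
have [x0 q0] := pz_ge0 W beta (2 * B) n k w y00.
have t0 : 0 <= k%:R * mesh n :> R by rewrite mulr_ge0// ltW// mesh_gt0.
have kt' : 0 <= (k%:R * mesh n : R) <= t1 by apply/andP; split.
have := H1 _ kt'; have := H2 _ kt'; rewrite !clampE//.
move: h1 h2; rewrite !ler_norml => /andP[? ?] /andP[? ?] /andP[? ?] /andP[? ?].
rewrite /in_box x0 q0 andbT /=; apply/andP; split; rewrite /M in KM; lra.
Qed.

(** The last phase is empty when [t1 <= j2], hence the guarded hypothesis. With [fz], the chain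
    freezes at the grid point before [t1] at the latest and idles until the integer time [j3]. *)
Lemma sched_inclusion w (fz : bool) (lev : R) (j1 j2 : nat) (t1 : R) :
  (j1 <= j2)%N -> j1%:R <= t1 ->
  (forall t, 0 <= t <= j1%:R -> B < Q2 t w) ->
  (j2%:R < t1 -> forall t, j2%:R <= t <= t1 -> Q2 t w < 2 * B) ->
  (fz -> lev < - Q1 t1 w) ->
  exists K0 : nat, forall K, (K0 <= K)%N -> forall j3, (j2 <= j3)%N ->
    (if fz then t1 <= j3%:R else t1 == j3%:R) ->
    exists n0, forall n, (n0 <= n)%N -> sched_event beta B W K%:R fz lev j1 j2 j3 n w.
Proof.
move=> j12 jt1 HB H2B Hlev.
have t10 : 0 <= t1 by exact: le_trans jt1.
have [[_ c1] [_ c2]] := cQ.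
have [e1 e10 E1] : exists2 e, 0 < e & forall t, 0 <= t <= j1%:R -> - Q2 t w <= - B - e.
  apply: (clamp_margin (fun t => - Q2 t w)) => //.
  - by move=> t; exact: continuousN (c2 w t).
  - by move=> t /HB; rewrite ltrN2.
have [e2 e20 E2] : exists2 e, 0 < e &
    (j2%:R < t1 -> forall t, j2%:R <= t <= t1 -> Q2 t w <= 2 * B - e).
  have [jt|tj] := boolP (j2%:R < t1); last by exists 1.
  by have [e e0 E] := clamp_margin _ _ _ _ (c2 w) (ler0n _ _) (H2B jt); exists e.
pose e3 := if fz then - Q1 t1 w - lev else 1.
have e30 : 0 < e3 by rewrite /e3; case: (fz) Hlev => // H; rewrite subr_gt0 H.
have e32 : 0 < e3 / 2 by rewrite divr_gt0.
have [dl dl0 Hd] := clamp_near _ t1 _ (c1 w) t10 e32.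
pose e := Num.min (Num.min e1 e2) (e3 / 2).
have e0 : 0 < e by rewrite !lt_min e10 e20.
have ee1 : e <= e1 by rewrite !ge_min lexx.
have ee2 : e <= e2 by rewrite !ge_min lexx orbT.
have ee3 : e <= e3 / 2 by rewrite !ge_min lexx !orbT.
have [K0 [n1 Hn1]] := pz_control w t1 e e0.
have dl2 : 0 < dl / 2 by rewrite divr_gt0.
have [n2 Hn2] := mesh_small _ dl2.
exists K0 => K KK0 j3 j23 jt3; exists (maxn n1 n2) => n; rewrite geq_max => /andP[nn1 nn2].
have hp := mesh_gt0 (R := R) n.
have hdl := Hn2 n nn2.
have al k : k%:R * mesh n < t1 ->
    sched_alive B K%:R (j1 * n.+1) (j2 * n.+1) k (pz W beta (2 * B) n k w).
  move=> kt; have [h1 h2 h3] := Hn1 n nn1 k (ltW kt).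
  rewrite /sched_alive (h3 K KK0)/=.
  have k0 : 0 <= k%:R * mesh n :> R by rewrite mulr_ge0// ltW.
  case: ltnP => kj1.
    have tk : 0 <= (k%:R * mesh n : R) <= j1%:R.
      by apply/andP; split => //; rewrite -(mesh_natr j1 n) ler_pM2r// ler_nat ltnW.
    have := E1 _ tk; move: h2; rewrite ler_norml => /andP[? ?] ?; lra.
  case: ltnP => kj2 //.
  have jk : j2%:R <= k%:R * mesh n :> R by rewrite -(mesh_natr j2 n) ler_pM2r// ler_nat.
  have tk : j2%:R <= (k%:R * mesh n : R) <= t1 by apply/andP; split => //; exact: ltW.
  have := E2 (le_lt_trans jk kt) _ tk; move: h2; rewrite ler_norml => /andP[? ?] ?; lra.
have fmono k z : sched_frozen fz lev (j1 * n.+1) k z -> sched_frozen fz lev (j1 * n.+1) k.+1 z.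
  by move=> /and3P[f1 f2 f3]; apply/and3P; split => //; exact: leqW.
rewrite /sched_event /=.
have [fE|fE] : fz = true \/ fz = false by case: (fz); [left|right].
  2:{ subst fz; move/eqP in jt3; rewrite andbT.
  have [] // := kchain_alive (bm_increment W (mesh n)) (sde_step beta (mesh n)) (0, 2 * B)
    (sched_alive B K%:R (j1 * n.+1) (j2 * n.+1)) (sched_frozen false lev (j1 * n.+1)) (j3 * n.+1) w.
  by move=> j jj; apply: al; rewrite jt3 -(mesh_natr j3 n) ltr_pM2r// ltr_nat. }
subst fz; rewrite /=.
pose k0 := Num.truncn (t1 / mesh n).
have /andP[k1' k2'] := truncn_grid t1 (mesh n) t10 hp; rewrite -/k0 in k1' k2'.
have kj1 : (j1 * n.+1 <= k0)%N.
  rewrite -ltnS -(ltr_nat R) -(ltr_pM2r hp) mesh_natr -natr1 mulrDl mul1r.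
  exact: le_lt_trans k2'.
have kj3 : (k0 <= j3 * n.+1)%N.
  by rewrite -(ler_nat R) -(ler_pM2r hp) mesh_natr (le_trans k1').
have kk0 : 0 <= k0%:R * mesh n :> R by rewrite mulr_ge0// ltW.
have alj j : (j < k0)%N -> sched_alive B K%:R (j1 * n.+1) (j2 * n.+1) j (pz W beta (2 * B) n j w).
  by move=> jk; apply: al; apply: lt_le_trans k1'; rewrite ltr_pM2r// ltr_nat.
have frk : sched_frozen true lev (j1 * n.+1) k0 (pz W beta (2 * B) n k0 w).
  apply/and3P; split => //.
  have [h1 _ _] := Hn1 n nn1 k0 k1'.
  have dk : `|k0%:R * mesh n - t1| < dl.
    rewrite distrC ger0_norm ?subr_ge0//; lra.
  have := Hd _ kk0 dk; rewrite ltr_norml; move: h1; rewrite ler_norml.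
  rewrite /e3 in ee3 * => /andP[? ?] /andP[? ?]; lra.
have [a b] := kchain_frozen (bm_increment W (mesh n)) (sde_step beta (mesh n)) (0, 2 * B)
    (sched_alive B K%:R (j1 * n.+1) (j2 * n.+1)) (sched_frozen true lev (j1 * n.+1)) fmono
    k0 (j3 * n.+1) w kj3 alj frk.
by rewrite a /=; have /and3P[_ _] := b.
Qed.

End inclusion.

(** * Almost sure finiteness of [Xi0] *)

Section recurrence.
Context {R : realType} (beta B : R).
Hypothesis beta0 : 0 < beta.
Hypothesis B_large : 4 * (beta + beta^-1) <= B.

Let B0 : 0 < B.
Proof. by apply: lt_le_trans B_large; rewrite mulr_gt0// addr_gt0// invr_gt0. Qed.

Lemma expR_natN_small (eta c e : R) : 0 < eta -> 0 <= c -> 0 < e ->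
  exists J0 : nat, forall J, (J0 <= J)%N -> c * expR (- eta * J%:R) <= e.
Proof.
move=> eta0 c0 e0.
exists (Num.truncn (c / (eta * e))).+1 => J hJ.
have JM : c / (eta * e) <= J%:R.
  apply: (@le_trans _ _ (Num.truncn (c / (eta * e))).+1%:R); last by rewrite ler_nat.
  by apply/ltW; rewrite truncnS_gt.
have : c <= J%:R * (eta * e) by rewrite -ler_pdivrMr// mulr_gt0.
move=> cJ; rewrite mulNr expRN ler_pdivrMr ?expR_gt0//.
have : e * (1 + eta * J%:R) <= e * expR (eta * J%:R) by rewrite ler_pM2l//; exact: expR_ge1Dx.
by move: (J%:R : R) cJ => Jr; nra.
Qed.

Section solution_process.
Context {d : measure_display} {T : measurableType d}.
Variables (P : probability T R) (W Q1 Q2 L : R -> T -> R).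
Hypothesis BM : standard_BM P W.
Hypothesis sol : forall w, reflected_solution beta 0 (2 * B) (W^~ w) (Q1^~ w) (Q2^~ w) (L^~ w).

Let cQ := solution_cts P W Q1 Q2 L beta (2 * B) BM sol.
Let init w := solution_init P W Q1 Q2 L beta (2 * B) BM sol w.

Let above (J : nat) : set T := [set w | forall t : R, 0 <= t <= J%:R -> - Q2 t w < - B].
Let below (j J : nat) : set T := [set w | forall t : R, j%:R <= t <= J%:R -> Q2 t w < 2 * B].

Let m_above J : measurable (above J).
Proof. by apply: measurable_forall_lt => //; apply: cts_processN; exact: cQ.2. Qed.

Let m_below j J : (j <= J)%N -> measurable (below j J).
Proof. by move=> jJ; apply: measurable_forall_lt; rewrite ?ler_nat//; exact: cQ.2. Qed.

Let no_cycle : set T := [set w | forall p : nat, ~ cycle_done B (Q2^~ w) p%:R].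

Lemma measurable_no_cycle : measurable no_cycle.
Proof.
rewrite (_ : no_cycle = \bigcap_p ~` [set w | cycle_done B (Q2^~ w) p%:R]).
  apply: bigcapT_measurable => p; apply: measurableC.
  by apply: measurable_cycle_done => [||w]; [exact: cQ.2|exact: B0|exact: (init w).2].
by apply/seteqP; split => w H p; [move=> _|]; exact: H.
Qed.

(** If the cycle never ends, either [Q2] stays above [B] forever, or it stays below [2 * B] from the
    first integer after a visit to [B]. Each case has exponentially small probability over a long
    time, by the first and the third phase respectively. *)
Lemma Xi0_infinite_null : P no_cycle = 0%E.
Proof.
have [Cst [eta [Cst0 eta0 HB]]] := three_phase_bound beta B beta0 B_large.
have Pabove J : (P (above J) <= (Cst * expR (- eta * J%:R))%:E)%E.
  apply: (measure_eventually2_le P (above J) (fun K n => sched_event beta B W K%:R false 0 J J J n) _ 0) => //.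
  - by move=> K n; exact: (measurable_sched_event beta B P).
  - move=> w aw.
    have [] // := sched_inclusion P W Q1 Q2 L beta B B0 BM sol w false 0 J J J%:R.
    + by move=> t tJ; have := aw t tJ; rewrite ltrN2.
    + by rewrite ltxx.
    move=> K0 HK0; exists K0 => K /HK0 /(_ J (leqnn J)); exact.
  - move=> K _; have [h1 h10 Hn] := HB K%:R (ler0n _ _).
    have [n0 Hn0] := mesh_small _ h10.
    exists n0 => n /Hn0 /Hn /(_ false 0 J J J (lexx 0) (leqnn J) (leqnn J) d T P W BM).
    by rewrite subnn !mulr0 !addr0 divr1.
have Pbelow j J : (j <= J)%N ->
    (P (below j J) <= (Cst * expR (C0 beta * j%:R - eta * (J - j)%:R))%:E)%E.
  move=> jJ.
  apply: (measure_eventually2_le P (below j J) (fun K n => sched_event beta B W K%:R false 0 0 j J n) _ 0) => //.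
  - exact: m_below.
  - by move=> K n; exact: (measurable_sched_event beta B P).
  - move=> w bw.
    have [] // := sched_inclusion P W Q1 Q2 L beta B B0 BM sol w false 0 0 j J%:R.
    + move=> t /andP[t0 t0']; have -> : t = 0 by apply/le_anti/andP; split.
      by rewrite (init w).2; have := B0; lra.
    move=> K0 HK0; exists K0 => K /HK0 /(_ J jJ); exact.
  - move=> K _; have [h1 h10 Hn] := HB K%:R (ler0n _ _).
    have [n0 Hn0] := mesh_small _ h10.
    exists n0 => n /Hn0 /Hn /(_ false 0 0%N j J (lexx 0) (leq0n j) jJ d T P W BM).
    by rewrite subn0 mulr0 add0r divr1 mulNr.
have null0 (A : set T) : measurable A -> (forall e, 0 < e -> (P A <= e%:E)%E) -> P A = 0%E.
  move=> mA H; apply/le_anti/andP; split; last exact: measure_ge0.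
  apply/lee_addgt0Pr => e e0; rewrite add0e; exact: H.
pose A1 := \bigcap_J above J.
have mA1 : measurable A1 by exact: bigcapT_measurable.
have PA1 : P A1 = 0%E.
  apply: null0 => // e e0.
  have [J HJ] := expR_natN_small _ _ _ eta0 (ltW Cst0) e0.
  apply: (@le_trans _ _ (P (above J))).
    by apply: le_measure; rewrite ?inE// => w; exact.
  by apply: (le_trans (Pabove J)); rewrite lee_fin HJ.
pose A2 j := \bigcap_(J in [set J | (j <= J)%N]) below j J.
have mA2 j : measurable (A2 j).
  by apply: bigcap_measurableType => J jJ; exact: m_below.
have PA2 j : P (A2 j) = 0%E.
  apply: null0 => // e e0.
  have cc : 0 <= Cst * expR (C0 beta * j%:R) by rewrite mulr_ge0 ?expR_ge0// ltW.
  have [J HJ] := expR_natN_small _ _ _ eta0 cc e0.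
  apply: (@le_trans _ _ (P (below j (j + J)))).
    apply: le_measure; rewrite ?inE//; first by apply: m_below; exact: leq_addr.
    by move=> w; apply => /=; exact: leq_addr.
  apply: (le_trans (Pbelow _ _ (leq_addr _ _))); rewrite lee_fin addKn expRD mulrA.
  by rewrite -mulNr; exact: HJ.
have mU : measurable (A1 `|` \bigcup_j A2 j).
  by apply: measurableU => //; exact: bigcupT_measurable.
apply/le_anti/andP; split; last exact: measure_ge0.
apply: (@le_trans _ _ (P (A1 `|` \bigcup_j A2 j))).
  apply: le_measure; rewrite ?inE//; first exact: measurable_no_cycle.
  move=> w nc.
  have [[s [s0 qs]]|ns] := pselect (exists s, 0 <= s /\ Q2 s w = B).
    right; exists (Num.truncn s).+1 => // J /= jJ t /andP[jt tJ].
    have st : s < t by apply: lt_le_trans jt; rewrite truncnS_gt.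
    rewrite ltNge; apply/negP => qt.
    have [|t' ] := @IVT _ (Q2^~ w) s t (2 * B) (ltW st) (continuous_clamp_within _ _ _ s0 (cQ.2.2 w)).
      rewrite qs; apply/andP; split; first by rewrite ge_min; apply/orP; left; have := B0; lra.
      by rewrite le_max qt orbT.
    rewrite in_itv/= => /andP[st' t't] qt'.
    apply: (nc J); exists s, t'; split => //; last exact: le_trans tJ.
    rewrite lt_neqAle st' andbT; apply/eqP => E; move: qs; rewrite E qt'; have := B0; lra.
  left => J _ t /andP[t0 tJ]; rewrite ltrN2 ltNge; apply/negP => qt.
  have [|t' ] := @IVT _ (Q2^~ w) 0 t B t0 (continuous_clamp_within _ _ _ (lexx 0) (cQ.2.2 w)).
    rewrite (init w).2; apply/andP; split; first by rewrite ge_min qt orbT.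
    by rewrite le_max; apply/orP; left; have := B0; lra.
  by rewrite in_itv/= => /andP[t'0 _] qt'; apply: ns; exists t'.
have mU2 : measurable (\bigcup_j A2 j) by exact: bigcupT_measurable.
have PU2 : P (\bigcup_j A2 j) = 0%E.
  apply/le_anti/andP; split; last exact: measure_ge0.
  apply: (le_trans (measure_sigma_subadditive P mA2 mU2 (@subset_refl _ _))).
  by rewrite eseries0// => j _ _; exact: PA2.
by rewrite (etrans (measureU0 mA1 mU2 PU2) PA1).
Qed.

End solution_process.
End recurrence.

(** * Upper tails *)

Section tail_Q1.
Context {R : realType} (beta B : R).
Hypothesis beta0 : 0 < beta.
Hypothesis B_large : 4 * (beta + beta^-1) <= B.

Let B0 : 0 < B.
Proof. by apply: lt_le_trans B_large; rewrite mulr_gt0// addr_gt0// invr_gt0. Qed.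

Let nat_below (al : R) : 0 < al -> exists j : nat, j%:R < al /\ al <= j.+1%:R.
Proof.
move=> al0; have /andP[h1 h2] := truncn_itv (ltW al0).
have [lt|] := boolP ((Num.truncn al)%:R < al).
  by exists (Num.truncn al); split => //; exact: ltW.
rewrite -leNgt => ge; case E : (Num.truncn al) ge h1 h2 => [|m] ge h1 h2.
  by move: (lt_le_trans al0 ge); rewrite ltxx.
exists m; split => //; apply: lt_le_trans h1; by rewrite ltr_nat.
Qed.

(** With [j] the last integer before the first visit to [B], the chain spends [j] units in the first
    phase, one unit unrestricted and the rest in the third. The costs [expR (- eta * j)] form a
    convergent geometric series. *)
Theorem tail_Q1_upper : exists2 Cs : R, 0 < Cs &
  forall (d : measure_display) (T : measurableType d) (P : probability T R)
    (W Q1 Q2 L : R -> T -> R), standard_BM P W ->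
  (forall w, reflected_solution beta 0 (2 * B) (W^~ w) (Q1^~ w) (Q2^~ w) (L^~ w)) ->
  forall x : R, 2 * beta <= x ->
  (P [set w | (tau (Q1^~ w) (- x) <= Xi0 B (Q2^~ w))%E]
    <= (Cs * expR (- ((x - 2 * beta) ^+ 2 / 8)))%:E)%E.
Proof.
have [Cst [eta [Cst0 eta0 HB]]] := three_phase_bound beta B beta0 B_large.
pose r := expR (- eta).
have r0 : 0 < r by exact: expR_gt0.
have r1 : r < 1 by rewrite -expR0 ltr_expR oppr_lt0.
have r10 : 0 < 1 - r by rewrite subr_gt0.
pose C1 := Cst * expR (C0 beta).
have C10 : 0 < C1 by rewrite mulr_gt0// expR_gt0.
exists (C1 / (1 - r)); first by rewrite divr_gt0.
move=> d T P W Q1 Q2 L BM sol x xb.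
pose lev := x - 2 * beta.
have lev0 : 0 <= lev by rewrite subr_ge0.
pose g := expR (- (lev ^+ 2 / 8)).
have g0 : 0 < g by exact: expR_gt0.
have [cQ1 cQ2] := solution_cts P W Q1 Q2 L beta (2 * B) BM sol.
have init := solution_init P W Q1 Q2 L beta (2 * B) BM sol.
(* The horizon grows with the box, so that it eventually exceeds the hitting time of each path. *)
pose F j K n := sched_event beta B W K%:R true lev j j.+1 (K + j.+1) n.
have mF j K n : measurable (F j K n) by exact: (measurable_sched_event beta B P).
pose G j := [set w | exists K0, forall K, (K0 <= K)%N ->
     exists n, forall k, (n <= k)%N -> F j K k w].
have mG j : measurable (G j).
  rewrite (_ : G j = \bigcup_K0 \bigcap_(K in [set K | (K0 <= K)%N])
     \bigcup_n \bigcap_(k in [set k | (n <= k)%N]) F j K k).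
    apply: bigcupT_measurable => K0; apply: bigcap_measurableType => K _.
    by apply: bigcupT_measurable => n; exact: bigcap_measurableType.
  apply/seteqP; split => w.
    by move=> [K0 H]; exists K0 => // K /= /H[n Hn]; exists n => // k /= /Hn.
  by move=> [K0 _ H]; exists K0 => K /H[n _ Hn]; exists n => k /Hn.
have PG j : (P (G j) <= (C1 * g * r ^+ j)%:E)%E.
  apply: (measure_eventually2_le P (G j) (F j) _ 0) => // K _.
  have [h1 h10 Hn] := HB K%:R (ler0n _ _).
  have [n0 Hn0] := mesh_small _ h10.
  have jK : (j.+1 <= K + j.+1)%N by exact: leq_addl.
  exists n0 => n /Hn0 /Hn /(_ true lev j j.+1 (K + j.+1)%N lev0 (leqnSn j) jK d T P W BM).
  move=> /le_trans; apply; rewrite lee_fin subSnn mulr1 mul0r addr0 -expRN expRD.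
  have -> : expR (- eta * j%:R) = r ^+ j by rewrite expRM_natr.
  by rewrite /C1 -/g; apply/eqr_leW; ring.
have mE : measurable [set w | (tau (Q1^~ w) (- x) <= Xi0 B (Q2^~ w))%E].
  by apply: measurable_tau_le_Xi0 => // w; exact: (init w).2.
pose N := [set w | forall p : nat, ~ cycle_done B (Q2^~ w) p%:R].
have mN : measurable N by exact: (measurable_no_cycle beta B beta0 B_large P W Q1 Q2 L BM sol).
have PN : P N = 0%E by exact: (Xi0_infinite_null beta B beta0 B_large P W Q1 Q2 L BM sol).
have mU : measurable (\bigcup_j G j) by exact: bigcupT_measurable.
have sub : [set w | (tau (Q1^~ w) (- x) <= Xi0 B (Q2^~ w))%E] `<=` (\bigcup_j G j) `|` N.
  move=> w /= tx; have [|nN] := pselect (N w); [by right|left].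
  have [p cd] : exists p : nat, cycle_done B (Q2^~ w) p%:R.
    by apply: contrapT => H; apply: nN => p cp; apply: H; exists p.
  have [al [xi [al0 alxi qal Xxi [Hal Hxi]]]] := cycle_structure _ _ _ B0 (cQ2.2 w) (init w).2 cd.
  have xi0 : 0 <= xi by rewrite (le_trans (ltW al0))// ltW.
  have [t0 /andP[t00 t0xi] Qt0] := tau_le_hit _ _ _ _ (cQ1.2 w) xi0 tx Xxi.
  have b2 : 0 < 2 * beta by rewrite mulr_gt0.
  have t0p : 0 < t0.
    rewrite lt_neqAle t00 andbT; apply/eqP => E; move: Qt0; rewrite -E (init w).1; lra.
  have [e e0 He] := clamp_near _ t0 _ (cQ1.2 w) t00 b2.
  (* A time just before the hit: [X] still exceeds [lev], thanks to the slack [2 * beta], and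
     [t1 < xi] keeps [Q2 < 2 * B] strict up to and including [t1]. *)
  pose t1 := Num.max (t0 / 2) (t0 - e / 2).
  have t1t0 : t1 < t0 by rewrite /t1 gt_max; apply/andP; split; lra.
  have t10 : 0 < t1 by rewrite /t1 lt_max; apply/orP; left; lra.
  have Xt1 : lev < - Q1 t1 w.
    have : `|Q1 t1 w - Q1 t0 w| < 2 * beta.
      apply: He; first exact: ltW.
      rewrite distrC ger0_norm ?subr_ge0 ?(ltW t1t0)//.
      have : t0 - e / 2 <= t1 by rewrite /t1 le_max lexx orbT.
      lra.
    by rewrite Qt0 ltr_norml /lev => /andP[? ?]; lra.
  have t1xi : t1 < xi by exact: lt_le_trans t0xi.
  (* If [t1] precedes [al], [j] is the integer part of [t1] and the third phase is empty. Otherwise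
     [j] is the largest integer strictly below [al]. *)
  have [j [jt1 jal H2]] : exists j : nat, [/\ j%:R <= t1, j%:R < al &
      (j.+1%:R < t1 -> forall t, j.+1%:R <= t <= t1 -> Q2 t w < 2 * B)].
    have [tal|alt] := ltP t1 al.
      have /andP[h1 h2] := truncn_itv (ltW t10).
      exists (Num.truncn t1); split => //; first exact: le_lt_trans tal.
      by move=> h3; move: (lt_trans h2 h3); rewrite ltxx.
    have [j [j1 j2]] := nat_below al al0.
    exists j; split => //; first by rewrite (le_trans (ltW j1)).
    move=> _ t /andP[jt tt]; apply: Hxi; first exact: le_trans jt.
    exact: le_lt_trans t1xi.
  have HB' t : 0 <= t <= j%:R -> B < Q2 t w.
    by move=> /andP[h1 h2]; apply: Hal => //; exact: le_lt_trans jal.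
  have [K0 HK0] := sched_inclusion P W Q1 Q2 L beta B B0 BM sol w true lev j j.+1 t1
    (leqnSn j) jt1 HB' H2 (fun=> Xt1).
  exists j => //; exists (maxn K0 (Num.truncn t1).+1) => K; rewrite geq_max => /andP[KK0 Kt].
  apply: (HK0 K KK0 (K + j.+1)%N (leq_addl _ _)).
  apply: (@le_trans _ _ (Num.truncn t1).+1%:R); first by apply/ltW; rewrite truncnS_gt.
  by rewrite ler_nat (leq_trans Kt)// leq_addr.
apply: (@le_trans _ _ (P ((\bigcup_j G j) `|` N))).
  by apply: le_measure; rewrite ?inE//; exact: measurableU.
rewrite (measureU0 mU mN PN).
apply: (le_trans (measure_sigma_subadditive P mG mU (@subset_refl _ _))).
apply: (@le_trans _ _ (\sum_(0 <= j <oo) (C1 * g * r ^+ j)%:E)%E).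
  by apply: lee_nneseries => // j _; exact: PG.
have geo : (fun n => \sum_(0 <= j < n) (C1 * g * r ^+ j)%:E)%E @ \oo --> (C1 * g / (1 - r))%:E.
  have rn : `|r| < 1 by rewrite ger0_norm// ltW.
  have cv := @cvg_geometric_series _ (C1 * g) r rn.
  rewrite (_ : (fun n => _) = EFin \o series (geometric (C1 * g) r)); last first.
    by apply/funext => n; rewrite /series /= sumEFin.
  by apply: cvg_EFin; [exact: nearW|exact: cv].
rewrite (cvg_lim _ geo)// lee_fin -/lev -/g.
by apply/eqr_leW; ring.
Qed.

End tail_Q1.

Section tail_Q2.
Context {R : realType} (beta B : R).
Hypothesis beta0 : 0 < beta.
Hypothesis B_large : 4 * (beta + beta^-1) <= B.

Let B0 : 0 < B.
Proof. by apply: lt_le_trans B_large; rewrite mulr_gt0// addr_gt0// invr_gt0. Qed.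

Let up_alive (K : R) (k : nat) (z : R * R) : bool := in_box K z && (B <= z.1 + z.2).
(** It also serves as the target set, and the sign of the first coordinate is what [V0_ge] asks
    for. *)
Let up_frozen (y : R) (k : nat) (z : R * R) : bool := (0 <= z.1) && (y <= z.1 + z.2).

Let mzq : measurable_fun setT (fun z : R * R => z.1 + z.2).
Proof. by apply: measurable_funD; [exact: measurable_fst|exact: measurable_snd]. Qed.

Let m_alive K k : measurable_fun setT (up_alive K k).
Proof.
apply: measurable_and; first exact: measurable_in_box.
exact: measurable_fun_ler.
Qed.

Let m_frozen y k : measurable_fun setT (up_frozen y k).
Proof.
apply: measurable_and; apply: measurable_fun_ler => //; exact: measurable_fst.
Qed.

Section process.
Context {d : measure_display} {T : measurableType d}.
Variables (P : probability T R) (W Q1 Q2 L : R -> T -> R).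
Hypothesis BM : standard_BM P W.
Hypothesis sol : forall w, reflected_solution beta 0 (2 * B) (W^~ w) (Q1^~ w) (Q2^~ w) (L^~ w).

Let up_event (y : R) (K n : nat) : set T :=
  [set w | let z := kchain (bm_increment W (mesh n)) (sde_step beta (mesh n)) (0, 2 * B)
       (up_alive K%:R) (up_frozen y) (K * n.+1) w in z.2 && up_frozen y 0 z.1].

Let measurable_up_event y K n : measurable (up_event y K n).
Proof.
apply: (measurable_bm_kchain P W BM (mesh n) (K * n.+1) (sde_step beta (mesh n)) (0, 2 * B)
  (up_alive K%:R) (up_frozen y) (mesh_gt0 n) _ _ _ (up_frozen y 0)) => //.
exact: measurable_estep.
Qed.

Let up_event_bound y K : exists n0, forall n, (n0 <= n)%N ->
  (P (up_event y K n) <= (expR (beta / 4 * (2 * B - y + (beta + beta^-1))))%:E)%E.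
Proof.
have [h1 h10 H] := phaseF beta B beta0 B_large K%:R (ler0n _ _).
have [n0 Hn0] := mesh_small _ h10.
exists n0 => n /Hn0 hn.
have m0 := expR_gt0 (beta / 4 * (y - 2 * (beta + beta^-1) / 2)).
have := bm_kchain_bound P W BM (mesh n) (K * n.+1) (sde_step beta (mesh n)) (0, 2 * B)
  (up_alive K%:R) (up_frozen y) (mesh_gt0 n) (measurable_estep beta (mesh n))
  (m_alive K%:R) (m_frozen y) (fun=> V0 beta) (fun=> 1) (up_frozen y 0) _
  (fun=> measurable_V0 beta) (fun _ z => ltW (V0_gt0 beta z)) (fun=> ler01) (m_frozen y 0) m0 _ _ _.
move=> /(_ _ _ _) /le_trans; apply.
- move=> k z _ /andP[zK qB] _; rewrite mul1r.
  by apply: H => //; exact: mesh_gt0.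
- by move=> k z _ _; rewrite mul1r.
- by move=> z /andP[x0 yq]; exact: V0_ge.
rewrite big1// mul1r lee_fin /V0 /lyapF /= expr0n/= mulr0 mul0r addr0 -expRN -expRD.
by rewrite ler_expR; apply/eqr_leW; field; rewrite gt_eqF.
Qed.

Let up_inclusion y w t0 : 0 <= t0 -> y <= Q2 t0 w ->
  (forall t, 0 <= t <= t0 -> B < Q2 t w) ->
  exists K0 : nat, forall K, (K0 <= K)%N -> exists n0, forall n, (n0 <= n)%N ->
    up_event (y - B) K n w.
Proof.
move=> t00 yt0 HB.
have [[_ c1] [_ c2]] := solution_cts P W Q1 Q2 L beta (2 * B) BM sol.
have [e1 e10 E1] : exists2 e, 0 < e & forall t, 0 <= t <= t0 -> - Q2 t w <= - B - e.
  apply: (clamp_margin (fun t => - Q2 t w)) => //.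
  - by move=> t; exact: continuousN (c2 w t).
  - by move=> t /HB; rewrite ltrN2.
have Bh : 0 < B / 2 by rewrite divr_gt0.
have [dl dl0 Hd] := clamp_near _ t0 _ (c2 w) t00 Bh.
pose e := Num.min e1 (B / 2).
have e0 : 0 < e by rewrite !lt_min e10.
have ee1 : e <= e1 by rewrite !ge_min lexx.
have ee3 : e <= B / 2 by rewrite !ge_min lexx !orbT.
have [K0 [n1 Hn1]] := pz_control P W Q1 Q2 L beta B B0 BM sol w t0 e e0.
have dl2 : 0 < dl / 2 by rewrite divr_gt0.
have [n2 Hn2] := mesh_small _ dl2.
exists (maxn K0 (Num.truncn t0).+1) => K; rewrite geq_max => /andP[KK0 Kt].
exists (maxn n1 n2) => n; rewrite geq_max => /andP[nn1 nn2].
have hp := mesh_gt0 (R := R) n.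
have hdl := Hn2 n nn2.
pose k0 := Num.truncn (t0 / mesh n).
have /andP[k1' k2'] := truncn_grid t0 (mesh n) t00 hp; rewrite -/k0 in k1' k2'.
have tK : t0 <= K%:R.
  apply: (@le_trans _ _ (Num.truncn t0).+1%:R); first by apply/ltW; rewrite truncnS_gt.
  by rewrite ler_nat.
have kj3 : (k0 <= K * n.+1)%N.
  by rewrite -(ler_nat R) -(ler_pM2r hp) mesh_natr (le_trans k1').
have kk0 : 0 <= k0%:R * mesh n :> R by rewrite mulr_ge0// ltW.
have alj j : (j < k0)%N -> up_alive K%:R j (pz W beta (2 * B) n j w).
  move=> jk; have jt : j%:R * mesh n <= t0.
    by apply: le_trans k1'; rewrite ler_pM2r// ler_nat ltnW.
  have [_ h2 h3] := Hn1 n nn1 j jt; rewrite /up_alive (h3 K KK0)/=.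
  have tk : 0 <= (j%:R * mesh n : R) <= t0.
    by apply/andP; split => //; rewrite mulr_ge0// ltW.
  by have := E1 _ tk; move: h2; rewrite ler_norml => /andP[? ?] ?; lra.
have frk : up_frozen (y - B) k0 (pz W beta (2 * B) n k0 w).
  have y00 : 0 <= 2 * B by rewrite mulr_ge0// ltW.
  rewrite /up_frozen (pz_ge0 W beta (2 * B) n k0 w y00).1/=.
  have [_ h1 _] := Hn1 n nn1 k0 k1'.
  have dk : `|k0%:R * mesh n - t0| < dl.
    by rewrite distrC ger0_norm ?subr_ge0//; lra.
  have := Hd _ kk0 dk; rewrite ltr_norml; move: h1; rewrite ler_norml.
  by move=> /andP[? ?] /andP[? ?]; lra.
have [a b] := kchain_frozen (bm_increment W (mesh n)) (sde_step beta (mesh n)) (0, 2 * B)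
    (up_alive K%:R) (up_frozen (y - B)) (fun k z f => f) k0 (K * n.+1) w kj3 alj frk.
by rewrite /up_event /= a /=.
Qed.

(** Optional stopping for [V0], with the target level lowered from [y] to [y - B] so that the scheme
    reaches it; this turns [2 * B] into [3 * B] in the exponent. *)
Theorem tail_Q2_upper (y : R) : 4 * B <= y ->
  (P [set w | (tau (Q2^~ w) y <= Xi0 B (Q2^~ w))%E]
    <= (expR (beta / 4 * (3 * B - y + (beta + beta^-1))))%:E)%E.
Proof.
move=> yB.
have [cQ1 cQ2] := solution_cts P W Q1 Q2 L beta (2 * B) BM sol.
have init := solution_init P W Q1 Q2 L beta (2 * B) BM sol.
have mE : measurable [set w | (tau (Q2^~ w) y <= Xi0 B (Q2^~ w))%E].
  by apply: measurable_tau_le_Xi0 => // w; exact: (init w).2.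
pose N := [set w | forall p : nat, ~ cycle_done B (Q2^~ w) p%:R].
have mN : measurable N by exact: (measurable_no_cycle beta B beta0 B_large P W Q1 Q2 L BM sol).
have PN : P N = 0%E by exact: (Xi0_infinite_null beta B beta0 B_large P W Q1 Q2 L BM sol).
set E := [set w | _] in mE *.
have mEN : measurable (E `\` N) by exact: measurableD.
apply: (@le_trans _ _ (P ((E `\` N) `|` N))).
  apply: le_measure; rewrite ?inE//; first exact: measurableU.
  by move=> w Ew; have [Nw|Nw] := pselect (N w); [right|left].
rewrite (measureU0 mEN mN PN).
apply: (measure_eventually2_le P (E `\` N) (up_event (y - B)) _ 0) => //.
  move=> w [Ew nN].
  have [p cd] : exists p : nat, cycle_done B (Q2^~ w) p%:R.
    by apply: contrapT => H; apply: nN => p cp; apply: H; exists p.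
  have [al [xi [al0 alxi qal Xxi [Hal Hxi]]]] := cycle_structure _ _ _ B0 (cQ2.2 w) (init w).2 cd.
  have xi0 : 0 <= xi by rewrite (le_trans (ltW al0))// ltW.
  have [t0 /andP[t00 t0xi] Qt0] := tau_le_hit _ _ _ _ (cQ2.2 w) xi0 Ew Xxi.
  (* Between [al] and [xi] the process is below [2 * B], and by continuity below [3 * B] at [xi],
     while [y >= 4 * B]. So [y] is reached while [Q2] is still above [B]. *)
  have t0al : t0 < al.
    rewrite ltNge; apply/negP => alt0.
    have [lt|] := ltP t0 xi.
      by have := Hxi t0 alt0 lt; rewrite Qt0; have := B0; lra.
    move=> xit0; have e : t0 = xi by apply/le_anti/andP.
    have h0 := B0.
    have [dl dl0 Hd] := clamp_near _ xi _ (cQ2.2 w) xi0 B0.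
    pose s := Num.max al (xi - dl / 2).
    have sx : s < xi by rewrite gt_max alxi; lra.
    have als : al <= s by rewrite le_max lexx.
    have s0 : 0 <= s by rewrite (le_trans (ltW al0)).
    have : `|Q2 s w - Q2 xi w| < B.
      apply: Hd => //; rewrite distrC ger0_norm ?subr_ge0 ?(ltW sx)//.
      by have : xi - dl / 2 <= s by [rewrite le_max lexx orbT]; lra.
    have := Hxi s als sx; rewrite -e Qt0 ltr_norml; lra.
  apply: (up_inclusion y w t0 t00); first by rewrite Qt0.
  by move=> t /andP[h1 h2]; apply: Hal => //; exact: le_lt_trans t0al.
move=> K _; have [n0 Hn0] := up_event_bound (y - B) K.
exists n0 => n /Hn0 /le_trans; apply; rewrite lee_fin ler_expR.
by apply/eqr_leW; ring.
Qed.

End process.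
End tail_Q2.

(** * Lower tails *)

Section lower_Q2.
Context {R : realType} (beta B : R).
Hypothesis beta0 : 0 < beta.
Hypothesis B0 : 0 < B.

(* [Q2] dominates the Brownian motion with drift [2 * B + sqrt 2 * W t - beta * t], whose
   scale function is [expR (beta * z)]. *)
Definition drift_step (h : R) (zu : R * measurableTypeR R) : R :=
  zu.1 + Num.sqrt 2 * (zu.2 : R) - beta * h.

Lemma measurable_drift_step h : measurable_fun setT (drift_step h).
Proof.
have m2 : measurable_fun setT (fun zu : R * measurableTypeR R => zu.2 : R).
  exact: measurable_snd.
apply: measurable_funB => //; apply: measurable_funD; first exact: measurable_fst.
by apply: measurable_funM.
Qed.

(* A perturbation of [expR (gm * c) - expR (gm * z)]; the last term makes it nonnegative
   also above [c], which spares us from controlling the overshoot of the chain. *)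
Definition low_fun (gm gm' c z : R) : R :=
  expR (gm * c) - expR (gm * z) + expR (gm * c) * expR (gm' * (z - c)).

Lemma low_fun_ge0 gm gm' c z : 0 <= gm -> gm <= gm' -> 0 <= low_fun gm gm' c z.
Proof.
move=> g0 gg; rewrite /low_fun; have [zc|cz] := leP z c.
  have : expR (gm * z) <= expR (gm * c) by rewrite ler_expR ler_wpM2l.
  have : 0 <= expR (gm * c) * expR (gm' * (z - c)) by rewrite mulr_ge0 ?expR_ge0.
  lra.
have : expR (gm * z) <= expR (gm * c) * expR (gm' * (z - c)).
  rewrite -expRD ler_expR.
  have : gm * (z - c) <= gm' * (z - c) by rewrite ler_wpM2r// subr_ge0 ltW.
  lra.
have := expR_ge0 (gm * c); lra.
Qed.

Lemma measurable_low_fun gm gm' c : measurable_fun setT (low_fun gm gm' c).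
Proof.
apply: measurable_funD.
  by apply: measurable_funB => //; apply: measurableT_comp => //; exact: measurable_funM.
apply: measurable_funM => //; apply: measurableT_comp => //; apply: measurable_funM => //.
exact: measurable_funB.
Qed.

Let int_exp (k h z : R) : 0 < h ->
  (\int[normal_prob 0%R (Num.sqrt h)]_u (expR (k * drift_step h (z, u)))%:E
   = (expR (k * z) * expR (k * (k - beta) * h))%:E)%E.
Proof.
move=> h0.
have E u : expR (k * drift_step h (z, u)) = expR (k * Num.sqrt 2 * u + k * (z - beta * h)).
  by rewrite /drift_step /=; congr expR; ring.
under eq_integral do rewrite E.
rewrite integral_normal_expR// -expRD exprMn sqr_sqrtr//; congr (expR _)%:E; by field.
Qed.

Let m_step h z (f : R -> R) : measurable_fun setT f ->
  measurable_fun setT (fun u : measurableTypeR R => (f (drift_step h (z, u)))%:E).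
Proof.
move=> mf; apply/measurable_EFinP.
have mp : measurable_fun setT (fun u : measurableTypeR R => (z, u)).
  exact: measurable_fun_pair.
exact: (measurableT_comp mf (measurableT_comp (measurable_drift_step h) mp)).
Qed.

Lemma low_fun_step gm gm' c z h : 0 < h -> 0 <= gm -> gm <= gm' ->
  (\int[normal_prob 0%R (Num.sqrt h)]_u (low_fun gm gm' c (drift_step h (z, u)))%:E
   <= (expR (gm * c) - expR (gm * z) * expR (gm * (gm - beta) * h)
       + expR (gm * c) * (expR (gm' * (z - c)) * expR (gm' * (gm' - beta) * h)))%:E)%E.
Proof.
move=> h0 g0 gg.
have mexp k : measurable_fun setT (fun z : R => expR (k * z)).
  by apply: measurableT_comp => //; exact: measurable_funM.
have sumE : (\int[normal_prob 0%R (Num.sqrt h)]_u (low_fun gm gm' c (drift_step h (z, u)))%:E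
    + \int[normal_prob 0%R (Num.sqrt h)]_u (expR (gm * drift_step h (z, u)))%:E
    = (expR (gm * c))%:E + (expR (gm * c) * expR (- gm' * c))%:E
       * \int[normal_prob 0%R (Num.sqrt h)]_u (expR (gm' * drift_step h (z, u)))%:E)%E.
  rewrite -ge0_integralD//; last 3 first.
  - by move=> u _; rewrite lee_fin; exact: low_fun_ge0.
  - by apply: m_step; exact: measurable_low_fun.
  - exact: (m_step h z (fun z => expR (gm * z))).
  rewrite -ge0_integralZl//; last first.
    exact: (m_step h z (fun z => expR (gm' * z))).
  have kE : ((expR (gm * c))%:E = \int[normal_prob 0%R (Num.sqrt h)]_u (cst (expR (gm * c))%:E u))%E.
    by rewrite integral_cst//= probability_setT mule1.
  rewrite [in RHS]kE -ge0_integralD//; last 2 first.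
  - by move=> u _; rewrite lee_fin expR_ge0.
  - by apply: measurable_funeM; exact: (m_step h z (fun z => expR (gm' * z))).
  apply: eq_integral => u _; rewrite -EFinM -!EFinD; congr EFin.
  have eD : expR (gm' * (drift_step h (z, u) - c))
      = expR (- gm' * c) * expR (gm' * drift_step h (z, u)) by rewrite -expRD; congr expR; ring.
  by rewrite /low_fun eD; ring.
move: sumE; rewrite !int_exp// -EFinM -EFinD => sumE.
have -> : expR (gm' * (z - c)) = expR (- gm' * c) * expR (gm' * z).
  by rewrite -expRD; congr expR; ring.
have : (\int[normal_prob 0%R (Num.sqrt h)]_u (low_fun gm gm' c (drift_step h (z, u)))%:E
   + (expR (gm * z) * expR (gm * (gm - beta) * h))%:E
   <= (expR (gm * c) + expR (gm * c) * expR (- gm' * c) * (expR (gm' * z) * expR (gm' * (gm' - beta) * h)))%:E)%E.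
  by rewrite sumE.
rewrite -leeBrDr// -EFinB => /le_trans; apply; rewrite lee_fin.
by apply/eqr_leW; ring.
Qed.

(* [gm > beta] makes the main term of [low_fun] a strict supermartingale, which absorbs
   the (tiny, for large [gm']) contribution of the correction term. *)
Lemma low_fun_supermartingale gm gm' dl y b h z : beta < gm -> gm <= gm' -> 0 < h ->
  2 * gm' ^+ 2 * h <= 1 -> b <= z -> z <= y ->
  2 * expR (gm * (y + dl)) * (gm' ^+ 2 * expR (- gm' * dl)) <= expR (gm * b) * (gm * (gm - beta)) ->
  (\int[normal_prob 0%R (Num.sqrt h)]_u (low_fun gm gm' (y + dl) (drift_step h (z, u)))%:E
   <= (low_fun gm gm' (y + dl) z)%:E)%E.
Proof.
move=> bg gg h0 hg bz zy H.
have b0 := beta0.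
have g0 : 0 < gm by lra.
have g'0 : 0 < gm' by lra.
apply: (le_trans (low_fun_step _ _ _ _ _ h0 (ltW g0) gg)); rewrite lee_fin /low_fun.
set A := expR (gm * (y + dl)) in H *.
have A0 : 0 < A by exact: expR_gt0.
set p := expR (gm' * (z - (y + dl))).
have p0 : 0 < p by exact: expR_gt0.
have pl : p <= expR (- gm' * dl).
  rewrite /p ler_expR.
  have : gm' * (z - (y + dl)) <= gm' * (- dl) by rewrite ler_pM2l//; lra.
  lra.
set v := gm' * (gm' - beta) * h.
have v0 : 0 <= v by rewrite !mulr_ge0 ?ltW// subr_gt0; lra.
have vl : v <= gm' ^+ 2 * h.
  rewrite /v ler_pM2r// expr2 ler_pM2l//; lra.
have v2 : v <= 1 / 2 by lra.
have ev : expR v - 1 <= 2 * (gm' ^+ 2 * h).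
  have := expR_le_quadratic v v2.
  have : 2 * v ^+ 2 <= v by nra.
  lra.
set u := gm * (gm - beta) * h.
have eu : u <= expR u - 1 by have := expR_ge1Dx u; lra.
have u0 : 0 <= u by rewrite !mulr_ge0 ?ltW// subr_gt0.
have bz' : expR (gm * b) <= expR (gm * z) by rewrite ler_expR ler_pM2l.
have t1 : A * (p * (expR v - 1)) <= A * (expR (- gm' * dl) * (2 * (gm' ^+ 2 * h))).
  rewrite ler_pM2l//; apply: ler_pM => //; first exact: ltW.
  by have := expR_ge1Dx v; lra.
have t2 : expR (gm * b) * u <= expR (gm * z) * (expR u - 1).
  by apply: ler_pM => //; exact: expR_ge0.
have t3 : A * (expR (- gm' * dl) * (2 * (gm' ^+ 2 * h))) <= expR (gm * b) * u.
  have := ler_wpM2r (ltW h0) H.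
  rewrite /u; move: (expR (- gm' * dl)) (expR (gm * b)) => e1 e2.
  by move=> /le_trans H'; apply: (le_trans _ (H' _ _)); apply/eqr_leW; ring.
lra.
Qed.

(** Cubic growth of the exponential, [expR (g * r) >= (g * r / 3) ^ 3], beats the square once
    [g >= 27 / (c * r ^ 3)]. *)
Let exp_small (c r a : R) : 0 < c -> 0 < r ->
  exists g, [/\ a <= g, 1 <= g & g ^+ 2 * expR (- g * r) <= c].
Proof.
move=> c0 r0.
have e0 : 0 < c * r ^+ 3 by rewrite mulr_gt0// exprn_gt0.
pose g := Num.max 1 (Num.max a (27 / (c * r ^+ 3))).
have g1 : 1 <= g by rewrite le_max lexx.
have ga : a <= g by rewrite !le_max lexx orbT.
have gc : 27 <= g * (c * r ^+ 3) by rewrite -ler_pdivrMr// !le_max lexx !orbT.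
have g0 : 0 < g by exact: lt_le_trans g1.
exists g; split => //.
have x0 : 0 < g * r / 3 by rewrite divr_gt0// mulr_gt0.
have E3 : (g * r / 3) ^+ 3 <= expR (g * r).
  have -> : expR (g * r) = expR (g * r / 3) ^+ 3 by rewrite -expRM_natl; congr expR; field.
  by rewrite lerXn2r ?nnegrE ?expR_ge0 ?(ltW x0)//; have := expR_ge1Dx (g * r / 3); lra.
have -> : - g * r = - (g * r) by ring.
rewrite expRN ler_pdivrMr ?expR_gt0//.
apply: (@le_trans _ _ (c * (g * r / 3) ^+ 3)); last by rewrite ler_pM2l.
have -> : c * (g * r / 3) ^+ 3 = g ^+ 2 * (g * (c * r ^+ 3)) / 27 by field.
rewrite ler_pdivlMr// ler_pM2l ?exprn_gt0//.
Qed.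

(** The drifted Brownian motion started at [2 * B] reaches [y] before [B] with probability
    [(e2 - e1) / (ey - e1)], where [e1], [e2], [ey] are the values of [expR (beta * z)] at [B],
    [2 * B], [y]. Dropping [e1] from the denominator gives this smaller value. *)
Let low_target (y : R) := (1 - expR (- (beta * B))) * expR (- (beta * (y - 2 * B))).

(* [r] perturbs [beta], [y] and [B] at once; at [r = 0] the inequality
   [low_fun (2 * B) <= (1 - low_target y) * m] is strict. *)
Let low_params (y : R) : 2 * B <= y -> exists r gm' : R, [/\ 0 < r, beta + r <= gm',
   2 * expR ((beta + r) * (y + r)) * (gm' ^+ 2 * expR (- gm' * r))
     <= expR ((beta + r) * (B + r)) * ((beta + r) * (beta + r - beta)) &
   low_fun (beta + r) gm' (y + r) (2 * B)
     <= (1 - low_target y) * (expR ((beta + r) * (y + r)) - expR ((beta + r) * (B + r)))].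
Proof.
move=> yB.
pose phi (r : R) := expR ((beta + r) * (2 * B))
   - low_target y * (expR ((beta + r) * (y + r)) - expR ((beta + r) * (B + r)))
   - expR ((beta + r) * (B + r)).
have phi0 : 0 < phi 0.
  have -> : phi 0 = low_target y * expR (beta * B).
    rewrite /phi !addr0 /low_target.
    have e1 : expR (beta * (2 * B)) = expR (beta * B) * expR (beta * B).
      by rewrite -expRD; congr expR; ring.
    have e2 : expR (- (beta * (y - 2 * B))) * expR (beta * y) = expR (beta * B) * expR (beta * B).
      by rewrite -!expRD; congr expR; ring.
    have e3 : expR (- (beta * B)) * expR (beta * B) = 1.
      by rewrite -expRD addNr expR0.
    rewrite e1.
    move: e2 e3; set a := expR (- (beta * (y - _))); set b := expR (beta * y).
    set e := expR (beta * B); set e' := expR (- _) => e2 e3.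
    have -> : (1 - e') * a * (b - e) = (1 - e') * (a * b) - (1 - e') * a * e by ring.
    rewrite e2.
    have -> : (1 - e') * (e * e) = e * e - (e' * e) * e by ring.
    rewrite e3; ring.
  rewrite !mulr_gt0 ?expR_gt0// subr_gt0 expR_lt1 oppr_lt0 mulr_gt0//.
have cphi : {for 0, continuous phi}.
  have cE (f : R -> R) : {for 0, continuous f} -> {for 0, continuous (fun r => expR (f r))}.
    by move=> cf; apply: continuous_comp => //; exact: continuous_expR.
  have cl (a : R) : {for 0, continuous (fun r : R => a + r)}.
    by apply: continuousD; [exact: cst_continuous|exact: cvg_id].
  have cy (a : R) : {for 0, continuous (fun r : R => expR ((beta + r) * (a + r)))}.
    by apply: cE; apply: continuousM; exact: cl.
  apply: continuousB; last exact: cy.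
  apply: continuousB.
    by apply: cE; apply: continuousM; [exact: cl|exact: cst_continuous].
  apply: continuousM; first exact: cst_continuous.
  by apply: continuousB; exact: cy.
have /nbhs_ballP[e /= e0 He] : \forall r \near (0 : R), 0 < phi r.
  exact: (cvgr_gt _ cphi).
pose r := e / 2.
have r0 : 0 < r by rewrite divr_gt0.
have phir : 0 < phi r.
  by apply: He; rewrite /ball/= sub0r normrN gtr0_norm// /r; move: e0; lra.
set gm := beta + r.
have gm0 : 0 < gm by rewrite addr_gt0.
set A := expR (gm * (y + r)); set b := expR (gm * (B + r)).
have A0 : 0 < A by exact: expR_gt0.
have b0 : 0 < b by exact: expR_gt0.
(* The first entry makes the correction term at the starting point smaller than the gap [phi r], the
   second makes it negligible in the supermartingale inequality. *)
pose c := Num.min (phi r / A) (b * (gm * r) / (2 * A)).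
have c0 : 0 < c by rewrite lt_min !divr_gt0// !mulr_gt0.
have [gm' [gg g1 gc]] := exp_small c r gm c0 r0.
have cA : c * A <= phi r by rewrite -ler_pdivlMr// ge_min lexx.
have cb : c * (2 * A) <= b * (gm * r).
  by rewrite -ler_pdivlMr ?mulr_gt0// ge_min lexx orbT.
exists r, gm'; split => //.
  have -> : beta + r - beta = r by ring.
  apply: le_trans cb; rewrite [X in _ <= X]mulrC ler_pM2l// mulr_gt0//.
have t1 : A * expR (gm' * (2 * B - (y + r))) <= phi r.
  apply: le_trans cA; rewrite [X in _ <= X]mulrC ler_pM2l//; apply: le_trans gc.
  apply: (@le_trans _ _ (expR (- gm' * r))).
    rewrite ler_expR.
    have : gm' * (2 * B - (y + r)) <= gm' * (- r) by rewrite ler_pM2l; lra.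
    lra.
  by rewrite ler_peMl ?expR_ge0// expr_ge1// (le_trans ler01).
move: t1; rewrite /phi /low_fun -/gm -/A -/b.
move: (expR (gm * _)) (expR (gm' * _)) (low_target y) => e1 e2 tg; lra.
Qed.

Section process.
Context {d : measure_display} {T : measurableType d}.
Variables (P : probability T R) (W Q1 Q2 L : R -> T -> R).
Hypothesis BM : standard_BM P W.
Hypothesis sol : forall w, reflected_solution beta 0 (2 * B) (W^~ w) (Q1^~ w) (Q2^~ w) (L^~ w).

Let lower_path (t : R) w := 2 * B + Num.sqrt 2 * W t w - beta * t.

Let pchain_drift h k w :
  pchain (bm_increment W h) (drift_step h) (2 * B) k w = lower_path (k%:R * h) w.
Proof.
elim: k => [|k ih].
  by case: BM => W0 _ _ _ _; rewrite /lower_path mul0r W0 /=; ring.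
rewrite /pchain /= -/(pchain (bm_increment W h) (drift_step h) (2 * B) k w) ih.
by rewrite /drift_step /= /bm_increment /grid_increment /lower_path -natr1; ring.
Qed.

(** [Q2 = X + S], and both [X] and the drift contribution [X] to [S] are nonnegative. *)
Let lower_path_le t w : 0 <= t -> lower_path t w <= Q2 t w.
Proof.
move=> t0; case: (BM) => W0 Wc _ _ _.
have [cW cX cS] := solution_continuous beta (2 * B) _ _ _ _ (Wc w) (sol w).
have [M M0 HM] := segment_bounded _ 0 t cX.
(* Centring at [M / 2] encodes [0 <= X <= M], so that the increment estimate yields exactly 0 as
   lower bound for the integral of [X]. *)
have H u : 0 <= u <= t -> `|- Q1 u w - M / 2| <= M / 2.
  move=> /[dup] /andP[u0 _] /HM; rewrite clampE// ler_norml => /andP[_ h2].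
  have := solution_X_ge0 beta (2 * B) _ _ _ _ (sol w) u u0.
  by rewrite ler_norml => h1; apply/andP; split; lra.
have := solution_S_increment beta (2 * B) _ _ _ _ (Wc w) (sol w) 0 t (M / 2) (M / 2) (lexx 0) t0 H.
have [-> ->] := solution_init P W Q1 Q2 L beta (2 * B) BM sol w.
have := solution_X_ge0 beta (2 * B) _ _ _ _ (sol w) t t0.
rewrite W0 !subr0 add0r ler_norml => X0 /andP[S1 _].
by rewrite /lower_path; lra.
Qed.

Let continuous_lower_path w : continuous (clamp (lower_path^~ w)).
Proof.
case: (BM) => _ Wc _ _ _.
have cW := continuous_clamp _ (Wc w).
have cm : continuous (clamp (fun t : R => t)).
  by apply: continuous_clamp; apply: continuous_subspaceT => t; exact: cvg_id.
move=> t; apply: (@continuousB _ _ _ (fun t => 2 * B + Num.sqrt 2 * clamp (W^~ w) t)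
  (fun t => beta * clamp id t)).
  apply: continuousD; first exact: cst_continuous.
  by apply: continuousM; [exact: cst_continuous|exact: cW].
by apply: continuousM; [exact: cst_continuous|exact: cm].
Qed.

Let down_event (y b : R) (K n : nat) : set T :=
  [set w | let z := kchain (bm_increment W (mesh n)) (drift_step (mesh n)) (2 * B)
       (fun _ z => z <= y) (fun _ z => z <= b) (K * n.+1) w in z.2 && (z.1 <= b)].

Let measurable_down_event y b K n : measurable (down_event y b K n).
Proof.
apply: (measurable_bm_kchain P W BM (mesh n) (K * n.+1) (drift_step (mesh n)) (2 * B)
  (fun _ z => z <= y) (fun _ z => z <= b) (mesh_gt0 n) _ _ _ (fun z => z <= b)).
- exact: measurable_drift_step.
- by move=> k; exact: measurable_fun_ler.
- by move=> k; exact: measurable_fun_ler.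
- exact: measurable_fun_ler.
Qed.

(** On this event [Q2] visits [B] without having reached [y], hence so does the dominated path, in
    the weaker form of going below [b]. The chain equals that path at grid points, so the only slack
    needed, [b - B], is for rounding the time to the grid. *)
Let down_inclusion y b w : B < b -> (Xi0 B (Q2^~ w) < tau (Q2^~ w) y)%E -> 2 * B <= y ->
  exists K0 : nat, forall K, (K0 <= K)%N -> exists n0, forall n, (n0 <= n)%N ->
    down_event y b K n w.
Proof.
move=> Bb /Xi0_lt[s [t [s0 st qs qt tt]]] yB.
have [_ [_ c2]] := solution_cts P W Q1 Q2 L beta (2 * B) BM sol.
have [_ q0] := solution_init P W Q1 Q2 L beta (2 * B) BM sol w.
have Qy u : 0 <= u <= s -> Q2 u w < y.
  move=> /andP[u0 us]; rewrite ltNge; apply/negP => yu.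
  have [|v] := @IVT _ (Q2^~ w) 0 u y u0 (continuous_clamp_within _ _ _ (lexx 0) (c2 w)).
    by rewrite q0 ge_min yB le_max yu orbT.
  rewrite in_itv/= => /andP[v0 vu] Qv.
  have : (tau (Q2^~ w) y <= v%:E)%E by exact: hit_le.
  by move=> /(lt_le_trans tt); rewrite lte_fin => tv; lra.
have b0 : 0 < b - B by rewrite subr_gt0.
have [dl dl0 Hd] := clamp_near _ s _ (continuous_lower_path w) s0 b0.
have [n1 Hn1] := mesh_small _ dl0.
exists (Num.truncn s).+1 => K Kt; exists n1 => n /Hn1 hdl.
have hp := mesh_gt0 (R := R) n.
pose k0 := Num.truncn (s / mesh n).
have /andP[k1' k2'] := truncn_grid s (mesh n) s0 hp; rewrite -/k0 in k1' k2'.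
have tK : s <= K%:R.
  apply: (@le_trans _ _ (Num.truncn s).+1%:R); first by apply/ltW; rewrite truncnS_gt.
  by rewrite ler_nat.
have kj3 : (k0 <= K * n.+1)%N.
  by rewrite -(ler_nat R) -(ler_pM2r hp) mesh_natr (le_trans k1').
have kk0 j : 0 <= j%:R * mesh n :> R by rewrite mulr_ge0// ltW.
have alj j : (j < k0)%N -> pchain (bm_increment W (mesh n)) (drift_step (mesh n)) (2 * B) j w <= y.
  move=> jk; have jt : j%:R * mesh n <= s.
    by apply: le_trans k1'; rewrite ler_pM2r// ler_nat ltnW.
  rewrite pchain_drift (le_trans (lower_path_le _ _ (kk0 j)))// ltW// Qy//.
  by rewrite kk0.
have frk : pchain (bm_increment W (mesh n)) (drift_step (mesh n)) (2 * B) k0 w <= b.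
  rewrite pchain_drift.
  have dk : `|k0%:R * mesh n - s| < dl.
    by rewrite distrC ger0_norm ?subr_ge0//; lra.
  have := Hd _ (kk0 k0) dk; have := lower_path_le s w s0; rewrite qs ltr_norml.
  by move=> ? /andP[? ?]; lra.
have [a c] := kchain_frozen (bm_increment W (mesh n)) (drift_step (mesh n)) (2 * B)
    (fun _ z => z <= y) (fun _ z => z <= b) (fun k z f => f) k0 (K * n.+1) w kj3 alj frk.
by rewrite /down_event /= a /=.
Qed.

(** The complementary event is bounded from above: the supermartingale [low_fun] is at least [m]
    below [B + r], and [low_params] gives [low_fun (2 * B) / m <= 1 - low_target y]. *)
Theorem tail_Q2_lower (y : R) : 2 * B <= y ->
  (((1 - expR (- (beta * B))) * expR (- (beta * (y - 2 * B))))%:E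
    <= P [set w | (tau (Q2^~ w) y <= Xi0 B (Q2^~ w))%E])%E.
Proof.
move=> yB.
have [cQ1 cQ2] := solution_cts P W Q1 Q2 L beta (2 * B) BM sol.
have init := solution_init P W Q1 Q2 L beta (2 * B) BM sol.
have mE : measurable [set w | (tau (Q2^~ w) y <= Xi0 B (Q2^~ w))%E].
  by apply: measurable_tau_le_Xi0 => // w; exact: (init w).2.
set E := [set w | _] in mE *.
suff H : (P (~` E) <= (1 - low_target y)%:E)%E.
  move: H; rewrite probability_setC// -[P E]fineK ?fin_num_measure//.
  by rewrite -EFinB !lee_fin /low_target; lra.
have [r [gm' [r0 gg Hsup Hlow]]] := low_params y yB.
have b0 := beta0.
have gm0 : 0 < beta + r by rewrite addr_gt0.
have g'0 : 0 < gm' by rewrite (lt_le_trans gm0).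
set m := (X in _ <= _ * X) in Hlow.
have m0 : 0 < m.
  by rewrite subr_gt0 ltr_expR ltr_pM2l//; have := B0; lra.
apply: (measure_eventually2_le P (~` E) (down_event y (B + r)) _ 0) => //.
- exact: measurableC.
- move=> w /negP; rewrite -ltNge => Ew.
  by apply: (down_inclusion y (B + r) w) => //; rewrite ltrDl.
move=> K _.
have h10 : 0 < (2 * gm' ^+ 2)^-1 by rewrite invr_gt0 mulr_gt0// exprn_gt0.
have [n0 Hn0] := mesh_small _ h10.
exists n0 => n /Hn0 hn.
have hh : 2 * gm' ^+ 2 * mesh n <= 1.
  by rewrite -ler_pdivlMl ?mulr_gt0 ?exprn_gt0// mulr1.
have V0 (z : R) : 0 <= low_fun (beta + r) gm' (y + r) z by apply: low_fun_ge0 => //; exact: ltW.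
have := bm_kchain_bound P W BM (mesh n) (K * n.+1) (drift_step (mesh n)) (2 * B)
  (fun _ z => z <= y) (fun _ z => z <= B + r) (mesh_gt0 n) (measurable_drift_step (mesh n))
  _ _ (fun=> low_fun (beta + r) gm' (y + r)) (fun=> 1) (fun z => z <= B + r) m
  (fun=> measurable_low_fun _ _ _) (fun _ z => V0 z) (fun=> ler01) _ m0.
move=> /(_ _ _ _ _ _ _) /le_trans; apply.
- by move=> k; exact: measurable_fun_ler.
- by move=> k; exact: measurable_fun_ler.
- exact: measurable_fun_ler.
- move=> k z _ zy; rewrite -ltNge mul1r => bz.
  have bg : beta < beta + r by rewrite ltrDl.
  exact: (low_fun_supermartingale _ _ _ _ (B + r) _ _ bg gg (mesh_gt0 n) hh (ltW bz) zy Hsup).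
- by move=> k z _ _; rewrite mul1r.
- move=> z zb; rewrite /m /low_fun.
  have : expR ((beta + r) * z) <= expR ((beta + r) * (B + r)) by rewrite ler_expR ler_pM2l.
  have : 0 <= expR ((beta + r) * (y + r)) * expR (gm' * (z - (y + r))).
    by rewrite mulr_ge0 ?expR_ge0.
  lra.
by rewrite big1// mul1r lee_fin ler_pdivrMr.
Qed.

End process.
End lower_Q2.

(** * Lower tail of [X] through an Ornstein-Uhlenbeck chain *)

Section gaussian_lower_tail.
Context {R : realType} {d : measure_display} {T : measurableType d}.
Variable P : probability T R.

(* Exponential tilting: under the weight [expR (th * Z)] with [th = m / v], the mass of [Z]
   concentrates within distance [4] of [m], because the second factor
   [expR (Z - m) + expR (m - Z)] has a tilted mean at most [2 * expR 1]. *)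
Lemma gaussian_lower_tail (Z : T -> R) (v m : R) : measurable_fun setT Z ->
  0 < v -> v <= 2 -> 0 <= m ->
  (forall l, \int[P]_w (expR (l * Z w))%:E = (expR (l ^+ 2 * v / 2))%:E)%E ->
  ((expR (- (4 * m + m ^+ 2 / 2) / v) / 2)%:E <= P [set w | (m - 4 < Z w)%R])%E.
Proof.
move=> mZ v0 v2 m0 mgf.
have mE l : measurable_fun setT (fun w => (expR (l * (Z w - m)))%:E).
  apply/measurable_EFinP; apply: measurableT_comp => //; apply: measurable_funM => //.
  exact: measurable_funB.
have IE l : (\int[P]_w (expR (l * (Z w - m)))%:E = (expR (l ^+ 2 * v / 2 - l * m))%:E)%E.
  have E w : expR (l * (Z w - m)) = expR (- (l * m)) * expR (l * Z w).
    by rewrite -expRD; congr expR; ring.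
  under eq_integral do rewrite E EFinM.
  rewrite ge0_integralZl//=; last first.
    by apply/measurable_EFinP; apply: measurableT_comp => //; exact: measurable_funM.
  by rewrite mgf -EFinM -expRD; congr (expR _)%:E; ring.
pose th := m / v.
have th0 : 0 <= th by rewrite divr_ge0// ltW.
have thv : th * v = m by rewrite divfK// gt_eqF.
set F := [set w | _].
have mF : measurable F.
  have -> : F = setT `&` Z @^-1` `]m - 4, +oo[.
    by apply/seteqP; split => w /=; rewrite in_itv/= andbT => // -[].
  exact: mZ.
pose A := expR (- (m ^+ 2 / 2) / v).
have I0 : (\int[P]_w (expR (th * (Z w - m)))%:E = A%:E)%E.
  by rewrite IE; congr (expR _)%:E; rewrite /th; field; rewrite gt_eqF.
have I1 : (\int[P]_w (expR ((th + 1) * (Z w - m)))%:E = (A * expR (v / 2))%:E)%E.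
  by rewrite IE -expRD; congr (expR _)%:E; rewrite /th; field; rewrite gt_eqF.
have I2 : (\int[P]_w (expR ((th - 1) * (Z w - m)))%:E = (A * expR (v / 2))%:E)%E.
  by rewrite IE -expRD; congr (expR _)%:E; rewrite /th; field; rewrite gt_eqF.
have pw w : expR (th * (Z w - m)) <= expR (-4) * expR ((th + 1) * (Z w - m))
    + expR (-4) * expR ((th - 1) * (Z w - m)) + expR (4 * th) * \1_F w.
  have p1 : 0 <= expR (4 * th) * \1_F w by rewrite mulr_ge0 ?expR_ge0.
  have p2 : 0 <= expR (-4) * expR ((th + 1) * (Z w - m)) by rewrite mulr_ge0 ?expR_ge0.
  have p3 : 0 <= expR (-4) * expR ((th - 1) * (Z w - m)) by rewrite mulr_ge0 ?expR_ge0.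
  have [zm|zm] := leP (Z w) (m - 4).
    have : expR (th * (Z w - m)) <= expR (-4) * expR ((th - 1) * (Z w - m)).
      by rewrite -expRD ler_expR; lra.
    lra.
  have [zm'|zm'] := leP (m + 4) (Z w).
    have : expR (th * (Z w - m)) <= expR (-4) * expR ((th + 1) * (Z w - m)).
      by rewrite -expRD ler_expR; lra.
    lra.
  have -> : \1_F w = 1 :> R by rewrite indicE mem_set.
  have : expR (th * (Z w - m)) <= expR (4 * th).
    rewrite ler_expR mulrC ler_wpM2r//; lra.
  lra.
have key : (A%:E <= (expR (-4) * (A * expR (v / 2)))%:E + (expR (-4) * (A * expR (v / 2)))%:E
    + (expR (4 * th))%:E * P F)%E.
  rewrite -I0 [X in (X + _ + _)%E]EFinM -I1 [X in (_ + X + _)%E]EFinM -I2.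
  have -> : P F = (\int[P]_w (\1_F w)%:E)%E by rewrite integral_indic// setIT.
  have mI : measurable_fun setT (fun w => (\1_F w)%:E : \bar R).
    by apply/measurable_EFinP; exact: measurable_indic.
  rewrite -!ge0_integralZl//; [|by rewrite lee_fin expR_ge0..].
  rewrite -ge0_integralD//; [|exact: measurable_funeM..].
  rewrite -ge0_integralD//; last 3 first.
  - by move=> w _; rewrite -!EFinM -EFinD lee_fin addr_ge0// mulr_ge0 ?expR_ge0.
  - by apply: emeasurable_funD; exact: measurable_funeM.
  - exact: measurable_funeM.
  apply: ge0_le_integral => //.
  - apply: emeasurable_funD; last exact: measurable_funeM.
    by apply: emeasurable_funD; exact: measurable_funeM.
  - by move=> w _; rewrite -!EFinM -!EFinD lee_fin.
have A0 : 0 < A by exact: expR_gt0.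
(* This is the reason for the distance 4: with [v <= 2] and [4 <= expR 3], the two outer tails carry
   together at most half of the tilted mass. *)
have ev : 4 * (expR (-4) * expR (v / 2)) <= 1.
  have e3 : 4 <= expR 3 :> R by have := expR_ge1Dx (3 : R); lra.
  have : expR (v / 2) <= expR 1 by rewrite ler_expR; lra.
  move=> /(ler_wpM2l (expR_ge0 (-4))) e1.
  have e2 : 4 * (expR (-4) * expR 1) <= expR 3 * (expR (-4) * expR 1) :> R.
    by rewrite ler_wpM2r// mulr_ge0 ?expR_ge0.
  have e4 : expR 3 * (expR (-4) * expR 1) = 1 :> R.
    rewrite -!expRD -[RHS]expR0; congr expR; ring.
  by rewrite e4 in e2; lra.
have PF : P F \is a fin_num by exact: fin_num_measure.
move: key; rewrite -(fineK PF) -EFinM -!EFinD !lee_fin => key.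
have -> : expR (- (4 * m + m ^+ 2 / 2) / v) = expR (- (4 * th)) * A.
  by rewrite -expRD; congr expR; rewrite /th; field; rewrite gt_eqF.
have k2 : A / 2 <= expR (4 * th) * fine (P F).
  have : A * (4 * (expR (-4) * expR (v / 2))) <= A * 1 by rewrite ler_pM2l.
  move: key; move: (expR (-4)) (expR (v / 2)) (_ * fine _) => a b c; lra.
rewrite expRN -mulrA ler_pdivrMl ?expR_gt0//.
Qed.

End gaussian_lower_tail.

Section ou_chain.
Context {R : realType}.

Definition ou_step (h : R) (zu : R * measurableTypeR R) : R :=
  (1 - h) * zu.1 - Num.sqrt 2 * (zu.2 : R).

Lemma measurable_ou_step h : measurable_fun setT (ou_step h).
Proof.
have m2 : measurable_fun setT (fun zu : R * measurableTypeR R => zu.2 : R).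
  exact: measurable_snd.
apply: measurable_funB; apply: measurable_funM => //; exact: measurable_fst.
Qed.

(** Variance after [N] steps: the noise of step [k] has variance [2 * h] and is then contracted
    [N - k.+1] times. *)
Definition ou_var (h : R) (N : nat) : R := 2 * h * \sum_(k < N) ((1 - h) ^+ (N - k.+1)) ^+ 2.

Lemma ou_varE h N : h < 2 -> (2 - h) * ou_var h N = 2 * (1 - (1 - h) ^+ (2 * N)).
Proof.
move=> h2; rewrite /ou_var (reindex_inj rev_ord_inj)/=.
under eq_bigr do rewrite subnSK// subKn ?(ltnW (ltn_ord _))// exprAC.
have := subrX1 ((1 - h) ^+ 2) N; rewrite -exprM => E.
have -> : 1 - (1 - h) ^+ (2 * N) = - ((1 - h) ^+ (2 * N) - 1) by ring.
rewrite E; move: (\sum_(_ < _) _) => S; ring.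
Qed.

Lemma integral_ou_step h a z : 0 < h ->
  (\int[normal_prob 0%R (Num.sqrt h)]_u (expR (a * ou_step h (z, u)))%:E
   = (expR (a ^+ 2 * h) * expR (a * (1 - h) * z))%:E)%E.
Proof.
move=> h0.
have E u : expR (a * ou_step h (z, u)) = expR (- (a * Num.sqrt 2) * u + a * (1 - h) * z).
  by rewrite /ou_step /=; congr expR; ring.
under eq_integral do rewrite E.
by rewrite integral_normal_expR// expRD sqrrN exprMn sqr_sqrtr//; congr (expR _ * _)%:E; field.
Qed.

Context {d : measure_display} {T : measurableType d}.
Variables (P : probability T R) (W : R -> T -> R).
Hypothesis BM : standard_BM P W.

Definition ou (h : R) (N : nat) (w : T) : R := pchain (bm_increment W h) (ou_step h) 0 N w.

Lemma measurable_ou h N : 0 < h -> measurable_fun setT (ou h N).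
Proof.
move=> h0; apply: measurable_chain => [j|_]; last exact: measurable_ou_step.
exact: (measurable_bm_increment P W BM h j h0).
Qed.

(** The tilt at step [k] is [l * (1 - h) ^ (N - k)], the contraction still to come; one step then
    reproduces the test function up to an explicit factor. *)
Lemma ou_mgf h N l : 0 < h ->
  (\int[P]_w (expR (l * ou h N w))%:E = (expR (l ^+ 2 * ou_var h N / 2))%:E)%E.
Proof.
move=> h0.
pose V k (z : R) := expR (l * (1 - h) ^+ (N - k) * z).
pose c (k : nat) := expR ((l * (1 - h) ^+ (N - k.+1)) ^+ 2 * h).
have mV k : measurable_fun setT (V k).
  by apply: measurableT_comp => //; exact: measurable_funM.
have H := integral_chain_eq P N (bm_increment W h) (normal_prob 0%R (Num.sqrt h))
  (fun k => measurable_bm_increment P W BM h k h0)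
  (fun A => bm_increment_indep P W BM h N A h0)
  (fun k A _ => bm_increment_law P W BM h k A h0) (fun=> ou_step h) 0
  (fun=> measurable_ou_step h) V c mV (fun k z => expR_ge0 _) (fun k => expR_ge0 _).
transitivity (\int[P]_w (V N (ou h N w))%:E)%E.
  by apply: eq_integral => w _; rewrite /V subnn expr0 mulr1.
rewrite [LHS]H.
  rewrite /V mulr0 expR0 mulr1 /c -expR_sum; congr (expR _)%:E.
  rewrite /ou_var mulr_sumr mulr_sumr mulr_suml; apply: eq_bigr => k _.
  by field.
move=> k z kN; rewrite /V integral_ou_step//; congr (expR _ * expR _)%:E.
by rewrite -(subnSK kN) exprSr mulrA.
Qed.

Lemma ou_lower_tail h N m : 0 < h -> h <= 1 / 2 -> N%:R * h = 1 / 2 -> 0 <= m ->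
  ((expR (- (4 * m + m ^+ 2 / 2) * (9 / 5)) / 2)%:E <= P [set w | (m - 4 < ou h N w)%R])%E.
Proof.
move=> h0 h1 Nh m0.
have vE := ou_varE h N; set r := (1 - h) ^+ (2 * N) in vE.
have r0 : 0 <= r by rewrite exprn_ge0//; lra.
(* Here [r <= expR (- 1)], as [2 * N * h = 1], and [expR (1 / 2) >= 3 / 2]. The variance is
   therefore at least [5 / 9], which gives the factor [9 / 5] and a leading coefficient [9 / 10 < 1]
   in the exponent. *)
have r1 : r <= 4 / 9.
  have e : (1 - h) ^+ (2 * N) <= expR (- h) ^+ (2 * N).
    rewrite lerXn2r ?nnegrE ?expR_ge0//; first lra.
    by have := expR_ge1Dx (- h).
  apply: (le_trans e); rewrite -expRM_natl natrM.
  have -> : 2 * N%:R * - h = - 1 by rewrite -mulrA mulrN Nh; field.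
  have a : 3 / 2 <= expR (1 / 2) :> R by have := expR_ge1Dx (1 / 2 : R); lra.
  have b : expR (1 / 2) * expR (1 / 2) * expR (- 1) = 1 :> R.
    by rewrite -!expRD -[RHS]expR0; congr expR; field.
  have := expR_gt0 (- 1 : R); move: a b.
  move: (expR (1 / 2)) (expR (- 1)) => p q a b q0.
  have : (3 / 2) * (3 / 2) <= p * p by apply: ler_pM => //; lra.
  by move=> /(ler_wpM2r (ltW q0)); rewrite b; lra.
have {}vE : (2 - h) * ou_var h N = 2 * (1 - r) by apply: vE; lra.
have v1 : 5 / 9 <= ou_var h N by nra.
have v2 : ou_var h N <= 2 by nra.
have v0 : 0 < ou_var h N by lra.
apply: le_trans (gaussian_lower_tail P (ou h N) (ou_var h N) m (measurable_ou h N h0) v0 v2 m0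
  (fun l => ou_mgf h N l h0)).
rewrite lee_fin ler_pM2r// ler_expR !mulNr lerN2 ler_wpM2l//.
  by rewrite addr_ge0 ?mulr_ge0// divr_ge0// sqr_ge0.
by rewrite -[leLHS]mul1r ler_pdivrMr//; lra.
Qed.

End ou_chain.

(* [q] plays the role of [Q2] and decreases at most at rate one, hence its past is controlled
   by its present value; this turns the pull of [Q2] on [Q1] into the loss of [y0]. *)
Lemma euler_ge_ou {R : realType} (beta h y0 : R) (dW z : nat -> R) k : 0 <= beta -> 0 <= h ->
  h <= 1 -> 0 <= y0 -> z 0%N = 0 -> (forall j, z j.+1 = (1 - h) * z j - Num.sqrt 2 * dW j) ->
  let x := (euler beta h y0 dW k).1 in let q := x + (euler beta h y0 dW k).2 in
  - (k%:R * h) * q <= (1 - h) * (x - z k - q + y0).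
Proof.
move=> b0 h0 h1 y00 z0 zS; elim: k => [|k ih] /=.
  by rewrite z0; lra.
have qS := estep_q beta h (euler beta h y0 dW k) (dW k).
have [_ q0] := euler_q_ge beta h y0 dW k h0 h1 y00.
move: ih q0 qS => /=; rewrite zS.
set x := (euler _ _ _ _ _).1; set s := (euler _ _ _ _ _).2.
set x' := Num.max _ _; set u := Num.sqrt 2 * dW k.
rewrite -natr1; have := ler0n R k; move: (k%:R : R) => kr k0 ih q0 qS.
have bh : 0 <= beta * h by rewrite mulr_ge0.
have hy : 0 <= h * y0 by rewrite mulr_ge0.
have k1h : 0 <= (kr + 1) * h by rewrite mulr_ge0// addr_ge0.
have s1 : (1 - h) * (x - z k - (x + s)) - h * (x + s)
    <= x' - ((1 - h) * z k - u) - (x' + (s + u + (x - beta) * h)) by lra.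
have s2 := ler_wpM2l (_ : 0 <= 1 - h) s1.
have s3 := ler_wpM2l k1h qS.
have {}s2 := s2 (eqbRL (subr_ge0 _ _) h1).
have s4 : 0 <= (1 - h) * (h * y0) by rewrite mulr_ge0// subr_ge0.
have s5 := ler_wpM2l (eqbRL (subr_ge0 _ _) h1) ih.
lra.
Qed.

Section lower_Q1.
Context {R : realType} (beta B : R).
Hypothesis beta0 : 0 < beta.
Hypothesis B0 : 0 < B.

Let B20 : 0 <= 2 * B. Proof. by rewrite mulr_ge0// ltW. Qed.

Let mesh_le1 n : mesh n <= 1 :> R.
Proof. by rewrite invf_le1// ler1n. Qed.

(** Only odd indices are used for the lower tail of [X]: the mesh is then [1 / (2 * n + 2)], and
    time [1 / 2] is a grid point. *)
Let mesh_half n : n.+1%:R * mesh (n.*2.+1) = 1 / 2 :> R.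
Proof.
by rewrite /mesh -[n.*2.+2]/(n.+1.*2) -muln2 natrM invfM mulrA mulfV ?mul1r//.
Qed.

Section process.
Context {d : measure_display} {T : measurableType d}.
Variables (P : probability T R) (W Q1 Q2 L : R -> T -> R).
Hypothesis BM : standard_BM P W.
Hypothesis sol : forall w, reflected_solution beta 0 (2 * B) (W^~ w) (Q1^~ w) (Q2^~ w) (L^~ w).

Lemma Q2_ge_linear s w : 0 <= s -> 2 * B * (1 - s) <= Q2 s w.
Proof.
move=> s0; apply/ler_addgt0Pr => e e0.
have e2 : 0 < e / 2 by rewrite divr_gt0.
have [n Hn] := solution_euler_near P W Q1 Q2 L beta (2 * B) BM sol s _ w s0 e2.
have hp := mesh_gt0 (R := R) n.
have [] := Hn n (leqnn _); rewrite /= !ler_norml => /andP[_ ?] /andP[_ ?].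
set k0 := Num.truncn (s / mesh n).
have /andP[k1 _] := truncn_grid s (mesh n) s0 hp; rewrite -/k0 in k1.
have [q1 _] := euler_q_ge beta (mesh n) (2 * B) (grid_increment (W^~ w) (mesh n)) k0
  (ltW hp) (mesh_le1 n) B20.
have : 2 * B * (1 - s) <= 2 * B * (1 - k0%:R * mesh n) by rewrite ler_wpM2l// lerD2l lerN2.
rewrite -/k0 in q1 *; lra.
Qed.

Lemma half_le_Xi0 w : ((1 / 2)%:E <= Xi0 B (Q2^~ w))%E.
Proof.
apply: le_Xi0 => -[s [t [s0 st tp qs qt]]].
have := Q2_ge_linear s w s0; rewrite qs => H.
have : 0 < B * (1 - 2 * s) by rewrite mulr_gt0//; lra.
lra.
Qed.

Let pz_ge_ou n w : ou W (mesh n.*2.+1) n.+1 w - 2 * B <= (pz W beta (2 * B) n.*2.+1 n.+1 w).1.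
Proof.
set h := mesh n.*2.+1.
have h0 : 0 < h by exact: mesh_gt0.
have h1 : h <= 1 / 2.
  by rewrite -(mesh_half n) -[leLHS]mul1r ler_pM2r// ler1n.
have h1' : h <= 1 by exact: mesh_le1.
have := euler_ge_ou beta h (2 * B) (grid_increment (W^~ w) h) (fun k => ou W h k w) n.+1
  (ltW beta0) (ltW h0) h1' B20 (erefl _) (fun j => erefl _).
have [_] := euler_q_ge beta h (2 * B) (grid_increment (W^~ w) h) n.+1 (ltW h0) h1' B20.
rewrite /pz pchain_euler -/h mesh_half; cbv zeta.
move: (euler _ _ _ _ _) (ou _ _ _ _) => [x s] z /= q0 H.
rewrite -subr_ge0; have h10 : 0 < 1 - h by lra.
(* With [k * h = 1 / 2], [euler_ge_ou] bounds [(1 - h) * (x - z + 2 * B)] below by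
   [(1 / 2 - h) * q], nonnegative as [h <= 1 / 2]. *)
rewrite -(pmulr_rge0 _ h10).
have : 0 <= (1 / 2 - h) * (x + s) by rewrite mulr_ge0// subr_ge0.
lra.
Qed.

(** The 4 is the one of [gaussian_lower_tail]. Of the level [x + 2 * B + 2] that remains, [2 * B] is
    lost to the pull of [Q2] and 1 to the approximation, which leaves more than [x]. *)
Let ou_event x n : set T := [set w | x + 2 * B + 6 - 4 < ou W (mesh n.*2.+1) n.+1 w].

Let ou_event_inclusion x w : (forall n, exists2 k, (n <= k)%N & ou_event x k w) ->
  Q1 (1 / 2) w < - x.
Proof.
move=> H.
have [n0 Hn0] := pz_near P W Q1 Q2 L beta (2 * B) BM sol w (1 / 2) _ ltr01.
have [k nk Zk] := H n0.
have {}Zk : x + 2 * B + 6 - 4 < ou W (mesh k.*2.+1) k.+1 w := Zk.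
have kn : (n0 <= k.*2.+1)%N.
  by rewrite (leq_trans nk)// -addnn -addnS leq_addr.
have := Hn0 _ kn k.+1; rewrite mesh_half => /(_ (lexx _))[+ _].
by have := pz_ge_ou k w; rewrite ler_norml => ? /andP[? ?]; lra.
Qed.

Lemma tail_Q1_lower_aux x : 0 <= x ->
  ((expR (- (4 * (x + 2 * B + 6) + (x + 2 * B + 6) ^+ 2 / 2) * (9 / 5)) / 2)%:E
       <= P [set w | (ereal_inf [set (Q1 t w)%:E | t in
                        [set t | (0 <= t)%R /\ (t%:E <= Xi0 B (Q2^~ w))%E]]
                      < (- x)%:E)%E])%E.
Proof.
move=> x0.
have [cQ1 cQ2] := solution_cts P W Q1 Q2 L beta (2 * B) BM sol.
have init := solution_init P W Q1 Q2 L beta (2 * B) BM sol.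
apply: (measure_infinitely_often_ge P _ (ou_event x) _ 0).
- apply: measurable_inf_lt => // w; first exact: (init w).2.
  by rewrite (init w).1 oppr_le0.
- move=> n.
  have -> : ou_event x n = setT `&` ou W (mesh n.*2.+1) n.+1 @^-1` `]x + 2 * B + 6 - 4, +oo[.
    by apply/seteqP; split => w /=; rewrite /ou_event/= in_itv/= andbT => // -[].
  by apply: (measurable_ou P W BM) => //; exact: mesh_gt0.
- move=> w /ou_event_inclusion Qx /=.
  apply: (@le_lt_trans _ _ (Q1 (1 / 2) w)%:E); last by rewrite lte_fin.
  apply: ge_ereal_inf; exists (Q1 (1 / 2) w)%:E => //; exists (1 / 2) => //.
  by split; [rewrite divr_ge0|exact: half_le_Xi0].
- move=> n _; apply: (ou_lower_tail P W BM); rewrite ?mesh_half//.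
  + exact: mesh_gt0.
  + by rewrite -(mesh_half n) -[leLHS]mul1r ler_pM2r ?mesh_gt0// ler1n.
  + by have := B20; lra.
Qed.

End process.

Theorem tail_Q1_lower : exists2 Css : R, 0 < Css &
  forall (d : measure_display) (T : measurableType d) (P : probability T R)
         (W Q1 Q2 L : R -> T -> R),
  standard_BM P W ->
  (forall w, reflected_solution beta 0 (2 * B) (W^~ w) (Q1^~ w) (Q2^~ w) (L^~ w)) ->
  forall x : R, 0 <= x ->
     ((Css * expR (- (x ^+ 2)))%:E
       <= P [set w | (ereal_inf [set (Q1 t w)%:E | t in
                        [set t | (0 <= t)%R /\ (t%:E <= Xi0 B (Q2^~ w))%E]]
                      < (- x)%:E)%E])%E.
Proof.
pose c := 2 * B + 6.
(* Coefficient of [x] in the exponent. The inequality [9 / 10 * x ^ 2 + b * x <= x ^ 2 + 5 / 2 * b ^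
   2] is [(x - 5 * b) ^ 2 >= 0], and the constants go into the prefactor. *)
pose b := 36 / 5 + 9 / 5 * c.
exists (expR (- (36 / 5 * c + 9 / 10 * c ^+ 2 + 5 / 2 * b ^+ 2)) / 2).
  by rewrite divr_gt0// expR_gt0.
move=> d T P W Q1 Q2 L BM sol x x0.
apply: le_trans (tail_Q1_lower_aux P W Q1 Q2 L BM sol x x0).
have -> : x + 2 * B + 6 = x + c by rewrite /c; ring.
rewrite lee_fin mulrAC ler_pM2r// -expRD ler_expR.
by have := sqr_ge0 (x - 5 * b); rewrite /b; move: (c) => c'; lra.
Qed.

End lower_Q1.

Theorem theorem3p4 (R : realType) :
  exists R0 : R, 0 < R0 /\
  exists C1 C2 : R, 0 < C1 /\ 0 < C2 /\
  forall beta : R, 0 < beta ->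
  let B := R0 * l0 beta in
  (* C^*(beta) and C^**(beta): may depend on beta, not on the probability space *)
  exists Cs Css : R, 0 < Cs /\ 0 < Css /\
  forall (d : measure_display) (T : measurableType d) (P : probability T R)
         (W Q1 Q2 L : R -> T -> R),
  standard_BM P W ->
  (forall w, reflected_solution beta 0 (2 * B) (W^~ w) (Q1^~ w) (Q2^~ w) (L^~ w)) ->
  (* (i) *)
  (forall y : R, (4 * B <= y)%R ->
     P [set w | (tau (Q2^~ w) y <= Xi0 B (Q2^~ w))%E]
       <= (C1 * expR (- (C2 * beta * (y - beta) / 2)))%:E)%E /\
  (* (ii) *)
  (forall y : R, (2 * B <= y)%R ->
     ((1 - expR (- (beta * R0 * l0 beta))) * expR (- (beta * (y - 2 * R0 * l0 beta))))%:E
       <= P [set w | (tau (Q2^~ w) y <= Xi0 B (Q2^~ w))%E])%E /\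
  (* (iii) *)
  (forall x : R, (18 * B <= x)%R ->
     P [set w | (tau (Q1^~ w) (- x) <= Xi0 B (Q2^~ w))%E]
       <= (Cs * expR (- ((x - 2 * beta) ^+ 2 / 8)))%:E)%E /\
  (* (iv) *)
  (forall x : R, (beta <= x)%R ->
     (Css * expR (- (x ^+ 2)))%:E
       <= P [set w | (ereal_inf [set (Q1 t w)%:E | t in
                        [set t | (0 <= t)%R /\ (t%:E <= Xi0 B (Q2^~ w))%E]]
                      < (- x)%:E)%E])%E.
Proof.
(* [8] makes [B >= 4 * (beta + 1 / beta)], since [l0] dominates both terms. For [y >= 4 * B] the
   exponent [beta / 4 * (3 * B - y + beta + 1 / beta)] is then at most [- beta * (y - beta) / 32],
   which is [1 / 16] in the stated normalisation. *)
exists 8; split => //; exists 1, (1 / 16); split => //; split => // beta beta0 B.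
have ib0 : 0 < beta^-1 by rewrite invr_gt0.
have lb : beta <= l0 beta by rewrite le_max lexx.
have lib : beta^-1 <= l0 beta by rewrite !le_max lexx orbT.
have B_large : 4 * (beta + beta^-1) <= B by rewrite /B; lra.
have B0 : 0 < B by lra.
have [Cs Cs0 H3] := tail_Q1_upper beta B beta0 B_large.
have [Css Css0 H4] := tail_Q1_lower beta B beta0 B0.
exists Cs, Css; split => //; split => // d T P W Q1 Q2 L BM sol; split; [|split; [|split]].
- move=> y yB.
  apply: (le_trans (tail_Q2_upper beta B beta0 B_large P W Q1 Q2 L BM sol y yB)).
  rewrite lee_fin mul1r ler_expR.
  have e : 3 * B - y + (beta + beta^-1) <= - ((y - beta) / 8) by lra.
  apply: (le_trans (ler_wpM2l (_ : 0 <= beta / 4) e)); first by rewrite divr_ge0// ltW.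
  by apply/eqr_leW; field.
- move=> y yB.
  have := tail_Q2_lower beta B beta0 B0 P W Q1 Q2 L BM sol y yB.
  by rewrite /B !mulrA.
- move=> x xB; apply: (H3 d T P W Q1 Q2 L BM sol); lra.
- move=> x xB; apply: (H4 d T P W Q1 Q2 L BM sol); lra.
Qed.
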